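(* Let $(M,\Sigma,\pi)$ be a non-planar, r-framed, 2-ruled 4-fold in $\mathbb{C}^4\cong\mathbb{R}^8$, with $\Sigma$ a connected real analytic 2-manifold, defined by orthogonal real analytic maps $\phi_1,\phi_2:\Sigma\to\mathcal{S}^7$ and a real analytic map $\psi:\Sigma\to\mathbb{R}^8$ by $$M=\{r_1\phi_1(\sigma)+r_2\phi_2(\sigma)+\psi(\sigma): r_1,r_2\in\mathbb{R},\ \sigma\in\Sigma\}.$$ Then $M$ is special Lagrangian if and only if $\omega(\phi_1,\phi_2)\equiv0$ and there exist, locally (near each point of $\Sigma$), oriented coordinates $(s,t)$ on $\Sigma$ such that $$\omega\Big(\phi_j,\frac{\partial\phi_k}{\partial s}\Big)\equiv0\ \ (j,k=1,2),\qquad \omega\Big(\phi_j,\frac{\partial\psi}{\partial s}\Big)\equiv0\ \ (j=1,2),$$ $$\frac{\partial\phi_1}{\partial t}=\phi_1\times\phi_2\times\frac{\partial\phi_1}{\partial s}+f\phi_2,\qquad \frac{\partial\phi_2}{\partial t}=\phi_1\times\phi_2\times\frac{\partial\phi_2}{\partial s}-f\phi_1,\qquad \frac{\partial\psi}{\partial t}=\phi_1\times\phi_2\times\frac{\partial\psi}{\partial s}+g_1\phi_1+g_2\phi_2$$ for some real analytic real-valued functions $f,g_1,g_2$ (defined on the domain of the coordinates), where $\times$ denotes the special Lagrangian triple cross product on $\mathbb{C}^4$ defined by $\operatorname{Re}\Omega$.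
   Context: Identify $\mathbb{R}^8\cong\mathbb{C}^4$ by $z_1=x_1+ix_2$, $z_2=x_3+ix_4$, $z_3=x_5+ix_6$, $z_4=x_7+ix_8$, with Euclidean metric $g$. Let $\omega=\frac{i}{2}\sum_{j=1}^4dz_j\wedge d\bar z_j$ and $\Omega=dz_1\wedge dz_2\wedge dz_3\wedge dz_4$. A real 4-dimensional submanifold of $\mathbb{C}^4$ is special Lagrangian (with phase 1) if, for a suitable orientation, $\operatorname{Re}\Omega$ restricts to the Riemannian volume form on each of its tangent spaces. The triple cross product used here is defined by $g(x\times y\times z,w)=\operatorname{Re}\Omega(x,y,z,w)$ for all $w\in\mathbb{C}^4$. A 2-ruled 4-fold $(M,\Sigma,\pi)$ in $\mathbb{R}^n$ is an (immersed) 4-dimensional submanifold $M$ with a smooth map $\pi:M\to\Sigma$ to a 2-manifold such that every fibre $\pi^{-1}(\sigma)$ is an affine 2-plane. An r-framing is a smoothly varying choice of oriented orthonormal basis $(\phi_1(\sigma),\phi_2(\sigma))$ of (the direction of) each fibre; $M$ is then the image of $\iota_M:\mathbb{R}^2\times\Sigma\to\mathbb{R}^n$, $\iota_M(r_1,r_2,\sigma)=r_1\phi_1(\sigma)+r_2\phi_2(\sigma)+\psi(\sigma)$. ''Orthogonal'' maps means $g(\phi_1,\phi_2)\equiv0$. $M$ may have singularities, namely points where $\iota_M$ fails to be an immersion, provided these form a nowhere dense subset of each fibre $\mathbb{R}^2\times\{\sigma\}$; ''special Lagrangian'' then refers to the nonsingular part. ''Non-planar'' means that $M$ is not contained in an affine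 4-plane. Local coordinates $(s,t)$ on $\Sigma$ are oriented if $\Phi(\phi_1,\phi_2,\partial\iota_M/\partial s,\partial\iota_M/\partial t)>0$ at the points where $\iota_M$ is an immersion, where $\Phi=\frac12\omega\wedge\omega+\operatorname{Re}\Omega$. *)

(* Defs.v *)
From HB Require Import structures.
From mathcomp Require Import all_boot all_order all_fingroup all_algebra.
From mathcomp Require Import all_classical all_reals all_analysis.
From mathcomp Require Import complex ring.
Set Implicit Arguments.
Unset Strict Implicit.
Unset Printing Implicit Defensive.
Import Order.TTheory GRing.Theory Num.Theory.
Import numFieldNormedType.Exports.
Local Open Scope classical_set_scope.
Local Open Scope ring_scope.

Section Forms.
Context {R : realType}.
Implicit Types x y z w : 'rV[R]_8.

Definition inner x y : R := \sum_(k < 8) x 0 k * y 0 k.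

(* With coordinates of R^8 and C^4 numbered from 1, this is
   z_(j+1) = x_(2j+1) + i x_(2j+2). *)
Definition zcoord (j : 'I_4) x : R[i] :=
  Complex (x 0 (inord j.*2)) (x 0 (inord j.*2.+1)).

Definition wedge11 (a b : 'rV[R]_8 -> R[i]) x y : R[i] := a x * b y - a y * b x.

Definition omegaC x y : R[i] :=
  Complex 0 1 / 2%:R *
    \sum_(j < 4) wedge11 (zcoord j) (fun v => conjc (zcoord j v)) x y.

Definition omega x y : R := complex.Re (omegaC x y).

Definition quad x y z w : 'I_4 -> 'rV[R]_8 := tnth [tuple x; y; z; w].

(* (dz_1 /\ dz_2 /\ dz_3 /\ dz_4)(v_1, ..., v_4) = det (dz_j(v_i)) *)
Definition Omega (v : 'I_4 -> 'rV[R]_8) : R[i] :=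
  \det (\matrix_(i < 4, j < 4) zcoord j (v i)).

Definition ReOmega x y z w : R := complex.Re (Omega (quad x y z w)).

(* wedge product of two 2-forms, with the normalization 1 / (2! 2!) *)
Definition wedge22 (a b : 'rV[R]_8 -> 'rV[R]_8 -> R) (v : 'I_4 -> 'rV[R]_8) : R :=
  (2%:R * 2%:R)^-1 *
  \sum_(s : 'S_4) (-1) ^+ odd_perm s *
    a (v (s (@Ordinal 4 0 isT))) (v (s (@Ordinal 4 1 isT))) *
    b (v (s (@Ordinal 4 2 isT))) (v (s (@Ordinal 4 3 isT))).

Definition Cayley x y z w : R :=
  2%:R^-1 * wedge22 omega omega (quad x y z w) + ReOmega x y z w.

(* the vector dual to ReOmega x y z, see crossP and cross_unique *)
Definition cross x y z : 'rV[R]_8 := \row_k ReOmega x y z (delta_mx 0 k).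

End Forms.

Section Analytic.
Context {R : realType}.

(* f is, near x, the sum of an absolutely convergent double power series *)
Definition analytic_at (f : 'rV[R]_2 -> R) (x : 'rV[R]_2) : Prop :=
  exists (a : nat -> nat -> R) (rho : R), 0 < rho /\
    forall h : 'rV[R]_2, `|h| < rho ->
      summable [set: nat * nat]
        (fun k => (a k.1 k.2 * h 0 0 ^+ k.1 * h 0 1 ^+ k.2)%:E) /\
      (fun n : nat => \sum_(i < n) \sum_(j < n) a i j * h 0 0 ^+ i * h 0 1 ^+ j)
        @ \oo --> f (x + h).

Definition vanalytic_at m (f : 'rV[R]_2 -> 'rV[R]_m) (x : 'rV[R]_2) : Prop :=
  forall k, analytic_at (fun y => f y 0 k) x.

End Analytic.

Section Charts.
Context {R : realType} {S : topologicalType}.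

(* Only the values of cmap on cdom and of cinv on cmap @` cdom matter. *)
Record chart := Chart {
  cdom : set S;
  cmap : S -> 'rV[R]_2;
  cinv : 'rV[R]_2 -> S;
  cdom_open : open cdom;
  cimg_open : open (cmap @` cdom);
  cmapK : forall u, cdom u -> cinv (cmap u) = u;
  cmap_continuous : forall u, cdom u -> {for u, continuous cmap};
  cinv_continuous : forall u, cdom u -> {for cmap u, continuous cinv}
}.

Definition transition_analytic (c c' : chart) : Prop :=
  forall u, cdom c u -> cdom c' u -> vanalytic_at (cmap c' \o cinv c) (cmap c u).

Definition compatible (c c' : chart) : Prop :=
  transition_analytic c c' /\ transition_analytic c' c.

(* partial derivatives with respect to the coordinates (s, t) given by c *)
Definition partial_s m (c : chart) (f : S -> 'rV[R]_m) (u : S) : 'rV[R]_m :=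
  'D_(delta_mx 0 0) (f \o cinv c) (cmap c u).
Definition partial_t m (c : chart) (f : S -> 'rV[R]_m) (u : S) : 'rV[R]_m :=
  'D_(delta_mx 0 1) (f \o cinv c) (cmap c u).

End Charts.
Arguments chart : clear implicits.

Record analyticSurface (R : realType) := AnalyticSurface {
  surface_space :> topologicalType;
  atlas : set (chart R surface_space);
  surface_hausdorff : hausdorff_space surface_space;
  surface_second_countable : @second_countable surface_space;
  atlas_cover : forall u, exists2 c, atlas c & cdom c u;
  atlas_compatible : forall c c', atlas c -> atlas c' -> compatible c c'
}.

Section Surfaces.
Context {R : realType} {S : analyticSurface R}.

Definition coordinates (c : chart R S) : Prop :=
  forall c', atlas c' -> compatible c c'.

Definition analytic_map m (f : S -> 'rV[R]_m) : Prop :=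
  forall c u, atlas c -> cdom c u -> vanalytic_at (f \o cinv c) (cmap c u).

Definition analytic_on_chart (c : chart R S) (f : S -> R) : Prop :=
  forall u, cdom c u -> analytic_at (f \o cinv c) (cmap c u).

End Surfaces.

Definition nowhere_dense (T : topologicalType) (A : set T) : Prop :=
  interior (closure A) = set0.

Section Ruled.
Context {R : realType} {S : analyticSurface R}.
Variables phi1 phi2 psi : S -> 'rV[R]_8.

(* (r 0 0, r 0 1) is (r_1, r_2) *)
Definition iota_M (r : 'rV[R]_2) (u : S) : 'rV[R]_8 :=
  r 0 0 *: phi1 u + r 0 1 *: phi2 u + psi u.

Definition local_iota (c : chart R S) (y : 'rV[R]_(2 + 2)) : 'rV[R]_8 :=
  iota_M (lsubmx y) (cinv c (rsubmx y)).

(* The rows span the image of the differential of iota_M at p. *)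
Definition tangent_mx (c : chart R S) (p : 'rV[R]_2 * S) : 'M[R]_(2 + 2, 8) :=
  jacobian (local_iota c) (row_mx p.1 (cmap c p.2)).

(* row_free: the differential of iota_M at p is injective *)
Definition immersion_at (p : 'rV[R]_2 * S) : Prop :=
  exists c, [/\ atlas c, cdom c p.2 & row_free (tangent_mx c p)].

Definition singularities_nowhere_dense : Prop :=
  forall u : S, nowhere_dense [set r : 'rV[R]_2 | ~ immersion_at (r, u)].

Definition planar : Prop :=
  exists (q : 'rV[R]_8) (W : 'M[R]_(4, 8)),
    row_free W /\ forall r u, (iota_M r u - q <= W)%MS.

(* An orientation of the nonsingular part, presented by a (possibly
   discontinuous) choice of oriented orthonormal bases E p of its tangent
   spaces.  For p' near p, the sign of det (E p' (E p)^T) compares the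
   orientation at p' with the one at p through orthogonal projection, so the
   last clause says that the orientation is locally constant. *)
Definition orientation (E : 'rV[R]_2 * S -> 'M[R]_(4, 8)) : Prop :=
  [/\ forall p, immersion_at p -> E p *m (E p)^T = 1%:M,
      forall p c, immersion_at p -> atlas c -> cdom c p.2 ->
        (E p :=: tangent_mx c p)%MS &
      forall p, immersion_at p ->
        \forall p' \near p, immersion_at p' -> 0 < \det (E p' *m (E p)^T)].

(* \det (v *m (E p)^T) is the Riemannian volume form of the tangent space
   oriented by E p, evaluated at the rows of v. *)
Definition special_lagrangian : Prop :=
  exists2 E, orientation E &
    forall p, immersion_at p -> forall v : 'M[R]_(4, 8), (v <= E p)%MS ->
      complex.Re (Omega (fun i => row i v)) = \det (v *m (E p)^T).

Definition oriented_coordinates (c : chart R S) : Prop :=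
  coordinates c /\
  forall u r, cdom c u -> immersion_at (r, u) ->
    0 < Cayley (phi1 u) (phi2 u) (partial_s c (iota_M r) u)
          (partial_t c (iota_M r) u).

End Ruled.

Section FormsTheory.
Context {R : realType}.
Implicit Types x y z w : 'rV[R]_8.

Lemma omegaCE x y :
  omegaC x y = (\sum_(j < 4) (x 0 (inord j.*2) * y 0 (inord j.*2.+1)
                              - x 0 (inord j.*2.+1) * y 0 (inord j.*2)))%:C%C.
Proof.
rewrite /omegaC mulr_sumr rmorph_sum /=; apply: eq_bigr => j _.
rewrite /wedge11 /zcoord /=.
set a := x _ _; set b := x _ _; set c := y _ _; set d := y _ _.
have n2 : (2%:R : R[i]) != 0 by rewrite pnatr_eq0.
apply: (mulfI n2); rewrite mulrA mulrCA mulfV // mulr1.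
rewrite mulr_natl mulr2n; simpc; congr Complex.
  by ring.
by ring.
Qed.

Lemma omegaE x y :
  omega x y = \sum_(j < 4) (x 0 (inord j.*2) * y 0 (inord j.*2.+1)
                            - x 0 (inord j.*2.+1) * y 0 (inord j.*2)).
Proof. by rewrite /omega omegaCE. Qed.

Lemma ReOmega_coord x y z w :
  ReOmega x y z w = \sum_(k < 8) ReOmega x y z (delta_mx 0 k) * w 0 k.
Proof.
have zE j : zcoord j w = \sum_(k < 8) zcoord j (delta_mx 0 k) * (w 0 k)%:C%C.
  have -> : zcoord j w = (w 0 (inord j.*2))%:C%C
                       + Complex 0 1 * (w 0 (inord j.*2.+1))%:C%C.
    by rewrite /zcoord; simpc.
  transitivity (\sum_(k < 8) ((inord j.*2 == k)%:R * (w 0 k)%:C%C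
                 + Complex 0 1 * (inord j.*2.+1 == k)%:R * (w 0 k)%:C%C)).
    rewrite big_split /=; congr (_ + _).
      rewrite (bigD1 (inord j.*2)) //= eqxx mul1r big1 ?addr0 // => k.
      by rewrite eq_sym => /negPf ->; rewrite mul0r.
    rewrite (bigD1 (inord j.*2.+1)) //= eqxx mulr1 big1 ?addr0 // => k.
    by rewrite eq_sym => /negPf ->; rewrite mulr0 mul0r.
  apply: eq_bigr => k _; rewrite -mulrDl; congr (_ * _).
  rewrite /zcoord !mxE eqxx /= -!(rmorph_nat (real_complex R)) /=.
  by simpc.
have expand v : Omega (quad x y z v) = \sum_j zcoord j v *
    cofactor (\matrix_(a < 4, b < 4) zcoord b (quad x y z 0 a)) ord_max j.
  rewrite /Omega (expand_det_row _ ord_max); apply: eq_bigr => j _.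
  rewrite mxE; congr (_ * _); rewrite /cofactor; congr (_ * \det _).
  apply/matrixP => a b; rewrite !mxE.
  by case: a => -[|[|[|]]].
rewrite /ReOmega expand; under eq_bigr do rewrite zE mulr_suml.
rewrite exchange_big /= raddf_sum; apply: eq_bigr => k _ /=.
rewrite expand.
have -> (c : R[i]) (a : R) : complex.Re c * a = complex.Re (c * a%:C%C).
  by case: c => ? ?; simpc.
congr complex.Re; rewrite mulr_suml; apply: eq_bigr => j _.
by rewrite mulrAC.
Qed.

Lemma crossP x y z w : inner (cross x y z) w = ReOmega x y z w.
Proof. by rewrite ReOmega_coord; apply: eq_bigr => k _; rewrite mxE. Qed.

Lemma cross_unique x y z v :
  (forall w, inner v w = ReOmega x y z w) -> v = cross x y z.
Proof.
move=> H; apply/rowP => k; rewrite mxE -H /inner (bigD1 k) //= big1.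
  by rewrite mxE !eqxx mulr1 addr0.
by move=> l /negPf lk; rewrite mxE lk andbF mulr0.
Qed.

End FormsTheory.

(* Main.v *)
Require Import Defs.
From HB Require Import structures.
From mathcomp Require Import all_boot all_order all_fingroup all_algebra.
From mathcomp Require Import all_classical all_reals all_analysis.
From mathcomp Require Import complex ring lra.
Set Implicit Arguments.
Unset Strict Implicit.
Unset Printing Implicit Defensive.
Import Order.TTheory GRing.Theory Num.Theory.
Import numFieldNormedType.Exports.
Local Open Scope classical_set_scope.
Local Open Scope ring_scope.

(* Write [J = cross p q] for orthonormal [p = phi1], [q = phi2] with
   [omega p q = 0]: on the complex orthogonal of p and q it is an isometry with
   [J^2 = -1], and a 4-plane containing p, q is special Lagrangian iff it is
   spanned by p, q, v, J v with v in that orthogonal.  Given the equations, the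
   tangent planes are of this form, whence the "if" part.

   Conversely, let [chi = iota_M r] for an immersion point (r, u) and let a bar
   denote the component orthogonal to p and q.  The special Lagrangian condition
   says that [bar chi_t] is a combination [X bar chi_s + Y J (bar chi_s)]; solving
   the analytic Beltrami equation with coefficients X, Y gives coordinates in which
   [bar chi_t = J (bar chi_s)].  In these coordinates the condition on every other
   [iota_M r'] shows that either [bar phi_t = J phi_s] for both phi's, which is the
   required system, or all first derivatives of phi1, phi2 lie in
   [W = span (p, q, v, J v)], v = bar chi_s.  In the second case comparing mixed
   derivatives modulo W shows that W is locally constant; by analytic continuation
   over the connected surface M lies in an affine 4-plane, which is excluded. *)

(** * Weighted norms of polynomials in two variables *)

Section WeightedNorm.
Context {R : realFieldType}.

Lemma ler_double (x : R) : 0 <= x -> x <= 2 * x.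
Proof. by move=> x0; rewrite ler_peMl // ler1n. Qed.

Lemma natr_le_exp2 n : n%:R <= 2 ^+ n :> R.
Proof. by rewrite -natrX ler_nat ltnW // ltn_expl. Qed.

Record ring_seminorm (A : comNzRingType) (nu : A -> R) : Prop := RingSeminorm {
  snorm0 : nu 0 = 0;
  snorm_ge0 : forall x, 0 <= nu x;
  snormD : forall x y, nu (x + y) <= nu x + nu y;
  snormN : forall x, nu (- x) = nu x;
  snormM : forall x y, nu (x * y) <= nu x * nu y;
  snorm1 : nu 1 <= 1
}.

Definition pnorm (A : comNzRingType) (nu : A -> R) (rho : R) (p : {poly A}) : R :=
  \sum_(i < size p) nu p`_i * rho ^+ i.

Section Pnorm.
Context {A : comNzRingType} {nu : A -> R}.
Hypothesis nuP : ring_seminorm nu.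

Lemma snorm_sum (I : Type) (r : seq I) (P : pred I) (F : I -> A) :
  nu (\sum_(i <- r | P i) F i) <= \sum_(i <- r | P i) nu (F i).
Proof.
elim/big_ind2 : _ => //; first by rewrite (snorm0 nuP).
by move=> x1 x2 y1 y2 h1 h2; apply: le_trans (snormD nuP _ _) (lerD h1 h2).
Qed.

Lemma snormX x i : nu (x ^+ i) <= nu x ^+ i.
Proof.
elim: i => [|i IH]; first by rewrite !expr0 (snorm1 nuP).
rewrite !exprS; apply: le_trans (snormM nuP _ _) _.
by rewrite ler_wpM2l // (snorm_ge0 nuP).
Qed.

Lemma snormX_le x (r : R) i : nu x <= r -> nu (x ^+ i) <= r ^+ i.
Proof.
move=> xr; apply: le_trans (snormX _ _) _.
by rewrite lerXn2r // nnegrE ?(le_trans _ xr) ?(snorm_ge0 nuP).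
Qed.

Lemma snormMn a n : nu (a *+ n) <= nu a *+ n.
Proof.
elim: n => [|n IH]; first by rewrite !mulr0n (snorm0 nuP).
by rewrite !mulrS; apply: le_trans (snormD nuP _ _) _; rewrite lerD2l.
Qed.

Lemma pnormE (rho : R) n (p : {poly A}) : (size p <= n)%N ->
  pnorm nu rho p = \sum_(i < n) nu p`_i * rho ^+ i.
Proof.
move=> pn; rewrite /pnorm (big_ord_widen n (fun i => nu p`_i * rho ^+ i) pn).
rewrite big_mkcond /=; apply: eq_bigr => i _; case: ltnP => // h.
by rewrite nth_default // (snorm0 nuP) mul0r.
Qed.

Variable rho : R.
Hypothesis rho0 : 0 <= rho.
Local Notation norm := (pnorm nu rho).

Lemma pnorm_ge0 p : 0 <= norm p.
Proof. by apply: sumr_ge0 => i _; rewrite mulr_ge0 ?exprn_ge0 ?(snorm_ge0 nuP). Qed.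

Lemma pnorm0 : norm 0 = 0.
Proof. by rewrite /pnorm size_poly0 big_ord0. Qed.

Lemma pnormN p : norm (- p) = norm p.
Proof.
rewrite /pnorm size_polyN; apply: eq_bigr => i _.
by rewrite coefN (snormN nuP).
Qed.

Lemma pnormD p q : norm (p + q) <= norm p + norm q.
Proof.
set n := maxn (size p) (size q).
rewrite (@pnormE _ n (p + q)) ?(leq_trans (size_polyD _ _)) //.
rewrite (@pnormE _ n p) ?leq_maxl // (@pnormE _ n q) ?leq_maxr //.
rewrite -big_split /=; apply: ler_sum => i _.
by rewrite coefD -mulrDl ler_wpM2r ?exprn_ge0 // (snormD nuP).
Qed.

Lemma pnormC c : norm c%:P = nu c.
Proof. by rewrite (@pnormE _ 1) ?size_polyC_leq1 // big_ord1 coefC eqxx expr0 mulr1. Qed.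

Lemma pnormMXaddC p c : norm (p * 'X + c%:P) = norm p * rho + nu c.
Proof.
have sz : (size (p * 'X + c%:P)%R <= (size p).+1)%N by rewrite size_MXaddC; case: ifP.
rewrite (pnormE _ sz) big_ord_recl coefD coefMX coefC !eqxx add0r expr0 mulr1.
rewrite addrC /pnorm mulr_suml; congr (_ + _); apply: eq_bigr => i _.
by rewrite coefD coefMX coefC /= /bump /= add1n addr0 exprSr mulrA.
Qed.

Lemma pnormMX p : norm (p * 'X) = norm p * rho.
Proof. by have := pnormMXaddC p 0; rewrite polyC0 (snorm0 nuP) !addr0. Qed.

Lemma pnormCM c p : norm (c%:P * p) <= nu c * norm p.
Proof.
rewrite mul_polyC (@pnormE _ (size p)) ?size_scale_leq // /pnorm mulr_sumr.
apply: ler_sum => i _; rewrite coefZ mulrA ler_wpM2r ?exprn_ge0 //.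
exact: snormM nuP _ _.
Qed.

Lemma pnormM p q : norm (p * q) <= norm p * norm q.
Proof.
elim/poly_ind: p => [|p c IH]; first by rewrite mul0r pnorm0 mul0r.
rewrite mulrDl pnormMXaddC mulrDl; apply: le_trans (pnormD _ _) _.
by apply: lerD (pnormCM _ _); rewrite !(mulrAC _ _ q) pnormMX mulrAC ler_wpM2r.
Qed.

Lemma pnorm_seminorm : ring_seminorm norm.
Proof.
split; [exact: pnorm0|exact: pnorm_ge0|exact: pnormD|exact: pnormN|exact: pnormM|].
by rewrite pnormC (snorm1 nuP).
Qed.

Lemma pnorm_polyX : norm 'X <= rho.
Proof.
by rewrite -['X]mul1r pnormMX pnormC ler_piMl // (snorm1 nuP).
Qed.

Lemma pnorm_le_radius sigma p : rho <= sigma -> norm p <= pnorm nu sigma p.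
Proof.
move=> rs; apply: ler_sum => i _; rewrite ler_wpM2l ?(snorm_ge0 nuP) //.
by rewrite lerXn2r // nnegrE // (le_trans rho0).
Qed.

Lemma pnorm_deriv p : norm p^`() * rho <= pnorm nu (2 * rho) p.
Proof.
rewrite -pnormMX (@pnormE _ (size p)); last first.
  case: (eqVneq p 0) => [->|p0]; first by rewrite deriv0 mul0r size_poly0.
  case: (eqVneq p^`() 0) => [->|d0]; first by rewrite mul0r size_poly0.
  by rewrite size_mulX // lt_size_deriv.
apply: ler_sum => -[[|i] hi] _ /=.
  by rewrite coefMX eqxx (snorm0 nuP) mul0r mulr_ge0 ?(snorm_ge0 nuP).
rewrite coefMX /= coef_deriv exprMn mulrCA mulrA ler_wpM2r ?exprn_ge0 //.
apply: le_trans (snormMn _ _) _.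
by rewrite -[leLHS]mulr_natl ler_wpM2r ?(snorm_ge0 nuP) // natr_le_exp2.
Qed.

End Pnorm.

Lemma pnorm_mono (A : comNzRingType) (mu nu : A -> R) rho p :
  0 <= rho -> (forall a, mu a <= nu a) -> pnorm mu rho p <= pnorm nu rho p.
Proof. by move=> r0 mn; apply: ler_sum => i _; rewrite ler_wpM2r ?exprn_ge0. Qed.

Definition horner_map (A B : comNzRingType) (f : A -> B) (p : {poly A}) (x : B) : B :=
  (map_poly f p).[x].

Section HornerMapMorphism.
Context {A B : comNzRingType}.

Lemma horner_map_is_additive (f : {additive A -> B}) x :
  zmod_morphism (fun p => horner_map f p x).
Proof. by move=> p q; rewrite /horner_map raddfB hornerD hornerN. Qed.

Lemma horner_map_is_multiplicative (f : {rmorphism A -> B}) x :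
  monoid_morphism (fun p => horner_map f p x).
Proof.
split; first by rewrite /horner_map rmorph1 hornerC.
by move=> p q; rewrite /horner_map rmorphM hornerM.
Qed.

Lemma horner_mapC (f : {additive A -> B}) c x : horner_map f c%:P x = f c.
Proof. by rewrite /horner_map map_polyC hornerC. Qed.

Lemma horner_mapX (f : {rmorphism A -> B}) x : horner_map f 'X x = x.
Proof. by rewrite /horner_map map_polyX hornerX. Qed.

Lemma horner_mapE (f : {additive A -> B}) p x :
  horner_map f p x = \sum_(i < size p) f p`_i * x ^+ i.
Proof.
rewrite /horner_map (@horner_coef_wide _ (size p)) ?size_poly //.
by apply: eq_bigr => i _; rewrite coef_map.
Qed.

End HornerMapMorphism.

Section HornerMapEstimates.
Context {A B : comNzRingType} {mu : A -> R} {nu : B -> R}.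
Hypotheses (muP : ring_seminorm mu) (nuP : ring_seminorm nu).
Variable rho : R.
Hypothesis rho0 : 0 <= rho.

Lemma horner_map_le (f : {additive A -> B}) p x :
  (forall a, nu (f a) <= mu a) -> nu x <= rho -> nu (horner_map f p x) <= pnorm mu rho p.
Proof.
move=> fb xr; rewrite horner_mapE; apply: le_trans (snorm_sum nuP _ _ _) _.
apply: ler_sum => i _; apply: le_trans (snormM nuP _ _) _.
by apply: ler_pM; rewrite ?(snorm_ge0 nuP) // snormX_le.
Qed.

Lemma expr_lipschitz (x y : B) i : nu x <= rho -> nu y <= rho ->
  nu (x ^+ i - y ^+ i) * rho <= (2 * rho) ^+ i * nu (x - y).
Proof.
move=> xr yr; elim: i => [|i IH].
  by rewrite !expr0 subrr (snorm0 nuP) mul0r mul1r (snorm_ge0 nuP).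
have -> : x ^+ i.+1 - y ^+ i.+1 = x * (x ^+ i - y ^+ i) + (x - y) * y ^+ i.
  by rewrite !exprS; ring.
set d := nu (x - y) in IH *; have d0 : 0 <= d by exact: snorm_ge0 nuP _.
have left_le : nu (x * (x ^+ i - y ^+ i)) <= rho * nu (x ^+ i - y ^+ i).
  by apply: le_trans (snormM nuP _ _) _; rewrite ler_wpM2r ?(snorm_ge0 nuP).
have right_le : nu ((x - y) * y ^+ i) <= d * rho ^+ i.
  by apply: le_trans (snormM nuP _ _) _; rewrite ler_wpM2l // snormX_le.
have pow_le : rho ^+ i <= (2 * rho) ^+ i.
  by rewrite lerXn2r ?nnegrE ?mulr_ge0 // ler_double.
apply: (@le_trans _ _ ((rho * nu (x ^+ i - y ^+ i) + d * rho ^+ i) * rho)).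
  by rewrite ler_wpM2r //; apply: le_trans (snormD nuP _ _) (lerD left_le right_le).
have -> : (rho * nu (x ^+ i - y ^+ i) + d * rho ^+ i) * rho
    = rho * (nu (x ^+ i - y ^+ i) * rho) + rho * d * rho ^+ i by ring.
have -> : (2 * rho) ^+ i.+1 * d = rho * ((2 * rho) ^+ i * d) + rho * d * (2 * rho) ^+ i.
  by rewrite exprS; ring.
by apply: lerD; rewrite ler_wpM2l // mulr_ge0.
Qed.

Lemma horner_map_lipschitz (f : {additive A -> B}) p x y :
  (forall a, nu (f a) <= mu a) -> nu x <= rho -> nu y <= rho ->
  nu (horner_map f p x - horner_map f p y) * rho <= pnorm mu (2 * rho) p * nu (x - y).
Proof.
move=> fb xr yr; rewrite !horner_mapE -sumrB.
apply: (@le_trans _ _ ((\sum_(i < size p) nu (f p`_i * x ^+ i - f p`_i * y ^+ i)) * rho)).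
  by rewrite ler_wpM2r // (snorm_sum nuP).
rewrite /pnorm !mulr_suml; apply: ler_sum => i _.
rewrite -mulrBr; apply: (@le_trans _ _ (mu p`_i * (nu (x ^+ i - y ^+ i) * rho))).
  rewrite mulrA ler_wpM2r //; apply: le_trans (snormM nuP _ _) _.
  by rewrite ler_wpM2r ?(snorm_ge0 nuP).
by rewrite -mulrA ler_wpM2l ?(snorm_ge0 muP) // expr_lipschitz.
Qed.

Lemma horner_map_perturb (f g : {additive A -> B}) (mu' : A -> R) K p x :
  (forall a, nu (f a - g a) <= mu' a * K) -> nu x <= rho -> 0 <= K ->
  nu (horner_map f p x - horner_map g p x) <= pnorm mu' rho p * K.
Proof.
move=> fg xr K0; rewrite !horner_mapE -sumrB; apply: le_trans (snorm_sum nuP _ _ _) _.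
rewrite /pnorm mulr_suml; apply: ler_sum => i _; rewrite -mulrBl mulrAC.
apply: le_trans (snormM nuP _ _) _.
by apply: ler_pM; rewrite ?(snorm_ge0 nuP) // snormX_le.
Qed.

End HornerMapEstimates.
End WeightedNorm.

Notation poly2 R := {poly {poly R}}.

Lemma I2_cases (i : 'I_2) : i = 0 \/ i = 1.
Proof. by case: i => -[|[|]] // ?; [left|right]; apply/val_inj. Qed.

Lemma sum_I2 (V : nmodType) (F : 'I_2 -> V) : \sum_i F i = F 0 + F 1.
Proof.
rewrite big_ord_recl big_ord1; congr (F _ + F _); exact/val_inj.
Qed.

Section Bivariate.
Context {R : realFieldType}.
Implicit Types (p q : poly2 R) (rho sigma : R).

Lemma normr_seminorm : ring_seminorm (fun x : R => `|x|).
Proof.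
split=> [|x|x y|x|x y|]; rewrite ?normr0 ?normrN ?normrM ?normr1 //.
exact: ler_normD.
Qed.

Definition pnorm1 rho : {poly R} -> R := pnorm (fun x : R => `|x|) rho.
Definition pnorm2 rho : poly2 R -> R := pnorm (pnorm1 rho) rho.

Lemma pnorm1_seminorm rho : 0 <= rho -> ring_seminorm (pnorm1 rho).
Proof. exact: pnorm_seminorm normr_seminorm _. Qed.

Lemma pnorm2_seminorm rho : 0 <= rho -> ring_seminorm (pnorm2 rho).
Proof. by move=> r0; exact: pnorm_seminorm (pnorm1_seminorm r0) _ r0. Qed.

Lemma pnorm2_ge0 rho p : 0 <= rho -> 0 <= pnorm2 rho p.
Proof. by move=> /pnorm2_seminorm /snorm_ge0. Qed.

Lemma pnorm2_le_radius rho sigma p : 0 <= rho <= sigma -> pnorm2 rho p <= pnorm2 sigma p.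
Proof.
move=> /andP[r0 rs]; apply: le_trans (pnorm_le_radius (pnorm1_seminorm r0) r0 _ rs) _.
apply: pnorm_mono; first exact: le_trans r0 rs.
by move=> a; exact: pnorm_le_radius normr_seminorm _ r0 _ _ rs.
Qed.

Definition pvar (i : 'I_2) : poly2 R := if i == 0 then 'X else 'X%:P.
Definition pconst (c : R) : poly2 R := c%:P%:P.

Lemma pconst_is_additive : zmod_morphism pconst.
Proof. by move=> x y; rewrite /pconst !polyCB. Qed.

Lemma pconst_is_multiplicative : monoid_morphism pconst.
Proof. by split=> [|x y]; rewrite /pconst ?polyC1 // !polyCM. Qed.
HB.instance Definition _ :=
  GRing.isZmodMorphism.Build R (poly2 R) pconst pconst_is_additive.
HB.instance Definition _ :=
  GRing.isMonoidMorphism.Build R (poly2 R) pconst pconst_is_multiplicative.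

Lemma pnorm2_var rho i : 0 <= rho -> pnorm2 rho (pvar i) <= rho.
Proof.
move=> r0; rewrite /pnorm2 /pvar; case: ifP => _.
  exact: pnorm_polyX (pnorm1_seminorm r0) _ r0.
rewrite pnormC; last exact: pnorm1_seminorm.
exact: pnorm_polyX normr_seminorm _ r0.
Qed.

Lemma pnorm2_const rho c : 0 <= rho -> pnorm2 rho (pconst c) = `|c|.
Proof.
move=> r0; rewrite /pnorm2 pnormC; last exact: pnorm1_seminorm.
by rewrite /pnorm1 pnormC //; exact: normr_seminorm.
Qed.

Definition coef2 p i j : R := p`_i`_j.

Lemma poly2P p q : (forall i j, coef2 p i j = coef2 q i j) -> p = q.
Proof. by move=> h; apply/polyP => i; apply/polyP => j; exact: h. Qed.

Lemma coef2D p q i j : coef2 (p + q) i j = coef2 p i j + coef2 q i j.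
Proof. by rewrite /coef2 !coefD. Qed.

Lemma coef2B p q i j : coef2 (p - q) i j = coef2 p i j - coef2 q i j.
Proof. by rewrite /coef2 !coefB. Qed.

Lemma coef2_const c i j : coef2 (pconst c) i j = if (i + j == 0)%N then c else 0.
Proof.
rewrite /coef2 /pconst coefC addn_eq0; case: eqVneq => [_|i0]; first by rewrite coefC.
by rewrite coef0.
Qed.

Lemma coef2_constM c p i j : coef2 (pconst c * p) i j = c * coef2 p i j.
Proof. by rewrite /coef2 !coefCM. Qed.

Lemma coef2_var k i j :
  coef2 (pvar k) i j = ((i == (k == 0%R) :> nat) && (j == (k == 1%R) :> nat))%:R.
Proof.
rewrite /coef2 /pvar; have [->|->] := I2_cases k => /=.
  by rewrite coefX; case: (i == 1%N); rewrite ?coef0 // coef1.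
by rewrite coefC; case: (i == 0%N); rewrite ?coef0 // coefX.
Qed.

Lemma coef2M p q i j : coef2 (p * q) i j =
  \sum_(k < i.+1) \sum_(l < j.+1) coef2 p k l * coef2 q (i - k) (j - l).
Proof.
by rewrite /coef2 coefM coef_sum; apply: eq_bigr => k _; rewrite coefM.
Qed.

Definition deg2 p : nat := maxn (size p) (sizeY p).

Lemma pnorm2E rho n p : 0 <= rho -> (deg2 p <= n)%N ->
  pnorm2 rho p = \sum_(i < n) \sum_(j < n) `|coef2 p i j| * rho ^+ (i + j).
Proof.
rewrite geq_max => r0 /andP[pX pY].
rewrite /pnorm2 (pnormE (pnorm1_seminorm r0) _ pX); apply: eq_bigr => i _.
rewrite /pnorm1 (pnormE normr_seminorm _ (n := n)); last first.
  exact: leq_trans (max_size_coefXY _ _) pY.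
by rewrite mulr_suml; apply: eq_bigr => j _; rewrite -mulrA exprD (mulrC (rho ^+ j)).
Qed.

Lemma rectangle_sum_le_square (F : nat -> nat -> R) m1 m2 n :
  (forall i j, 0 <= F i j) -> (m1 <= n)%N -> (m2 <= n)%N ->
  \sum_(i < m1) \sum_(j < m2) F i j <= \sum_(i < n) \sum_(j < n) F i j.
Proof.
move=> F0 m1n m2n; rewrite (big_ord_widen n (fun i => \sum_(j < m2) F i j) m1n).
rewrite big_mkcond /=; apply: ler_sum => i _; case: ifP => _; last exact: sumr_ge0.
rewrite (big_ord_widen n (fun j => F i j) m2n).
by rewrite big_mkcond /=; apply: ler_sum => j _; case: ifP.
Qed.

Lemma square_sum_le_pnorm2 rho n p : 0 <= rho ->
  \sum_(i < n) \sum_(j < n) `|coef2 p i j| * rho ^+ (i + j) <= pnorm2 rho p.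
Proof.
move=> r0; rewrite (@pnorm2E _ (maxn n (deg2 p))) ?leq_maxr //.
apply: (@rectangle_sum_le_square (fun i j => `|coef2 p i j| * rho ^+ (i + j))).
- by move=> i j; rewrite mulr_ge0 ?exprn_ge0.
- exact: leq_maxl.
- exact: leq_maxl.
Qed.

Lemma coef2_le_pnorm2 rho p i j : 0 <= rho ->
  `|coef2 p i j| * rho ^+ (i + j) <= pnorm2 rho p.
Proof.
move=> r0; apply: le_trans (square_sum_le_pnorm2 (maxn i j).+1 p r0).
have i_lt : (i < (maxn i j).+1)%N by rewrite ltnS leq_maxl.
have j_lt : (j < (maxn i j).+1)%N by rewrite ltnS leq_maxr.
have F0 k l : 0 <= `|coef2 p k l| * rho ^+ (k + l) by rewrite mulr_ge0 ?exprn_ge0.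
rewrite (bigD1 (Ordinal i_lt)) //= (bigD1 (Ordinal j_lt)) //= -addrA lerDl.
by apply: addr_ge0; apply: sumr_ge0 => // k _; apply: sumr_ge0.
Qed.

Lemma pnorm2_le_termwise rho sigma K p q : 0 <= rho -> 0 <= sigma -> 0 <= K ->
  (forall i j, `|coef2 p i j| * rho ^+ (i + j) <= K * (`|coef2 q i j| * sigma ^+ (i + j))) ->
  pnorm2 rho p <= K * pnorm2 sigma q.
Proof.
move=> r0 s0 K0 pq; rewrite (pnorm2E r0 (leqnn (deg2 p))).
apply: (@le_trans _ _ (K * \sum_(i < deg2 p) \sum_(j < deg2 p)
    `|coef2 q i j| * sigma ^+ (i + j))); last by rewrite ler_wpM2l // square_sum_le_pnorm2.
rewrite mulr_sumr; apply: ler_sum => i _; rewrite mulr_sumr.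
by apply: ler_sum => j _.
Qed.

Lemma pnorm2_le_coef rho p q : 0 <= rho ->
  (forall i j, `|coef2 p i j| <= `|coef2 q i j|) -> pnorm2 rho p <= pnorm2 rho q.
Proof.
move=> r0 pq; rewrite -[leRHS]mul1r; apply: pnorm2_le_termwise => // i j.
by rewrite mul1r ler_wpM2r ?exprn_ge0.
Qed.

Lemma pnorm2_swapXY rho p : 0 <= rho -> pnorm2 rho (swapXY p) = pnorm2 rho p.
Proof.
have swap_le q : 0 <= rho -> pnorm2 rho (swapXY q) <= pnorm2 rho q.
  move=> r0; rewrite (pnorm2E r0 (leqnn _)) exchange_big /=.
  apply: le_trans (square_sum_le_pnorm2 (deg2 (swapXY q)) q r0).
  by do 2 (apply: ler_sum => ? _); rewrite /coef2 coef_swapXY addnC.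
by move=> r0; apply/le_anti; rewrite swap_le //= -{1}(swapXYK p) swap_le.
Qed.

Definition pderiv (i : 'I_2) p : poly2 R :=
  if i == 0 then p^`() else swapXY (swapXY p)^`().

Lemma pderiv_is_additive i : zmod_morphism (pderiv i).
Proof. by move=> p q; rewrite /pderiv; case: ifP => _; rewrite ?raddfB //= derivB raddfB. Qed.
HB.instance Definition _ i :=
  GRing.isZmodMorphism.Build (poly2 R) (poly2 R) (pderiv i) (pderiv_is_additive i).

Lemma pderivM i p q : pderiv i (p * q) = pderiv i p * q + p * pderiv i q.
Proof.
rewrite /pderiv; case: ifP => _; first exact: derivM.
by rewrite [swapXY (p * q)]rmorphM derivM rmorphD /= 2![swapXY (_ * _)]rmorphM /= !swapXYK.
Qed.

Lemma coef2_pderiv i p k l : coef2 (pderiv i p) k l =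
  if i == 0 then coef2 p k.+1 l *+ k.+1 else coef2 p k l.+1 *+ l.+1.
Proof.
rewrite /coef2 /pderiv; case: ifP => _; first by rewrite coef_deriv coefMn.
by rewrite coef_swapXY coef_deriv coefMn coef_swapXY.
Qed.

Lemma pderiv_comm p : pderiv 0 (pderiv 1 p) = pderiv 1 (pderiv 0 p).
Proof. by apply: poly2P => i j; rewrite !coef2_pderiv /= -!mulrnA mulnC. Qed.

Lemma pderiv_const i c : pderiv i (pconst c) = 0.
Proof.
apply: poly2P => k l; rewrite coef2_pderiv !coef2_const addnS addSn /= !mul0rn.
by rewrite !if_same.
Qed.

Lemma pderiv_var i j : pderiv i (pvar j) = (i == j)%:R.
Proof.
rewrite -[RHS](rmorph_nat pconst); apply: poly2P => k l.
rewrite coef2_pderiv !coef2_var coef2_const.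
by have [->|->] := I2_cases i; have [->|->] := I2_cases j;
  case: k => [|[|k]]; case: l => [|[|l]]; rewrite /= ?mulr0n ?mulr1n ?mul0rn.
Qed.

Lemma pnorm2_pderiv i rho p : 0 <= rho -> pnorm2 rho (pderiv i p) * rho <= pnorm2 (2 * rho) p.
Proof.
move=> r0; have r2 : 0 <= 2 * rho by lra.
have outer q : pnorm2 rho q^`() * rho <= pnorm2 (2 * rho) q.
  apply: le_trans (pnorm_deriv (pnorm1_seminorm r0) r0 q) _; apply: pnorm_mono => // a.
  exact: pnorm_le_radius normr_seminorm _ r0 _ _ (ler_double r0).
rewrite /pderiv; case: ifP => _ //.
by rewrite pnorm2_swapXY // -[in leRHS](swapXYK p) [leRHS]pnorm2_swapXY.
Qed.

Definition lin_coef (i : 'I_2) p : R := if i == 0 then coef2 p 1 0 else coef2 p 0 1.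

Lemma lin_coefE i p : lin_coef i p = coef2 (pderiv i p) 0 0.
Proof. by rewrite coef2_pderiv /lin_coef; case: ifP. Qed.

Definition nonaffine_part p : poly2 R :=
  p - (pconst (coef2 p 0 0) + \sum_i pconst (lin_coef i p) * pvar i).

Lemma coef2_nonaffine_part p i j :
  coef2 (nonaffine_part p) i j = if (i + j < 2)%N then 0 else coef2 p i j.
Proof.
rewrite /nonaffine_part sum_I2 coef2B !coef2D coef2_const !coef2_constM !coef2_var /lin_coef.
by case: i => [|[|i]]; case: j => [|[|j]];
  rewrite /= ?mulr0 ?mulr1 ?addr0 ?add0r ?subrr ?subr0.
Qed.

Lemma nonaffine_partB p q : nonaffine_part (p - q) = nonaffine_part p - nonaffine_part q.
Proof.
apply: poly2P => i j; rewrite coef2B !coef2_nonaffine_part coef2B.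
by case: ifP; rewrite ?subr0.
Qed.

Lemma pnorm2_nonaffine_part rho p : 0 <= rho -> pnorm2 rho (nonaffine_part p) <= pnorm2 rho p.
Proof.
move=> r0; apply: pnorm2_le_coef => // i j.
by rewrite coef2_nonaffine_part; case: ifP; rewrite ?normr0.
Qed.

Lemma pnorm2_nonaffine_part_scale rho sigma p : 0 <= sigma <= rho ->
  pnorm2 sigma (nonaffine_part p) * rho ^+ 2 <= sigma ^+ 2 * pnorm2 rho p.
Proof.
move=> /andP[s0 sr]; have r0 := le_trans s0 sr.
apply: le_trans (_ : sigma ^+ 2 * pnorm2 rho (nonaffine_part p) <= _); last first.
  by rewrite ler_wpM2l ?exprn_ge0 // pnorm2_nonaffine_part.
rewrite !(pnorm2E _ (leqnn (deg2 (nonaffine_part p)))) // mulr_suml mulr_sumr.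
apply: ler_sum => i _; rewrite mulr_suml mulr_sumr; apply: ler_sum => j _.
rewrite coef2_nonaffine_part; case: ltnP => ij; first by rewrite normr0 !mul0r mulr0.
rewrite -mulrA [leRHS]mulrCA; apply: ler_wpM2l => //.
rewrite -(subnKC ij); set k := (_ - _)%N.
rewrite (exprD sigma 2 k) (exprD rho 2 k) -mulrA ler_wpM2l ?exprn_ge0 //.
by rewrite [leRHS]mulrC ler_wpM2r ?exprn_ge0 // lerXn2r // nnegrE.
Qed.

Section Evaluation.
Context {B : comNzRingType} {nu : B -> R}.
Hypothesis nuP : ring_seminorm nu.
Variable f : {rmorphism R -> B}.
Hypothesis f_contraction : forall a, nu (f a) <= `|a|.
Implicit Types z : 'I_2 -> B.

Definition eval1 (y : B) (q : {poly R}) : B := horner_map f q y.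
HB.instance Definition _ y :=
  GRing.isZmodMorphism.Build {poly R} B (eval1 y) (horner_map_is_additive f y).
HB.instance Definition _ y :=
  GRing.isMonoidMorphism.Build {poly R} B (eval1 y) (horner_map_is_multiplicative f y).

Definition eval2 z p : B := horner_map (eval1 (z 1)) p (z 0).
HB.instance Definition _ z := GRing.isZmodMorphism.Build (poly2 R) B (eval2 z)
  (horner_map_is_additive (eval1 (z 1)) (z 0)).
HB.instance Definition _ z := GRing.isMonoidMorphism.Build (poly2 R) B (eval2 z)
  (horner_map_is_multiplicative (eval1 (z 1)) (z 0)).

Lemma eval2_var z i : eval2 z (pvar i) = z i.
Proof.
rewrite /eval2 /pvar; have [->|->] := I2_cases i => /=; first exact: horner_mapX.
by rewrite horner_mapC; exact: horner_mapX.
Qed.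

Lemma eval2_const z c : eval2 z (pconst c) = f c.
Proof. by rewrite /eval2 horner_mapC; exact: horner_mapC. Qed.

Lemma eval2E z n p : (deg2 p <= n)%N ->
  eval2 z p = \sum_(i < n) \sum_(j < n) f (coef2 p i j) * z 0 ^+ i * z 1 ^+ j.
Proof.
rewrite geq_max => /andP[pX pY]; rewrite /eval2 /horner_map (@horner_coef_wide _ n); last first.
  exact: leq_trans (size_poly _ _) pX.
apply: eq_bigr => i _; rewrite coef_map /=.
have -> : eval1 (z 1) p`_i = (map_poly f p`_i).[z 1] by [].
rewrite (@horner_coef_wide _ n); last first.
  exact: leq_trans (size_poly _ _) (leq_trans (max_size_coefXY _ _) pY).
by rewrite mulr_suml; apply: eq_bigr => j _; rewrite coef_map mulrAC.
Qed.

Lemma eval2_le rho z p : (forall i, nu (z i) <= rho) -> nu (eval2 z p) <= pnorm2 rho p.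
Proof.
move=> zr; have r0 := le_trans (snorm_ge0 nuP (z 0)) (zr 0).
apply: (@horner_map_le _ _ _ (pnorm1 rho) nu nuP rho (eval1 (z 1))) => // q.
exact: horner_map_le.
Qed.

Lemma eval2_lipschitz rho z w p :
  (forall i, nu (z i) <= rho) -> (forall i, nu (w i) <= rho) ->
  nu (eval2 z p - eval2 w p) * rho <= pnorm2 (2 * rho) p * \sum_i nu (z i - w i).
Proof.
move=> zr wr; have r0 := le_trans (snorm_ge0 nuP (z 0)) (zr 0).
have r2 : 0 <= 2 * rho by lra.
have -> : eval2 z p - eval2 w p
    = (eval2 z p - horner_map (eval1 (z 1)) p (w 0))
      + (horner_map (eval1 (z 1)) p (w 0) - eval2 w p).
  by rewrite addrA subrK.
apply: le_trans (ler_wpM2r r0 (snormD nuP _ _)) _; rewrite sum_I2 mulrDl mulrDr; apply: lerD.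
  apply: le_trans (_ : pnorm (pnorm1 rho) (2 * rho) p * nu (z 0 - w 0) <= _).
    apply: (@horner_map_lipschitz _ _ _ (pnorm1 rho) nu (pnorm1_seminorm r0) nuP rho r0
      (eval1 (z 1))) => // q.
    exact: horner_map_le.
  rewrite ler_wpM2r ?(snorm_ge0 nuP) //; apply: pnorm_mono => // a.
  exact: pnorm_le_radius normr_seminorm _ r0 _ _ (ler_double r0).
have [rz|rp] := eqVneq rho 0.
  by rewrite rz mulr0 mulr_ge0 ?(snorm_ge0 nuP) ?pnorm2_ge0 ?mulr0.
have rho_gt0 : 0 < rho by rewrite lt_def rp.
rewrite -ler_pdivlMr // -mulrA.
apply: le_trans (_ : pnorm (pnorm1 (2 * rho)) rho p * (nu (z 1 - w 1) / rho) <= _).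
  apply: (@horner_map_perturb _ _ _ nu nuP rho (eval1 (z 1)) (eval1 (w 1))) => //; last first.
    by rewrite divr_ge0 ?(snorm_ge0 nuP).
  move=> q; rewrite mulrA ler_pdivlMr //.
  exact: (@horner_map_lipschitz _ _ _ _ nu normr_seminorm nuP rho r0 f).
rewrite ler_wpM2r ?divr_ge0 ?(snorm_ge0 nuP) //.
by apply: pnorm_le_radius; [exact: pnorm1_seminorm | exact: r0 | exact: ler_double].
Qed.

End Evaluation.

Definition peval (h : 'rV[R]_2) : poly2 R -> R := eval2 idfun (h 0).
HB.instance Definition _ h := GRing.RMorphism.copy (peval h) (eval2 idfun (h 0)).

Definition psubst (s : 'I_2 -> poly2 R) : poly2 R -> poly2 R := eval2 pconst s.
HB.instance Definition _ (s : 'I_2 -> poly2 R) :=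
  GRing.RMorphism.copy (psubst s) (eval2 pconst s).

Lemma psubstB s p q : psubst s (p - q) = psubst s p - psubst s q.
Proof. exact: raddfB. Qed.

Lemma peval_var i h : peval h (pvar i) = h 0 i.
Proof. exact: eval2_var. Qed.

Lemma peval_const c h : peval h (pconst c) = c.
Proof. exact: eval2_const. Qed.

Lemma peval_psubst h s p : peval h (psubst s p) = peval (\row_i peval h (s i)) p.
Proof.
rewrite /psubst (eval2E _ _ (leqnn (deg2 p))) /peval (eval2E _ _ (leqnn (deg2 p))) !mxE.
rewrite !raddf_sum; apply: eq_bigr => i _; rewrite raddf_sum; apply: eq_bigr => j _.
by rewrite /= !rmorphM !rmorphXn /= eval2_const.
Qed.

Lemma peval0 p : peval 0 p = coef2 p 0 0.
Proof.
rewrite /peval (eval2E _ _ (leqnSn (deg2 p))) !mxE !big_ord_recl /=.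
rewrite !expr0 !mulr1 big1 ?addr0 => [|i _]; last by rewrite /= expr0n mulr0.
by rewrite big1 ?addr0 // => i _; apply: big1 => j _; rewrite /= expr0n mulr0 mul0r.
Qed.

Lemma psubst_le rho sigma s p : 0 <= sigma ->
  (forall i, pnorm2 sigma (s i) <= rho) -> pnorm2 sigma (psubst s p) <= pnorm2 rho p.
Proof.
move=> s0; apply: eval2_le; first exact: pnorm2_seminorm.
by move=> a; rewrite pnorm2_const.
Qed.

Lemma psubst_lipschitz rho sigma s t p : 0 <= sigma ->
  (forall i, pnorm2 sigma (s i) <= rho) -> (forall i, pnorm2 sigma (t i) <= rho) ->
  pnorm2 sigma (psubst s p - psubst t p) * rho
    <= pnorm2 (2 * rho) p * \sum_i pnorm2 sigma (s i - t i).
Proof.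
move=> s0; apply: eval2_lipschitz; first exact: pnorm2_seminorm.
by move=> a; rewrite pnorm2_const.
Qed.

Lemma derivation_ext (D E : {additive poly2 R -> R}) (h : 'rV[R]_2) :
  (forall p q, D (p * q) = D p * peval h q + peval h p * D q) ->
  (forall p q, E (p * q) = E p * peval h q + peval h p * E q) ->
  (forall c, D (pconst c) = E (pconst c)) -> (forall i, D (pvar i) = E (pvar i)) -> D =1 E.
Proof.
move=> DM EM eC eV; elim/poly_ind => [|p c IH]; first by rewrite !raddf0.
rewrite !raddfD /= DM EM IH (eV 0); congr (_ + _).
elim/poly_ind: c => [|c a IHc]; first by rewrite !raddf0.
by rewrite polyCD polyCM !raddfD /= DM EM IHc (eV 1) (eC a).
Qed.

Definition recenter (k : 'rV[R]_2) : poly2 R -> poly2 R :=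
  psubst (fun i => pvar i + pconst (k 0 i)).
HB.instance Definition _ k := GRing.RMorphism.copy (recenter k)
  (psubst (fun i => pvar i + pconst (k 0 i))).

Lemma coef2_recenter k p : coef2 (recenter k p) 0 0 = peval k p.
Proof.
rewrite -peval0 peval_psubst; congr (peval _ p); apply/rowP => i.
by rewrite mxE raddfD /= peval_var peval_const mxE add0r.
Qed.

Lemma lin_coef_recenter i k p : lin_coef i (recenter k p) = peval k (pderiv i p).
Proof.
pose D : {additive poly2 R -> R} := peval 0 \o pderiv i \o recenter k.
pose E : {additive poly2 R -> R} := peval k \o pderiv i.
rewrite lin_coefE -peval0; apply: (@derivation_ext D E k) => [u v|u v|c|j] /=.
- by rewrite rmorphM pderivM rmorphD !rmorphM /= !peval0 !coef2_recenter.
- by rewrite pderivM rmorphD !rmorphM.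
- by rewrite /recenter /psubst eval2_const !pderiv_const !raddf0.
- by rewrite /recenter /psubst eval2_var raddfD /= pderiv_const addr0 pderiv_var !rmorph_nat.
Qed.

End Bivariate.

(** * Power series and polynomial approximation *)

Section RowVectorNorm.
Context {R : realType} {n : nat}.
Implicit Types h : 'rV[R]_n.

Lemma coord_norm_le h i : `|h 0 i| <= `|h|.
Proof.
by rewrite [leRHS]/Num.norm /= mx_normrE; apply/bigmax_geP; right; exists (0, i).
Qed.

Lemma rV_norm_le h (r : R) : 0 <= r -> (forall i, `|h 0 i| <= r) -> `|h| <= r.
Proof.
move=> r0 hr; rewrite /Num.norm /= mx_normrE; apply/bigmax_leP; split=> // -[i j] _ /=.
by rewrite (ord1 i).
Qed.

End RowVectorNorm.

Section SquareSums.
Context {R : realType}.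
Implicit Types F : nat * nat -> R.

Let square n : set (nat * nat) := [set k | (k.1 < n)%N && (k.2 < n)%N].

Let fsbig_square F n :
  (\sum_(k \in square n) (F k)%:E = (\sum_(i < n) \sum_(j < n) F (i : nat, j : nat))%:E)%E.
Proof.
pose s := [seq (i, j) | i <- index_iota 0 n, j <- index_iota 0 n].
have -> : square n = [set` s].
  apply/seteqP; split=> -[i j] /=; last first.
    by move=> /allpairsP[[k l] /= [+ + [-> ->]]]; rewrite !mem_index_iota /square /= => -> ->.
  by move=> /andP[ni nj]; apply/allpairsP; exists (i, j); rewrite !mem_index_iota.
rewrite -fsbig_seq; last by apply: allpairs_uniq; rewrite ?iota_uniq // => -[? ?] [? ?].
rewrite big_allpairs big_mkord -sumEFin; apply: eq_bigr => i _.
by rewrite big_mkord -sumEFin.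
Qed.

Let finite_square n : finite_set (square n).
Proof.
apply: (@sub_finite_set _ _ (`I_n `*` `I_n)); last exact: finite_setX.
by move=> k /= /andP[].
Qed.

Lemma square_sums_bounded_summable F (M : R) :
  (forall n, \sum_(i < n) \sum_(j < n) `|F (i : nat, j : nat)| <= M) ->
  summable [set: nat * nat] (fun k => (F k)%:E).
Proof.
move=> FM; apply: (@le_lt_trans _ _ M%:E); last exact: ltry.
apply: ge_ereal_sup => _ /= [X [finX _]] <-.
pose n := (\max_(k <- finmap.enum_fset (fset_set X)) maxn k.1 k.2).+1.
have Xn : X `<=` square n.
  move=> k Xk; rewrite /square /= !ltnS -geq_max.
  apply: (@leq_bigmax_seq _ _ predT (fun k => maxn k.1 k.2)) => //.
  by rewrite in_fset_set // mem_set.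
apply: (@le_trans _ _ (\sum_(k \in square n) `|F k|%:E)%E).
  by apply: lee_fsum_nneg_subset => // k; rewrite !inE => /Xn.
by rewrite (fsbig_square (fun k => `|F k|)) lee_fin FM.
Qed.

Lemma summable_square_sums_bounded F : summable [set: nat * nat] (fun k => (F k)%:E) ->
  exists M : R, forall n, \sum_(i < n) \sum_(j < n) `|F (i : nat, j : nat)| <= M.
Proof.
rewrite summableE => Ffin; exists (fine (\esum_(k in [set: nat * nat]) `|(F k)%:E|)%E) => n.
rewrite -lee_fin fineK //; apply: esum_ge; exists (square n); first by split.
by rewrite (fsbig_square (fun k => `|F k|)).
Qed.

End SquareSums.

Section Approximation.
Context {R : realType}.
Implicit Types (rho sigma C M : R) (f g : 'rV[R]_2 -> R) (x h : 'rV[R]_2).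
Implicit Types (p q : poly2 R) (P Q : nat -> poly2 R) (a b : nat -> nat -> R).

Lemma cvgn_le (u : nat -> R) (l K : R) : u @ \oo --> l -> (forall n, u n <= K) -> l <= K.
Proof. by move=> ul uK; apply: (cvgr_to_le ul); exact: nearW. Qed.

Lemma is_cvgn_geometric_increments (u : nat -> R) C :
  (forall n, `|u n.+1 - u n| <= C / 2 ^+ n) -> cvgn u.
Proof.
move=> hu; have -> : u = (fun n => u 0%N + series (telescope u) n).
  by apply/funext => n; rewrite -eq_sum_telescope.
apply: is_cvgD; first exact: is_cvg_cst.
apply: normed_cvg; apply: (@series_le_cvg _ _ (geometric C (2^-1))).
- by move=> n; rewrite normr_ge0.
- move=> n; rewrite /geometric /= exprVn.
  by apply: le_trans (hu n); rewrite normr_ge0.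
- by move=> n /=; rewrite /telescope /geometric /= exprVn.
- by apply: is_cvg_geometric_series; rewrite ger0_norm ?invr_ge0 // invf_lt1 // ltr1n.
Qed.

Lemma geometric_eventually_le C (e : R) : 0 < e -> exists n, C / 2 ^+ n <= e.
Proof.
move=> e0; have : `|2^-1 : R| < 1 by rewrite ger0_norm ?invr_ge0 // invf_lt1 // ltr1n.
move=> /(cvg_geometric C) /cvgrPdist_le /(_ e e0)[n _ /(_ n (leqnn n)) /= le_e].
exists n; apply: le_trans le_e; rewrite sub0r normrN /geometric /= exprVn.
exact: ler_norm.
Qed.

Lemma peval_le rho p h : `|h| <= rho -> `|peval h p| <= pnorm2 rho p.
Proof.
move=> hr; apply: (eval2_le normr_seminorm) => // i.
exact: le_trans (coord_norm_le _ _) hr.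
Qed.

Lemma peval_lipschitz rho h k p : `|h| <= rho -> `|k| <= rho ->
  `|peval h p - peval k p| * rho <= pnorm2 (2 * rho) p * \sum_i `|h 0 i - k 0 i|.
Proof.
move=> hr kr; apply: (eval2_lipschitz normr_seminorm (f := idfun)) => // i;
  exact: le_trans (coord_norm_le _ _) _.
Qed.

Definition geometric_rate rho P : Prop :=
  exists C, forall n, pnorm2 rho (P n.+1 - P n) <= C / 2 ^+ n.

Lemma geometric_rate_const_ge0 rho P C : 0 <= rho ->
  (forall n, pnorm2 rho (P n.+1 - P n) <= C / 2 ^+ n) -> 0 <= C.
Proof.
by move=> r0 /(_ 0%N); rewrite expr0 divr1; apply: le_trans; exact: pnorm2_ge0.
Qed.

Lemma geometric_rate_tail rho P C : 0 <= rho ->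
  (forall n, pnorm2 rho (P n.+1 - P n) <= C / 2 ^+ n) ->
  forall n k, pnorm2 rho (P (k + n)%N - P n) <= 2 * C / 2 ^+ n.
Proof.
move=> r0 hC n k; have nP := pnorm2_seminorm r0.
have C0 := geometric_rate_const_ge0 r0 hC.
have pow_ge0 m : 0 <= (2 ^+ m)^-1 :> R by rewrite invr_ge0 exprn_ge0.
suff : pnorm2 rho (P (k + n)%N - P n) <= 2 * C / 2 ^+ n - 2 * C / 2 ^+ (k + n).
  by move=> h; apply: le_trans h _; rewrite gerBl !mulr_ge0.
elim: k => [|k IH]; first by rewrite !subrr (snorm0 nP).
rewrite addSn -[P _ - P n](subrKA (P (k + n)%N)).
apply: le_trans (snormD nP _ _) _; apply: le_trans (lerD (hC _) IH) _.
rewrite exprS invfM; move: (2 ^+ (k + n))^-1 (2 ^+ n)^-1 (pow_ge0 (k + n)%N) => s t s0.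
lra.
Qed.

Lemma geometric_rate_bounded rho P : 0 <= rho -> geometric_rate rho P ->
  exists2 M : R, 0 < M & forall n, pnorm2 rho (P n) <= M.
Proof.
move=> r0 [C hC]; have nP := pnorm2_seminorm r0.
have C0 := geometric_rate_const_ge0 r0 hC; have P0 := pnorm2_ge0 (P 0%N) r0.
exists (pnorm2 rho (P 0%N) + 2 * C + 1) => [|n]; first by lra.
have := geometric_rate_tail r0 hC 0 n; rewrite expr0 divr1 addn0 => tail.
rewrite -(subrK (P 0%N) (P n)); apply: le_trans (snormD nP _ _) _; lra.
Qed.

Lemma is_cvgn_coef2 rho P i j : 0 < rho -> geometric_rate rho P ->
  cvgn (fun n => coef2 (P n) i j).
Proof.
move=> r0 [C hC]; apply: (@is_cvgn_geometric_increments _ (C / rho ^+ (i + j))) => n.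
rewrite -coef2B mulrAC ler_pdivlMr ?exprn_gt0 //.
by apply: le_trans (hC n); apply: coef2_le_pnorm2; exact: ltW.
Qed.

Definition papprox f x rho P : Prop :=
  [/\ 0 < rho, geometric_rate rho P
    & forall h, `|h| <= rho -> peval h (P n) @[n --> \oo] --> f (x + h)].

Lemma papprox_error f x rho P C h : papprox f x rho P ->
  (forall n, pnorm2 rho (P n.+1 - P n) <= C / 2 ^+ n) -> `|h| <= rho ->
  forall n, `|f (x + h) - peval h (P n)| <= 2 * C / 2 ^+ n.
Proof.
move=> [r0 _ hf] hC hr n; apply: (@cvgn_le (fun k => `|peval h (P (k + n)%N) - peval h (P n)|)).
  apply: cvg_norm; apply: cvgB; last exact: cvg_cst.
  by rewrite (cvg_shiftn n (fun k => peval h (P k))); exact: hf.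
move=> k; rewrite -raddfB; apply: le_trans (peval_le _ hr) _.
exact: geometric_rate_tail (ltW r0) hC n k.
Qed.

Lemma papprox_limit x rho P : 0 < rho -> geometric_rate rho P ->
  papprox (fun z => limn (fun n => peval (z - x) (P n))) x rho P.
Proof.
move=> r0 hP; split=> // h hr; rewrite addrC addKr.
have [C hC] := hP; apply: (@is_cvgn_geometric_increments _ C) => n.
by rewrite -raddfB; apply: le_trans (peval_le _ hr) (hC n).
Qed.

Definition ptrunc a n : poly2 R := \poly_(i < n) \poly_(j < n) a i j.

Lemma coef2_ptrunc a n i j :
  coef2 (ptrunc a n) i j = if (i < n)%N && (j < n)%N then a i j else 0.
Proof.
by rewrite /coef2 coef_poly; case: ltnP => _ /=; rewrite ?coef0 // coef_poly.
Qed.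

Lemma deg2_ptrunc a n : (deg2 (ptrunc a n) <= n)%N.
Proof.
rewrite geq_max size_poly /=; apply/bigmax_leqP => i _; rewrite coef_poly.
by case: ifP => _; rewrite ?size_poly ?size_poly0.
Qed.

Lemma ptruncB a b n : ptrunc (fun i j => a i j - b i j) n = ptrunc a n - ptrunc b n.
Proof.
by apply: poly2P => i j; rewrite coef2B !coef2_ptrunc; case: ifP; rewrite ?subr0.
Qed.

Lemma ptruncN a n : ptrunc (fun i j => - a i j) n = - ptrunc a n.
Proof.
by apply: poly2P => i j; rewrite /coef2 !coefN -!/(coef2 _ _ _) !coef2_ptrunc;
  case: ifP; rewrite ?oppr0.
Qed.

Lemma ptrunc_coef2 p n : (deg2 p <= n)%N -> ptrunc (coef2 p) n = p.
Proof.
rewrite geq_max => /andP[pX pY]; apply: poly2P => i j; rewrite coef2_ptrunc.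
case: ltnP => [_|ni] /=; last by rewrite /coef2 (nth_default _ (leq_trans pX ni)) coef0.
case: ltnP => // nj; rewrite /coef2 (@nth_default _ 0 p`_i) //.
exact: leq_trans (max_size_coefXY _ _) (leq_trans pY nj).
Qed.

Lemma pnorm2_ptrunc rho a n : 0 <= rho ->
  pnorm2 rho (ptrunc a n) = \sum_(i < n) \sum_(j < n) `|a i j| * rho ^+ (i + j).
Proof.
move=> r0; rewrite (pnorm2E r0 (deg2_ptrunc a n)).
by apply: eq_bigr => i _; apply: eq_bigr => j _; rewrite coef2_ptrunc !ltn_ord.
Qed.

Lemma pnorm2_ptrunc_coef2 rho p n : 0 <= rho ->
  pnorm2 rho (ptrunc (coef2 p) n) <= pnorm2 rho p.
Proof. by move=> r0; rewrite pnorm2_ptrunc // square_sum_le_pnorm2. Qed.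

Lemma peval_ptrunc a n h :
  peval h (ptrunc a n) = \sum_(i < n) \sum_(j < n) a i j * h 0 0 ^+ i * h 0 1 ^+ j.
Proof.
rewrite /peval (eval2E _ _ (deg2_ptrunc a n)).
by apply: eq_bigr => i _; apply: eq_bigr => j _; rewrite coef2_ptrunc !ltn_ord.
Qed.

Lemma coef2_ptrunc_cvg a i j : coef2 (ptrunc a n) i j @[n --> \oo] --> a i j.
Proof.
apply: cvg_near_cst; exists (maxn i j).+1 => // n /=; rewrite gtn_max => /andP[ni nj].
by rewrite coef2_ptrunc ni nj.
Qed.

Lemma peval_ptrunc_cvg (a_ : nat -> nat -> nat -> R) a h m :
  (forall i j, a_ n i j @[n --> \oo] --> a i j) ->
  peval h (ptrunc (a_ n) m) @[n --> \oo] --> peval h (ptrunc a m).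
Proof.
move=> a_a; under eq_cvg do rewrite peval_ptrunc; rewrite peval_ptrunc.
apply: cvg_big => [|i _]; first exact: add_continuous.
apply: cvg_big => [|j _]; first exact: add_continuous.
by do 2 apply: cvgMr_tmp; exact: a_a.
Qed.

Lemma pnorm2_ptrunc_cvg (a_ : nat -> nat -> nat -> R) a rho m : 0 <= rho ->
  (forall i j, a_ n i j @[n --> \oo] --> a i j) ->
  pnorm2 rho (ptrunc (a_ n) m) @[n --> \oo] --> pnorm2 rho (ptrunc a m).
Proof.
move=> r0 a_a; under eq_cvg do rewrite pnorm2_ptrunc //; rewrite pnorm2_ptrunc //.
apply: cvg_big => [|i _]; first exact: add_continuous.
apply: cvg_big => [|j _]; first exact: add_continuous.
by apply: cvgMr_tmp; apply: cvg_norm; exact: a_a.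
Qed.

Definition pseries f x rho a : Prop :=
  [/\ 0 < rho, exists M, forall n, pnorm2 rho (ptrunc a n) <= M
    & forall h, `|h| <= rho -> peval h (ptrunc a n) @[n --> \oo] --> f (x + h)].

(* Halving the radius turns plain boundedness into geometric decay. *)
Lemma ptrunc_geometric_rate rho a M : 0 < rho ->
  (forall n, pnorm2 rho (ptrunc a n) <= M) -> geometric_rate (rho / 2) (ptrunc a).
Proof.
move=> r0 hM; have r20 : 0 < rho / 2 by lra.
exists M => n; apply: (@le_trans _ _ ((2 ^+ n)^-1 * pnorm2 rho (ptrunc a n.+1))); last first.
  by rewrite mulrC ler_wpM2r ?invr_ge0 ?exprn_ge0.
apply: pnorm2_le_termwise; rewrite ?invr_ge0 ?exprn_ge0 ?ltW // => i j.
have rhs_ge0 : 0 <= (2 ^+ n)^-1 * (`|coef2 (ptrunc a n.+1) i j| * rho ^+ (i + j)).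
  by rewrite !mulr_ge0 ?invr_ge0 ?exprn_ge0 // ltW.
have [ij|] := ltnP (i + j) n.
  have [i_lt j_lt] := (leq_ltn_trans (leq_addr j i) ij, leq_ltn_trans (leq_addl i j) ij).
  rewrite (_ : coef2 _ i j = 0) ?normr0 ?mul0r // coef2B !coef2_ptrunc.
  by rewrite i_lt j_lt !ltnS (ltnW i_lt) (ltnW j_lt) subrr.
move=> n_le; apply: (@le_trans _ _ (`|coef2 (ptrunc a n.+1) i j| * (rho / 2) ^+ (i + j))).
  rewrite ler_wpM2r ?exprn_ge0 ?(ltW r20) // coef2B !coef2_ptrunc.
  case: (boolP ((i < n)%N && (j < n)%N)) => [/andP[i_lt j_lt]|_]; last by rewrite subr0.
  by rewrite !ltnS (ltnW i_lt) (ltnW j_lt) subrr normr0.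
rewrite mulrCA ler_wpM2l // exprMn mulrC ler_wpM2r ?exprn_ge0 ?(ltW r0) //.
by rewrite exprVn lef_pV2 ?posrE ?exprn_gt0 // ler_weXn2l ?ler1n.
Qed.

Lemma pseries_papprox f x rho a : pseries f x rho a -> papprox f x (rho / 2) (ptrunc a).
Proof.
move=> [r0 [M hM] hf]; split; [by lra|exact: ptrunc_geometric_rate hM|].
by move=> h hr; apply: hf; lra.
Qed.

Lemma papprox_pseries f x rho P a : papprox f x rho P ->
  (forall i j, coef2 (P n) i j @[n --> \oo] --> a i j) -> pseries f x rho a.
Proof.
move=> fP aP; have [r0 rP _] := fP; have [C hC] := rP.
have [M M0 hM] := geometric_rate_bounded (ltW r0) rP.
split=> //.
  exists M => m; apply: (cvgn_le (pnorm2_ptrunc_cvg (ltW r0) aP)) => n.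
  exact: le_trans (pnorm2_ptrunc_coef2 _ _ (ltW r0)) (hM n).
move=> h hr; have error := papprox_error fP hC hr.
have trunc_error n m : `|peval h (ptrunc a m) - peval h (ptrunc (coef2 (P n)) m)| <= 2 * C / 2 ^+ n.
  apply: (@cvgn_le (fun k =>
      `|peval h (ptrunc (coef2 (P (k + n)%N)) m) - peval h (ptrunc (coef2 (P n)) m)|)).
    apply: cvg_norm; apply: cvgB; last exact: cvg_cst.
    apply: (@peval_ptrunc_cvg (fun k => coef2 (P (k + n)%N))) => i j.
    by rewrite (cvg_shiftn n (fun k => coef2 (P k) i j)).
  move=> k; rewrite -raddfB -ptruncB; apply: le_trans (peval_le _ hr) _.
  under [X in ptrunc X]eq_fun do under eq_fun do rewrite -coef2B.
  apply: le_trans (pnorm2_ptrunc_coef2 _ _ (ltW r0)) _.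
  exact: geometric_rate_tail (ltW r0) hC n k.
apply/cvgrPdist_le => e e0.
have [n small] : exists n, 2 * C / 2 ^+ n <= e / 2 by apply: geometric_eventually_le; lra.
exists (deg2 (P n)) => // m /= dm; have := trunc_error n m; rewrite ptrunc_coef2 // distrC => tm.
rewrite -(subrKA (peval h (P n))); apply: le_trans (ler_normD _ _) _.
by have := error n; lra.
Qed.

Lemma pseries_exists x rho a M : 0 < rho -> (forall n, pnorm2 rho (ptrunc a n) <= M) ->
  exists f, pseries f x (rho / 2) a.
Proof.
move=> r0 hM; have r20 : 0 < rho / 2 by lra.
have fP := papprox_limit x r20 (ptrunc_geometric_rate r0 hM).
by eexists; apply: papprox_pseries fP _ => i j; exact: coef2_ptrunc_cvg.
Qed.

Lemma papprox_pseries_lim f x rho P : papprox f x rho P ->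
  pseries f x rho (fun i j => limn (fun n => coef2 (P n) i j)).
Proof.
by move=> fP; have [r0 rP _] := fP; apply: papprox_pseries fP _ => i j; exact: is_cvgn_coef2 rP.
Qed.

Lemma pseries_analytic f x rho a : pseries f x rho a -> analytic_at f x.
Proof.
move=> [r0 [M hM] hf]; exists a, rho; split=> // h hr; split; last first.
  by under eq_cvg do rewrite -peval_ptrunc; exact: hf (ltW hr).
apply: (@square_sums_bounded_summable _ (fun k => a k.1 k.2 * h 0 0 ^+ k.1 * h 0 1 ^+ k.2) M) => n.
apply: le_trans (hM n); rewrite (pnorm2_ptrunc _ _ (ltW r0)).
apply: ler_sum => i _; apply: ler_sum => j _.
have coord_le k : `|h 0 k| <= rho := le_trans (coord_norm_le h k) (ltW hr).
rewrite /= -mulrA normrM ler_wpM2l // normrM exprD !normrX.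
by apply: ler_pM; rewrite ?exprn_ge0 // lerXn2r // nnegrE ltW.
Qed.

Lemma analytic_pseries f x : analytic_at f x -> exists rho a, pseries f x rho a.
Proof.
move=> [a [rho [r0 fa]]]; have r20 : 0 < rho / 2 by lra.
exists (rho / 2), a; split=> //; last first.
  by move=> h hr; under eq_cvg do rewrite peval_ptrunc; apply: (fa h _).2; lra.
pose h : 'rV[R]_2 := const_mx (rho / 2).
have hr : `|h| < rho.
  apply: (@le_lt_trans _ _ (rho / 2)); last by lra.
  by apply: rV_norm_le => [|i]; rewrite ?mxE ?(ger0_norm (ltW r20)) // ltW.
have [/summable_square_sums_bounded[M hM] _] := fa h hr.
exists M => n; rewrite (pnorm2_ptrunc _ _ (ltW r20)); apply: le_trans (hM n).
apply: ler_sum => i _; apply: ler_sum => j _; rewrite /= !mxE -mulrA -exprD normrM.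
by rewrite normrX (ger0_norm (ltW r20)).
Qed.

Lemma analytic_papprox f x : analytic_at f x -> exists rho P, papprox f x rho P.
Proof.
by move=> /analytic_pseries[rho [a /pseries_papprox fP]]; exists (rho / 2), (ptrunc a).
Qed.

Lemma papprox_analytic f x rho P : papprox f x rho P -> analytic_at f x.
Proof. by move=> /papprox_pseries_lim; exact: pseries_analytic. Qed.

Lemma pseries_le_radius f x rho sigma a :
  pseries f x rho a -> 0 < sigma <= rho -> pseries f x sigma a.
Proof.
move=> [r0 [M hM] hf] /andP[s0 sr]; split=> // [|h hs]; last by apply: hf; exact: le_trans hs sr.
by exists M => n; apply: le_trans (hM n); apply: pnorm2_le_radius; rewrite ltW.
Qed.

Lemma analytic_pseries_pair f g x : analytic_at f x -> analytic_at g x ->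
  exists rho a b, [/\ rho <= 1, pseries f x rho a & pseries g x rho b].
Proof.
move=> /analytic_pseries[r [a fa]] /analytic_pseries[s [b gb]].
have [[r0 _ _] [s0 _ _]] := (fa, gb); pose rho := Num.min 1 (Num.min r s).
have rho0 : 0 < rho by rewrite !lt_min ltr01 r0 s0.
exists rho, a, b; split; first by rewrite ge_min lexx.
  by apply: pseries_le_radius fa _; rewrite rho0 !ge_min lexx ?orbT.
by apply: pseries_le_radius gb _; rewrite rho0 !ge_min lexx ?orbT.
Qed.

Lemma pseries_near_eq f g x rho sigma a : pseries f x rho a -> pseries g x sigma a ->
  exists2 r, 0 < r & forall h, `|h| <= r -> f (x + h) = g (x + h).
Proof.
move=> [r0 _ hf] [s0 _ hg]; exists (Num.min rho sigma); first by rewrite lt_min r0.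
by move=> h; rewrite le_min => /andP[hr hs]; apply: cvg_unique (hf h hr) (hg h hs).
Qed.

End Approximation.

(** * Real analytic functions of two variables *)

Section PartialDerivatives.
Context {R : realType} {n : nat} {V : normedModType R}.
Implicit Types (F G : 'rV[R]_n -> V) (y : 'rV[R]_n) (i : 'I_n).

Definition partial i F y : V := 'D_(delta_mx 0 i) F y.

Lemma partialE i F y : differentiable F y -> partial i F y = 'd F y (delta_mx 0 i).
Proof. exact: deriveE. Qed.

Lemma partial_cst i (v : V) y : partial i (fun=> v) y = 0.
Proof. exact: derive_cst. Qed.

Lemma partialD i F G y : differentiable F y -> differentiable G y ->
  partial i (fun z => F z + G z) y = partial i F y + partial i G y.
Proof. by move=> dF dG; apply: (@deriveD _ _ _ F G); exact: diff_derivable. Qed.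

Lemma partial_near_eq i F G y : (\forall z \near y, F z = G z) -> partial i F y = partial i G y.
Proof. exact: near_eq_derive. Qed.

Lemma near_partial_eq i F G y : (\forall z \near y, F z = G z) ->
  \forall z \near y, partial i F z = partial i G z.
Proof.
by move=> /nbhs_interior; apply: filterS => z; exact: partial_near_eq.
Qed.

End PartialDerivatives.

Section ScalarPartialDerivatives.
Context {R : realType} {n : nat}.
Implicit Types (f g : 'rV[R]_n -> R) (y : 'rV[R]_n) (i : 'I_n).

Lemma partialM i f g y : differentiable f y -> differentiable g y ->
  partial i (fun z => f z * g z) y = partial i f y * g y + f y * partial i g y.
Proof.
move=> df dg; transitivity (f y * partial i g y + g y * partial i f y).
  by apply: deriveM; exact: diff_derivable.
by rewrite addrC (mulrC (g y)).
Qed.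

Lemma partial_sum i m (f : 'I_m -> 'rV[R]_n -> R) y : (forall j, differentiable (f j) y) ->
  partial i (fun z => \sum_(j < m) f j z) y = \sum_(j < m) partial i (f j) y.
Proof.
move=> df; rewrite -derive_sum => [|j]; last exact: diff_derivable.
by congr ('D__ _ y); apply/funext => z; rewrite fct_sumE.
Qed.

End ScalarPartialDerivatives.

Section RowVectorPartialDerivatives.
Context {R : realType} {n m : nat}.

Lemma differentiable_rV (V : normedModType R) (F : V -> 'rV[R]_m) y :
  (forall k, differentiable (fun z => F z 0 k) y) -> differentiable F y.
Proof.
move=> dF; have -> : F = \sum_(k < m) (fun z => F z 0 k *: (delta_mx 0 k : 'rV[R]_m)).
  by apply/funext => z; rewrite fct_sumE {1}(row_sum_delta (F z)).
by apply: differentiable_sum => k; apply: differentiableZl.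
Qed.

Lemma partial_coord i (F : 'rV[R]_n -> 'rV[R]_m) y k : differentiable F y ->
  partial i F y 0 k = partial i (fun z => F z 0 k) y.
Proof. by move=> dF; rewrite /partial derive_mx ?mxE //; exact: diff_derivable. Qed.

End RowVectorPartialDerivatives.

Section Neighborhoods.
Context {R : realType} {V : normedModType R}.

Lemma nbhs_shiftP (A : set V) x :
  nbhs x A <-> exists2 r : R, 0 < r & forall h, `|h| <= r -> A (x + h).
Proof.
split=> [/nbhs_ballP[e /= e0 eA]|[r r0 rA]].
  exists (e / 2) => [|h hr]; first by lra.
  by apply: eA; rewrite -ball_normE /= opprD addrA subrr add0r normrN; lra.
apply/nbhs_ballP; exists r => //= y; rewrite -ball_normE /= distrC => yr.
by rewrite -(subrK x y) addrC; apply: rA; exact: ltW.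
Qed.

Lemma differentiable_of_error_bound (W : normedModType R) (f : V -> W) (df : {linear V -> W}) x :
  continuous df ->
  (forall e : R, 0 < e -> \forall h \near 0, `|f (x + h) - (f x + df h)| <= e * `|h|) ->
  differentiable f x /\ 'd f x = df :> (V -> W).
Proof.
move=> dfc f_error; have E : f \o shift x = cst (f x) + df +o_ 0 id.
  apply/eqaddoP => e e0; have := f_error e e0; apply: filterS => h.
  by rewrite -![(_ + _ : _ -> _) _]/(_ + _) /= (addrC h x).
have D : 'd f x = df :> (_ -> _) by rewrite (diff_unique dfc E).
by split=> //; apply/diff_locallyP; rewrite D.
Qed.

End Neighborhoods.

Section LinearForm.
Context {R : realType} {n : nat}.

Definition linear_form (a : 'I_n -> R) (h : 'rV[R]_n) : R := \sum_i a i * h 0 i.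

Lemma linear_form_is_linear a : linear (linear_form a).
Proof.
move=> k u v; rewrite /linear_form /GRing.scale /= mulr_sumr -big_split /=.
by apply: eq_bigr => i _; rewrite !mxE; ring.
Qed.
HB.instance Definition _ a :=
  GRing.isLinear.Build R 'rV[R]_n R *:%R (linear_form a) (linear_form_is_linear a).

Lemma linear_form_continuous a : continuous (linear_form a).
Proof.
apply: continuous_big => [|i _ h]; first exact: add_continuous.
by apply: continuousM; [exact: cst_continuous|exact: coord_continuous].
Qed.

Lemma linear_form_delta a i : linear_form a (delta_mx 0 i) = a i.
Proof.
rewrite /linear_form (bigD1 i) //= mxE !eqxx mulr1 big1 ?addr0 // => j /negPf ji.
by rewrite mxE ji andbF mulr0.
Qed.

End LinearForm.

Definition rV2 (R : realType) (s t : R) : 'rV[R]_2 := \row_i (if i == 0 then s else t).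

Section AnalyticFunctions.
Context {R : realType}.
Implicit Types (rho sigma : R) (f g : 'rV[R]_2 -> R) (x y h : 'rV[R]_2) (i : 'I_2).
Implicit Types (P Q : nat -> poly2 R) (p q : poly2 R) (a b : nat -> nat -> R).

Lemma rV2P x y : x 0 0 = y 0 0 -> x 0 1 = y 0 1 -> x = y.
Proof. by move=> e0 e1; apply/rowP => i; case: (I2_cases i) => ->. Qed.

Lemma papprox_le_radius f x rho sigma P :
  papprox f x rho P -> 0 < sigma <= rho -> papprox f x sigma P.
Proof.
move=> [r0 [C hC] hf] /andP[s0 sr]; split=> // [|h hs]; last by apply: hf; exact: le_trans hs sr.
by exists C => n; apply: le_trans (hC n); apply: pnorm2_le_radius; rewrite (ltW s0).
Qed.

Lemma analytic_near_eq f g x : (\forall y \near x, f y = g y) ->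
  analytic_at f x -> analytic_at g x.
Proof.
move=> /nbhs_shiftP[r r0 fg] /analytic_papprox[rho [P fP]]; have [rho0 _ _] := fP.
have m0 : 0 < Num.min r rho <= rho by rewrite lt_min r0 rho0 ge_min lexx orbT.
have [min0 rP hf] := papprox_le_radius fP m0; apply: (@papprox_analytic _ _ _ (Num.min r rho) P).
by split=> // h hm; rewrite -fg; [exact: hf|apply: le_trans hm _; rewrite ge_min lexx].
Qed.

Lemma papprox_poly f x rho p : 0 < rho -> (forall h, peval h p = f (x + h)) ->
  papprox f x rho (fun=> p).
Proof.
move=> r0 pf; split=> // [|h hr]; last by rewrite pf; exact: cvg_cst.
by exists 0 => n; rewrite subrr mul0r (snorm0 (pnorm2_seminorm (ltW r0))).
Qed.

Lemma papprox_cst (c : R) x rho : 0 < rho -> papprox (fun=> c) x rho (fun=> pconst c).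
Proof. by move=> r0; apply: papprox_poly => // h; rewrite peval_const. Qed.

Lemma papprox_coord i x y rho : 0 < rho ->
  papprox (fun z : 'rV[R]_2 => (z - y) 0 i) x rho (fun=> pvar i + pconst ((x - y) 0 i)).
Proof.
move=> r0; apply: papprox_poly => // h.
by rewrite raddfD /= peval_var peval_const !mxE; ring.
Qed.

Lemma analytic_cst (c : R) x : analytic_at (fun=> c) x.
Proof. exact: papprox_analytic (papprox_cst c x ltr01). Qed.

Lemma analytic_coord i x : analytic_at (fun z : 'rV[R]_2 => z 0 i) x.
Proof.
rewrite (_ : (fun z => _) = (fun z : 'rV[R]_2 => (z - 0) 0 i)).
  exact: papprox_analytic (papprox_coord i x 0 ltr01).
by apply/funext => z; rewrite subr0.
Qed.

Lemma papproxD f g x rho P Q : papprox f x rho P -> papprox g x rho Q ->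
  papprox (fun z => f z + g z) x rho (fun n => P n + Q n).
Proof.
move=> [r0 [C hC] hf] [_ [D hD] hg]; split=> // [|h hr].
  exists (C + D) => n; rewrite opprD addrACA [leRHS]mulrDl.
  by apply: le_trans (snormD (pnorm2_seminorm (ltW r0)) _ _) (lerD _ _).
by under eq_cvg do rewrite raddfD; apply: cvgD; [exact: hf|exact: hg].
Qed.

Lemma papproxN f x rho P : papprox f x rho P -> papprox (fun z => - f z) x rho (fun n => - P n).
Proof.
move=> [r0 [C hC] hf]; split=> // [|h hr].
  by exists C => n; rewrite -opprD (snormN (pnorm2_seminorm (ltW r0))).
by under eq_cvg do rewrite raddfN; apply: cvgN; exact: hf.
Qed.

Lemma papproxM f g x rho P Q : papprox f x rho P -> papprox g x rho Q ->
  papprox (fun z => f z * g z) x rho (fun n => P n * Q n).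
Proof.
move=> [r0 hP hf] [_ hQ hg]; have nP := pnorm2_seminorm (ltW r0); split=> // [|h hr]; last first.
  by under eq_cvg do rewrite rmorphM; apply: cvgM; [exact: hf|exact: hg].
have [M M0 hM] := geometric_rate_bounded (ltW r0) hP.
have [N N0 hN] := geometric_rate_bounded (ltW r0) hQ.
have [[C hC] [D hD]] := (hP, hQ); exists (C * N + M * D) => n.
rewrite (_ : _ - _ = (P n.+1 - P n) * Q n.+1 + P n * (Q n.+1 - Q n)); last by ring.
apply: le_trans (snormD nP _ _) _; rewrite [leRHS]mulrDl; apply: lerD.
  apply: le_trans (snormM nP _ _) _; rewrite mulrAC.
  by apply: ler_pM => //; exact: snorm_ge0 nP _.
apply: le_trans (snormM nP _ _) _; rewrite -mulrA.
by apply: ler_pM => //; exact: snorm_ge0 nP _.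
Qed.

Lemma papprox_common_radius f g x y rho sigma P Q : papprox f x rho P -> papprox g y sigma Q ->
  exists2 tau, 0 < tau & [/\ tau <= rho, tau <= sigma, papprox f x tau P & papprox g y tau Q].
Proof.
move=> fP gQ; have [[r0 _ _] [s0 _ _]] := (fP, gQ).
have m0 : 0 < Num.min rho sigma by rewrite lt_min r0 s0.
exists (Num.min rho sigma) => //; split; rewrite ?ge_min ?lexx ?orbT //.
  by apply: papprox_le_radius fP _; rewrite m0 ge_min lexx.
by apply: papprox_le_radius gQ _; rewrite m0 ge_min lexx orbT.
Qed.

Lemma analyticD f g x : analytic_at f x -> analytic_at g x ->
  analytic_at (fun z => f z + g z) x.
Proof.
move=> /analytic_papprox[rho [P fP]] /analytic_papprox[sigma [Q gQ]].
have [tau _ [_ _ fP' gQ']] := papprox_common_radius fP gQ.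
exact: papprox_analytic (papproxD fP' gQ').
Qed.

Lemma analyticM f g x : analytic_at f x -> analytic_at g x ->
  analytic_at (fun z => f z * g z) x.
Proof.
move=> /analytic_papprox[rho [P fP]] /analytic_papprox[sigma [Q gQ]].
have [tau _ [_ _ fP' gQ']] := papprox_common_radius fP gQ.
exact: papprox_analytic (papproxM fP' gQ').
Qed.

Lemma analyticN f x : analytic_at f x -> analytic_at (fun z => - f z) x.
Proof.
move=> fx; under eq_fun do rewrite -mulN1r.
exact: analyticM (analytic_cst _ _) fx.
Qed.

Lemma analyticB f g x : analytic_at f x -> analytic_at g x ->
  analytic_at (fun z => f z - g z) x.
Proof. by move=> fx gx; apply: analyticD fx (analyticN gx). Qed.

Lemma analytic_sum n (F : 'I_n -> 'rV[R]_2 -> R) x :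
  (forall j, analytic_at (F j) x) -> analytic_at (fun z => \sum_(j < n) F j z) x.
Proof.
elim: n F => [|n IH] F hF.
  by under eq_fun do rewrite big_ord0; exact: analytic_cst.
by under eq_fun do rewrite big_ord_recr; apply: analyticD => //; exact: IH.
Qed.

Section ApproxComposition.
Variables (F : 'rV[R]_2 -> R) (y : 'rV[R]_2) (rho : R) (P : nat -> poly2 R).
Variables (G : 'rV[R]_2 -> 'rV[R]_2) (x : 'rV[R]_2) (sigma : R) (Q : 'I_2 -> nat -> poly2 R).
Hypotheses (FP : papprox F y (2 * rho) P)
  (GQ : forall i, papprox (fun z => G z 0 i) x sigma (Q i))
  (Q_le : forall i n, pnorm2 sigma (Q i n) <= rho).

Lemma papprox_comp_radius_gt0 : 0 < rho.
Proof. by have [+ _ _] := FP; rewrite pmulr_rgt0. Qed.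

Lemma geometric_rate_psubst : geometric_rate sigma (fun n => psubst (Q^~ n) (P n)).
Proof.
have r0 := papprox_comp_radius_gt0; have [r2 hP _] := FP.
have [M M0 hM] := geometric_rate_bounded (ltW r2) hP; have [C hC] := hP.
have [s0 [C0 hC0] _] := GQ 0; have [_ [C1 hC1] _] := GQ 1.
have nS := pnorm2_seminorm (ltW s0).
exists (C + M / rho * (C0 + C1)) => n.
have -> : psubst (Q^~ n.+1) (P n.+1) - psubst (Q^~ n) (P n)
  = psubst (Q^~ n.+1) (P n.+1 - P n)
    + (psubst (Q^~ n.+1) (P n) - psubst (Q^~ n) (P n)).
  by rewrite psubstB subrKA.
apply: le_trans (snormD nS _ _) _; rewrite [leRHS]mulrDl; apply: lerD.
  apply: le_trans (hC n); apply: (@le_trans _ _ (pnorm2 rho (P n.+1 - P n))).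
    by apply: psubst_le; rewrite ?(ltW s0).
  by apply: pnorm2_le_radius; rewrite (ltW r0) ler_double // ltW.
rewrite -(ler_pM2r r0).
apply: le_trans (psubst_lipschitz _ (ltW s0) (Q_le^~ _) (Q_le^~ _)) _.
have -> : M / rho * (C0 + C1) / 2 ^+ n * rho = M * (C0 / 2 ^+ n + C1 / 2 ^+ n).
  by field; rewrite expf_neq0 ?pnatr_eq0 //= gt_eqF.
rewrite sum_I2; apply: ler_pM => //; first exact: pnorm2_ge0 (ltW r2).
  by rewrite addr_ge0 // (snorm_ge0 nS).
exact: lerD.
Qed.

Lemma papprox_inner_norm_le h : `|h| <= sigma -> `|G (x + h)| <= rho.
Proof.
move=> hs; apply: rV_norm_le (ltW papprox_comp_radius_gt0) _ => i; have [_ _ hG] := GQ i.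
apply: (@cvgn_le _ (fun n => `|peval h (Q i n)|)) => [|n]; first by apply: cvg_norm; exact: hG.
exact: le_trans (peval_le _ hs) (Q_le i n).
Qed.

Lemma papprox_comp : papprox (fun z => F (y + G z)) x sigma (fun n => psubst (Q^~ n) (P n)).
Proof.
have r0 := papprox_comp_radius_gt0; have [r2 hP hF] := FP; have [s0 _ _] := GQ 0.
have [M M0 hM] := geometric_rate_bounded (ltW r2) hP.
split=> // [|h hs]; first exact: geometric_rate_psubst.
pose k n : 'rV[R]_2 := \row_i peval h (Q i n); pose l := G (x + h).
have lr : `|l| <= rho := papprox_inner_norm_le hs.
have kr n : `|k n| <= rho.
  apply: rV_norm_le (ltW r0) _ => i; rewrite mxE.
  exact: le_trans (peval_le _ hs) (Q_le i n).
have -> : (fun n => peval h (psubst (Q^~ n) (P n)))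
        = (fun n => peval l (P n) + (peval (k n) (P n) - peval l (P n))).
  by apply/funext => n; rewrite peval_psubst addrC subrK.
have coord_cvg i : `|k n 0 i - l 0 i| @[n --> \oo] --> (0 : R).
  apply/norm_cvg0P; apply/subr_cvg0; under eq_cvg do rewrite mxE.
  by have [_ _ +] := GQ i; apply.
have sum_cvg : \sum_i `|k n 0 i - l 0 i| @[n --> \oo] --> (0 : R).
  rewrite (_ : (fun n => _) = (fun n => `|k n 0 0 - l 0 0| + `|k n 0 1 - l 0 1|)).
    by rewrite -[X in _ --> X](addr0 0); apply: cvgD.
  by apply/funext => n; rewrite sum_I2.
rewrite -[X in _ --> X]addr0; apply: cvgD.
  by apply: hF; apply: le_trans lr (ler_double (ltW r0)).
apply/norm_cvg0P; apply: (@squeeze_cvgr _ _ _ _ (fun=> 0)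
  (fun n => M / rho * \sum_i `|k n 0 i - l 0 i|)).
- apply: nearW => n; rewrite normr_ge0 /= mulrAC ler_pdivlMr //.
  apply: le_trans (peval_lipschitz _ (kr n) lr) _.
  by rewrite ler_wpM2r // sumr_ge0.
- exact: cvg_cst.
- by rewrite -[X in _ --> X](mulr0 (M / rho)); exact: cvgMl_tmp.
Qed.

End ApproxComposition.

Lemma papprox_value f x rho P : papprox f x rho P -> coef2 (P n) 0 0 @[n --> \oo] --> f x.
Proof.
move=> [r0 _ hf]; under eq_cvg do rewrite -peval0.
by rewrite -[x in f x]addr0; apply: hf; rewrite normr0 ltW.
Qed.

Lemma papprox_sub_value f x rho P : papprox f x rho P ->
  papprox (fun z => f z - f x) x rho (fun n => P n - pconst (coef2 (P n) 0 0)).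
Proof.
move=> fP; have [r0 [C hC] hf] := fP; split=> // [|h hr]; last first.
  under eq_cvg do rewrite raddfB /= peval_const.
  by apply: cvgB; [exact: hf|exact: papprox_value fP].
exists C => n; apply: le_trans (hC n); apply: pnorm2_le_coef (ltW r0) _ => i j.
rewrite !coef2B !coef2_const addn_eq0; case: ifP => [/andP[/eqP-> /eqP->]|_].
  by rewrite !subrr normr0.
by rewrite !subr0.
Qed.

Lemma pnorm2_sub_const_scale rho sigma p : 0 < sigma <= rho ->
  pnorm2 sigma (p - pconst (coef2 p 0 0)) <= sigma / rho * pnorm2 rho p.
Proof.
move=> /andP[s0 sr]; have r0 := lt_le_trans s0 sr.
have sr0 : 0 <= sigma / rho by rewrite divr_ge0 // ltW.
apply: pnorm2_le_termwise; rewrite ?(ltW s0) ?(ltW r0) // => i j.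
rewrite coef2B coef2_const; case: ifPn => [/eqP/eqP|ij]; rewrite ?addn_eq0.
  by move=> /andP[/eqP-> /eqP->]; rewrite subrr normr0 mul0r mulr_ge0 // mulr_ge0 // exprn_ge0 ?ltW.
rewrite subr0 mulrCA ler_wpM2l //; case: (i + j)%N ij => // m _.
rewrite !exprS mulrA divfK ?gt_eqF // ler_wpM2l ?(ltW s0) //.
by rewrite lerXn2r // nnegrE ltW.
Qed.

Lemma papprox_sub_value_small f x (eps : R) : analytic_at f x -> 0 < eps ->
  exists sigma P, papprox (fun z => f z - f x) x sigma P /\ forall n, pnorm2 sigma (P n) <= eps.
Proof.
move=> /analytic_papprox[rho [P fP]] e0; have [r0 hP _] := fP.
have [M M0 hM] := geometric_rate_bounded (ltW r0) hP.
pose sigma := Num.min rho (rho * eps / M).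
have s0 : 0 < sigma by rewrite lt_min r0 /= divr_gt0 ?mulr_gt0.
have sr : 0 < sigma <= rho by rewrite s0 ge_min lexx.
exists sigma, (fun n => P n - pconst (coef2 (P n) 0 0)); split=> [|n].
  exact: papprox_le_radius (papprox_sub_value fP) sr.
apply: le_trans (pnorm2_sub_const_scale _ sr) _; apply: (@le_trans _ _ (sigma / rho * M)).
  by rewrite ler_wpM2l // divr_ge0 // ltW.
by rewrite mulrAC ler_pdivrMr // -ler_pdivlMr // (mulrC eps) ge_min lexx orbT.
Qed.

Lemma analytic_comp (F : 'rV[R]_2 -> R) (G : 'rV[R]_2 -> 'rV[R]_2) x :
  analytic_at F (G x) -> vanalytic_at G x -> analytic_at (F \o G) x.
Proof.
move=> /analytic_papprox[rho [P FP]] Gx; have [r0 _ _] := FP.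
have r20 : 0 < rho / 2 by lra.
have [s0 [Q0 [GQ0 Q0_le]]] := papprox_sub_value_small (Gx 0) r20.
have [s1 [Q1 [GQ1 Q1_le]]] := papprox_sub_value_small (Gx 1) r20.
have [tau t0 [ts0 ts1 {}GQ0 {}GQ1]] := papprox_common_radius GQ0 GQ1.
have FP' : papprox F (G x) (2 * (rho / 2)) P by rewrite mulrC divfK ?pnatr_eq0.
rewrite (_ : F \o G = fun z => F (G x + (G z - G x))); last first.
  by apply/funext => z /=; rewrite addrC subrK.
pose Q i := if i == 0 then Q0 else Q1.
have GQ i : papprox (fun z => (G z - G x) 0 i) x tau (Q i).
  by rewrite /Q; case: (I2_cases i) => ->; under eq_fun do rewrite !mxE; [exact: GQ0|exact: GQ1].
apply: (papprox_analytic (papprox_comp FP' GQ _)) => i n; rewrite /Q.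
case: (I2_cases i) => -> /=; [apply: le_trans (Q0_le n)|apply: le_trans (Q1_le n)];
  by apply: pnorm2_le_radius; rewrite ltW.
Qed.

Lemma papprox_recenter f x rho P k : papprox f x rho P -> `|k| <= rho / 4 ->
  papprox f (x + k) (rho / 4) (fun n => recenter k (P n)).
Proof.
move=> fP kr; have [r0 _ _] := fP; have r40 : 0 < rho / 4 by lra.
have fP' : papprox f x (2 * (rho / 2)) P by rewrite mulrC divfK ?pnatr_eq0.
have coordQ i := papprox_coord i (x + k) x r40; have nS := pnorm2_seminorm (ltW r40).
have xk : x + k - x = k by rewrite addrC addKr.
rewrite xk in coordQ.
have Q_le i (n : nat) : pnorm2 (rho / 4) (pvar i + pconst (k 0 i)) <= rho / 2.
  apply: le_trans (snormD nS _ _) _; rewrite pnorm2_const ?(ltW r40) //.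
  by have := pnorm2_var i (ltW r40); have := coord_norm_le k i; lra.
have := papprox_comp (G := fun z => z - x) fP' coordQ Q_le.
by under eq_fun do rewrite addrC subrK.
Qed.

Lemma analytic_at_near f x : analytic_at f x -> \forall y \near x, analytic_at f y.
Proof.
move=> /analytic_papprox[rho [P fP]]; have [r0 _ _] := fP.
apply/nbhs_shiftP; exists (rho / 4); first by lra.
by move=> k kr; exact: papprox_analytic (papprox_recenter fP kr).
Qed.

Lemma analytic_coord_inv i x : x 0 i != 0 -> analytic_at (fun z : 'rV[R]_2 => (z 0 i)^-1) x.
Proof.
set c := x 0 i => c0; have nc : 0 < `|c| by rewrite normr_gt0.
pose rho := `|c| / 2; have r0 : 0 < rho by rewrite /rho; lra.
have nP := pnorm2_seminorm (ltW r0).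
pose P n : poly2 R := \sum_(0 <= k < n) pconst (c^-1 * (- c^-1) ^+ k) * pvar i ^+ k.
apply: (@papprox_analytic _ _ _ rho P); split=> // [|h hr].
  exists `|c|^-1 => n; rewrite /P big_nat_recr //= addrAC subrr add0r.
  apply: le_trans (snormM nP _ _) _; rewrite pnorm2_const ?(ltW r0) //.
  rewrite normrM normrX normrN normfV -mulrA ler_wpM2l ?invr_ge0 //.
  apply: (@le_trans _ _ (`|c|^-1 ^+ n * rho ^+ n)).
    rewrite ler_wpM2l ?exprn_ge0 ?invr_ge0 //; apply: (snormX_le nP).
    by rewrite pnorm2_var // ltW.
  by rewrite -exprMn /rho mulrA mulVf ?gt_eqF // mul1r exprVn.
have h_le : `|h 0 i| <= rho := le_trans (coord_norm_le h i) hr.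
have ratio_lt1 : `|- c^-1 * h 0 i| < 1.
  rewrite normrM normrN normfV mulrC ltr_pdivrMr // mul1r; apply: le_lt_trans h_le _.
  by rewrite /rho; lra.
have -> : (x + h) 0 i = c * (1 - - c^-1 * h 0 i) by rewrite mxE -/c; field.
rewrite invfM (_ : (fun n => _) = series (geometric c^-1 (- c^-1 * h 0 i))).
  exact: cvg_geometric_series.
apply/funext => n; rewrite /series /P raddf_sum /=.
by apply: eq_bigr => k _; rewrite rmorphM rmorphXn /= peval_const peval_var exprMn mulrA.
Qed.

Lemma analyticV f x : f x != 0 -> analytic_at f x -> analytic_at (fun z => (f z)^-1) x.
Proof.
move=> fx0 fx; pose G z : 'rV[R]_2 := rV2 (f z) 0.
rewrite (_ : (fun z => _) = (fun w : 'rV[R]_2 => (w 0 0)^-1) \o G); last first.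
  by apply/funext => z; rewrite /= mxE.
apply: analytic_comp; first by apply: analytic_coord_inv; rewrite mxE.
by move=> i; case: (I2_cases i) => ->; under eq_fun do rewrite mxE /=;
  [exact: fx|exact: analytic_cst].
Qed.

Lemma peval_nonaffine_part h p : peval h (nonaffine_part p)
  = peval h p - (coef2 p 0 0 + \sum_i lin_coef i p * h 0 i).
Proof.
rewrite raddfB /= raddfD /= peval_const raddf_sum; congr (_ - (_ + _)).
by apply: eq_bigr => i _; rewrite /= rmorphM /= peval_const peval_var.
Qed.

Lemma is_cvgn_lin_coef i f x rho P : papprox f x rho P -> cvgn (fun n => lin_coef i (P n)).
Proof. by move=> [r0 rP _]; case: (I2_cases i) => ->; exact: is_cvgn_coef2 rP. Qed.

Lemma papprox_taylor1 f x rho P : papprox f x rho P -> exists2 K : R, 0 <= K &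
  forall h, `|h| <= rho ->
    `|f (x + h) - (f x + linear_form (fun i => limn (fun n => lin_coef i (P n))) h)|
      <= K * `|h| ^+ 2.
Proof.
move=> fP; have [r0 hP hf] := fP; have [M M0 hM] := geometric_rate_bounded (ltW r0) hP.
exists (M / rho ^+ 2); first by rewrite divr_ge0 ?exprn_ge0 ?ltW.
move=> h hr; apply: (@cvgn_le _ (fun n => `|peval h (nonaffine_part (P n))|)) => [|n].
  under eq_cvg do rewrite peval_nonaffine_part.
  apply: cvg_norm; apply: cvgB; first exact: hf.
  apply: cvgD; first exact: papprox_value fP.
  apply: cvg_big => [|i _]; first exact: add_continuous.
  by apply: cvgMr_tmp; exact: is_cvgn_lin_coef fP.
apply: le_trans (peval_le _ (lexx _)) _; rewrite mulrAC ler_pdivlMr ?exprn_gt0 //.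
apply: le_trans (pnorm2_nonaffine_part_scale _ _) _; first by rewrite normr_ge0.
by rewrite mulrC ler_wpM2r ?exprn_ge0.
Qed.

Lemma papprox_differentiable f x rho P : papprox f x rho P ->
  differentiable f x /\ forall i, partial i f x = limn (fun n => lin_coef i (P n)).
Proof.
move=> fP; have [r0 _ _] := fP; have [K K0 hK] := papprox_taylor1 fP.
set c := (fun i => limn _) in hK *.
have [df dE] : differentiable f x /\ 'd f x = linear_form c :> (_ -> _).
  apply: differentiable_of_error_bound => [|e e0]; first exact: linear_form_continuous.
  apply/nbhs_shiftP; exists (Num.min rho (e / (K + 1))).
    by rewrite lt_min r0 divr_gt0 //; lra.
  move=> h; rewrite le_min add0r => /andP[hr he] /=; apply: le_trans (hK h hr) _.
  rewrite expr2 mulrA ler_wpM2r //; apply: (@le_trans _ _ (K * (e / (K + 1)))).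
    by rewrite ler_wpM2l.
  by rewrite mulrCA ger_pMr // ler_pdivrMr; lra.
by split=> // i; rewrite partialE // dE linear_form_delta.
Qed.

Lemma analytic_differentiable f x : analytic_at f x -> differentiable f x.
Proof. by move=> /analytic_papprox[rho [P /papprox_differentiable[]]]. Qed.

Lemma analytic_continuous f x : analytic_at f x -> {for x, continuous f}.
Proof. by move=> /analytic_differentiable; exact: differentiable_continuous. Qed.

Lemma near_neq0 f x : analytic_at f x -> f x != 0 -> \forall y \near x, f y != 0.
Proof. by move=> /analytic_continuous fx; exact: (cvgr_neq0 (f x) fx). Qed.

Lemma papprox_partial i f x rho P : papprox f x rho P ->
  papprox (partial i f) x (rho / 8) (fun n => pderiv i (P n)).
Proof.
move=> fP; have [r0 [C hC] _] := fP; have r80 : 0 < rho / 8 by lra.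
split=> // [|k kr].
  exists (C / (rho / 8)) => n; rewrite -raddfB mulrAC ler_pdivlMr //.
  apply: le_trans (pnorm2_pderiv _ _ (ltW r80)) _; apply: le_trans (hC n).
  by apply: pnorm2_le_radius; lra.
have kr4 : `|k| <= rho / 4 by lra.
have rP := papprox_recenter fP kr4; have [_ ->] := papprox_differentiable rP.
by under eq_cvg do rewrite -lin_coef_recenter; exact: is_cvgn_lin_coef rP.
Qed.

Lemma papprox_nonaffine_part f x rho P : papprox f x rho P ->
  papprox (fun z => f z - (f x + \sum_i partial i f x * (z - x) 0 i)) x rho
    (fun n => nonaffine_part (P n)).
Proof.
move=> fP; have [r0 [C hC] hf] := fP; have [_ df] := papprox_differentiable fP.
split=> // [|h hr].
  exists C => n; rewrite -nonaffine_partB; apply: le_trans (hC n).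
  exact: pnorm2_nonaffine_part (ltW r0).
under eq_cvg do rewrite peval_nonaffine_part; rewrite [x + h - x]addrC addKr.
apply: cvgB; first exact: hf.
apply: cvgD; first exact: papprox_value fP.
apply: cvg_big => [|i _]; first exact: add_continuous.
by apply: cvgMr_tmp; rewrite df; exact: is_cvgn_lin_coef fP.
Qed.

Lemma analytic_partial i f x : analytic_at f x -> analytic_at (partial i f) x.
Proof. by move=> /analytic_papprox[rho [P fP]]; exact: papprox_analytic (papprox_partial i fP). Qed.

Lemma partial_comm f x : analytic_at f x -> partial 0 (partial 1 f) x = partial 1 (partial 0 f) x.
Proof.
move=> /analytic_papprox[rho [P fP]].
have lim01 := papprox_value (papprox_partial 0 (papprox_partial 1 fP)).
have lim10 := papprox_value (papprox_partial 1 (papprox_partial 0 fP)).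
apply: cvg_unique lim01 _ => //; move: lim10.
by under eq_cvg do rewrite -pderiv_comm.
Qed.

Definition partial_coefs (K : nmodType) i (c : nat -> nat -> K) : nat -> nat -> K :=
  fun k l : nat => if i == 0 then c k.+1 l *+ k.+1 else c k l.+1 *+ l.+1.

Lemma raddf_partial_coefs (K L : nmodType) (phi : {additive K -> L}) i (c : nat -> nat -> K) :
  (fun k l : nat => phi (partial_coefs i c k l)) = partial_coefs i (fun k l => phi (c k l)).
Proof.
by apply/funext => k; apply/funext => l; rewrite /partial_coefs; case: ifP => _; rewrite raddfMn.
Qed.

Lemma pseries_partial i f x rho a : pseries f x rho a ->
  pseries (partial i f) x (rho / 16) (partial_coefs i a).
Proof.
move=> /pseries_papprox /(papprox_partial i).
rewrite (_ : rho / 2 / 8 = rho / 16); last by field.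
move=> /papprox_pseries; apply=> k l; under eq_cvg do rewrite coef2_pderiv.
by rewrite /partial_coefs; case: ifP => _; apply: cvgMn; exact: coef2_ptrunc_cvg.
Qed.

Lemma pseries_value f x rho a : pseries f x rho a -> a 0%N 0%N = f x.
Proof.
move=> /pseries_papprox /papprox_value fa.
exact: cvg_unique (coef2_ptrunc_cvg (a := a) (i := 0) (j := 0)) fa.
Qed.

Definition cauchy_product (K : nzRingType) (c d : nat -> nat -> K) (i j : nat) : K :=
  \sum_(k < i.+1) \sum_(l < j.+1) c k l * d (i - k)%N (j - l)%N.

Lemma pseriesM f g x rho a b : pseries f x rho a -> pseries g x rho b ->
  pseries (fun z => f z * g z) x (rho / 2) (cauchy_product a b).
Proof.
move=> /pseries_papprox fP /pseries_papprox gP; apply: papprox_pseries (papproxM fP gP) _ => i j.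
under eq_cvg do rewrite coef2M.
apply: cvg_big => [|k _]; first exact: add_continuous.
apply: cvg_big => [|l _]; first exact: add_continuous.
by apply: cvgM; exact: coef2_ptrunc_cvg.
Qed.

Lemma pseriesD f g x rho a b : pseries f x rho a -> pseries g x rho b ->
  pseries (fun z => f z + g z) x (rho / 2) (fun i j : nat => a i j + b i j).
Proof.
move=> /pseries_papprox fP /pseries_papprox gP; apply: papprox_pseries (papproxD fP gP) _ => i j.
by under eq_cvg do rewrite coef2D; apply: cvgD; exact: coef2_ptrunc_cvg.
Qed.

Lemma pseriesN f x rho a : pseries f x rho a ->
  pseries (fun z => - f z) x rho (fun i j : nat => - a i j).
Proof.
move=> [r0 [M hM] hf]; split=> // [|h hr]; last first.
  by under eq_cvg do rewrite ptruncN raddfN; apply: cvgN; exact: hf.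
by exists M => n; rewrite ptruncN (snormN (pnorm2_seminorm (ltW r0))).
Qed.

Lemma pseries_unique f g x rho sigma a : pseries f x rho a -> pseries g x sigma a ->
  \forall y \near x, f y = g y.
Proof. by move=> fa ga; apply/nbhs_shiftP; exact: pseries_near_eq fa ga. Qed.

Definition vanishes_near f : set 'rV[R]_2 := [set x | \forall y \near x, f y = 0].

Lemma vanishes_near_partial i f x : vanishes_near f x -> vanishes_near (partial i f) x.
Proof.
by move=> /(near_partial_eq i); apply: filterS => y ->; exact: partial_cst.
Qed.

Lemma pseries_eq0 f x rho a : pseries f x rho a -> closure (vanishes_near f) x ->
  forall i j : nat, a i j = 0.
Proof.
move=> fa fx i j; have [n] := ubnP (i + j)%N; elim: n => // n IH in f rho a i j fa fx *.
have reduce (k : 'I_2) (i' j' : nat) : (i' + j' < n)%N -> partial_coefs k a i' j' = 0.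
  move=> ij; apply: (IH _ _ _ _ _ (pseries_partial k fa)) => //.
  by move: fx; apply: closureS => y; exact: vanishes_near_partial.
rewrite ltnS; case: i => [|i] => [|ij]; last first.
  by have /eqP := reduce 0 i j ij; rewrite mulrn_eq0 => /eqP.
case: j => [_|j ij]; last by have /eqP := reduce 1 0%N j ij; rewrite mulrn_eq0 => /eqP.
rewrite (pseries_value fa); apply/eqP/negPn/negP => f0.
have [y [fy /=]] := fx _ (near_neq0 (pseries_analytic fa) f0).
by rewrite (nbhs_singleton fy) eqxx.
Qed.

Lemma analytic_vanishes_near_closure f x :
  analytic_at f x -> closure (vanishes_near f) x -> vanishes_near f x.
Proof.
move=> /analytic_pseries[rho [a fa]] fx; have a0 := pseries_eq0 fa fx.
apply: (pseries_unique fa (papprox_pseries (papprox_cst 0 x ltr01) _)) => i j.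
by rewrite a0 raddf0 /coef2 !coef0; exact: cvg_cst.
Qed.

Lemma analytic_partial0_cst f x : analytic_at f x ->
  (forall i, \forall y \near x, partial i f y = 0) -> \forall y \near x, f y = f x.
Proof.
move=> /analytic_pseries[rho [a fa]] df0.
have coefs0 (k : 'I_2) := pseries_eq0 (pseries_partial k fa) (subset_closure (df0 k)).
apply: (pseries_unique fa (papprox_pseries (papprox_cst (f x) x ltr01) _)) => i j.
rewrite (_ : a i j = coef2 (pconst (f x)) i j); first exact: cvg_cst.
rewrite coef2_const; case: i => [|i]; first case: j => [|j] /=.
- exact: pseries_value fa.
- by have /eqP := coefs0 1 0%N j; rewrite mulrn_eq0 => /eqP.
- by have /eqP := coefs0 0 i j; rewrite mulrn_eq0 => /eqP.
Qed.

End AnalyticFunctions.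

Section AnalyticMaps.
Context {R : realType} {m : nat}.
Implicit Types (F G : 'rV[R]_2 -> 'rV[R]_m) (y : 'rV[R]_2) (i : 'I_2).

Lemma vanalytic_differentiable F y : vanalytic_at F y -> differentiable F y.
Proof. by move=> Fy; apply: differentiable_rV => k; exact: analytic_differentiable (Fy k). Qed.

Lemma vanalytic_continuous F y : vanalytic_at F y -> {for y, continuous F}.
Proof. by move=> /vanalytic_differentiable; exact: differentiable_continuous. Qed.

Lemma vanalytic_near_neq0 F y : vanalytic_at F y -> F y != 0 -> \forall z \near y, F z != 0.
Proof. by move=> /vanalytic_continuous Fy; exact: (cvgr_neq0 (F y) Fy). Qed.

Lemma vanalytic_near F y : vanalytic_at F y -> \forall z \near y, vanalytic_at F z.
Proof.
by move=> Fy; apply: (@filter_forall _ _ _ (nbhs y) _) => k; exact: analytic_at_near (Fy k).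
Qed.

Lemma vanalytic_near_eq F G y : (\forall z \near y, F z = G z) ->
  vanalytic_at F y -> vanalytic_at G y.
Proof.
move=> FG Fy k; apply: analytic_near_eq (Fy k).
by apply: filterS FG => z ->.
Qed.

Lemma vanalytic_partial i F y : vanalytic_at F y -> vanalytic_at (partial i F) y.
Proof.
move=> Fy k; apply: (@analytic_near_eq _ (partial i (fun z => F z 0 k))).
  apply: filterS (vanalytic_near Fy) => z Fz.
  by rewrite partial_coord //; exact: vanalytic_differentiable.
exact: analytic_partial.
Qed.

Lemma vanalytic_cst (v : 'rV[R]_m) y : vanalytic_at (fun=> v) y.
Proof. by move=> k; exact: analytic_cst. Qed.

Lemma vanalyticD F G y : vanalytic_at F y -> vanalytic_at G y ->
  vanalytic_at (fun z => F z + G z) y.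
Proof. by move=> Fy Gy k; under eq_fun do rewrite mxE; exact: analyticD. Qed.

Lemma vanalyticB F G y : vanalytic_at F y -> vanalytic_at G y ->
  vanalytic_at (fun z => F z - G z) y.
Proof. by move=> Fy Gy k; under eq_fun do rewrite !mxE; exact: analyticB. Qed.

Lemma vanalyticZ (a : 'rV[R]_2 -> R) F y : analytic_at a y -> vanalytic_at F y ->
  vanalytic_at (fun z => a z *: F z) y.
Proof. by move=> ay Fy k; under eq_fun do rewrite mxE; exact: analyticM. Qed.

Lemma partialZ i (a : 'rV[R]_2 -> R) F y : analytic_at a y -> vanalytic_at F y ->
  partial i (fun z => a z *: F z) y = partial i a y *: F y + a y *: partial i F y.
Proof.
move=> ay Fy; apply/rowP => k; rewrite !mxE !partial_coord; try exact: vanalytic_differentiable.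
  rewrite -partialM; [|exact: analytic_differentiable..].
  by congr (partial i _ y); apply/funext => z; rewrite mxE.
by apply: vanalytic_differentiable; exact: vanalyticZ.
Qed.

Lemma partialcZ i (c : R) F y : vanalytic_at F y ->
  partial i (fun z => c *: F z) y = c *: partial i F y.
Proof. by move=> Fy; rewrite partialZ ?partial_cst ?scale0r ?add0r //; exact: analytic_cst. Qed.

Lemma vpartial_comm F y : vanalytic_at F y ->
  partial 0 (partial 1 F) y = partial 1 (partial 0 F) y.
Proof.
move=> Fy; apply/rowP => k.
have swap i j : partial i (partial j F) y 0 k = partial i (partial j (fun z => F z 0 k)) y.
  rewrite partial_coord; last by apply: vanalytic_differentiable; exact: vanalytic_partial.
  apply: partial_near_eq; apply: filterS (vanalytic_near Fy) => z Fz.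
  by rewrite partial_coord //; exact: vanalytic_differentiable.
transitivity (partial 0 (partial 1 (fun z => F z 0 k)) y); first exact: swap.
by rewrite partial_comm //; symmetry; exact: swap.
Qed.

End AnalyticMaps.

Lemma vanalytic_partial0_cst (R : realType) m (F : 'rV[R]_2 -> 'rV[R]_m) y :
  (\forall z \near y, vanalytic_at F z) ->
  (\forall z \near y, forall i, partial i F z = 0) -> \forall z \near y, F z = F y.
Proof.
move=> F_near dF0; suff F_cst : \forall z \near y, forall k, F z 0 k = F y 0 k.
  by apply: filterS F_cst => z F_cst; apply/rowP.
apply: (@filter_forall _ _ _ (nbhs y) _) => k.
apply: analytic_partial0_cst (nbhs_singleton F_near k) _ => i.
apply: filterS2 F_near dF0 => z Fz dFz; rewrite -partial_coord ?dFz ?mxE //.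
exact: vanalytic_differentiable.
Qed.

Lemma vanalytic_comp (R : realType) m (F : 'rV[R]_2 -> 'rV[R]_m) (G : 'rV[R]_2 -> 'rV[R]_2) x :
  vanalytic_at F (G x) -> vanalytic_at G x -> vanalytic_at (F \o G) x.
Proof. by move=> Fx Gx k; apply: (@analytic_comp _ (fun z => F z 0 k)). Qed.

Section LinearChange.
Context {R : realType} {m n : nat}.
Variables (F : 'rV[R]_2 -> 'rV[R]_m) (y : 'rV[R]_2) (A : 'M[R]_(m, n)).
Hypothesis Fy : vanalytic_at F y.

Let analytic_summand j k : analytic_at (fun z => F z 0 j * A j k) y.
Proof. exact: analyticM (analytic_cst _ _). Qed.

Lemma vanalytic_mulmxr : vanalytic_at (fun z => F z *m A) y.
Proof. by move=> k; under eq_fun do rewrite mxE; exact: analytic_sum. Qed.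

Lemma partial_mulmxr i : partial i (fun z => F z *m A) y = partial i F y *m A.
Proof.
apply/rowP => k; rewrite partial_coord; last exact: vanalytic_differentiable vanalytic_mulmxr.
under eq_fun do rewrite mxE; rewrite mxE partial_sum => [|j]; last exact: analytic_differentiable.
apply: eq_bigr => j _; rewrite partialM ?partial_cst ?mulr0 ?addr0 //.
  by rewrite partial_coord //; exact: vanalytic_differentiable.
exact: analytic_differentiable (Fy j).
Qed.

End LinearChange.

Section BilinearCalculus.
Context {R : realType} {m n : nat}.
Variable B : 'rV[R]_m -> 'rV[R]_n -> R.
Hypotheses (B_linl : forall a u v w, B (a *: u + v) w = a * B u w + B v w)
  (B_linr : forall a u v w, B w (a *: u + v) = a * B w u + B w v).

Let bilinearE u v :
  B u v = \sum_k \sum_l (u 0 k * v 0 l) * B (delta_mx 0 k) (delta_mx 0 l).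
Proof.
have B0l w : B 0 w = 0 by have := B_linl (-1) 0 0 w; rewrite scaler0 addr0 mulN1r addNr.
have B0r w : B w 0 = 0 by have := B_linr (-1) 0 0 w; rewrite scaler0 addr0 mulN1r addNr.
transitivity (\sum_k u 0 k * B (delta_mx 0 k) v).
  rewrite {1}(row_sum_delta u).
  by elim/big_rec2: _ => [|k r s _ <-]; rewrite ?B0l ?B_linl.
apply: eq_bigr => k _; transitivity (u 0 k * \sum_l v 0 l * B (delta_mx 0 k) (delta_mx 0 l)).
  congr (_ * _); rewrite {1}(row_sum_delta v).
  by elim/big_rec2: _ => [|l r s _ <-]; rewrite ?B0r ?B_linr.
by rewrite mulr_sumr; apply: eq_bigr => l _; rewrite mulrA.
Qed.

Variables (F : 'rV[R]_2 -> 'rV[R]_m) (G : 'rV[R]_2 -> 'rV[R]_n) (y : 'rV[R]_2).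
Hypotheses (Fy : vanalytic_at F y) (Gy : vanalytic_at G y).

Let term_analytic k l :
  analytic_at (fun z => (F z 0 k * G z 0 l) * B (delta_mx 0 k) (delta_mx 0 l)) y.
Proof. by apply: analyticM (analytic_cst _ _); exact: analyticM. Qed.

Lemma analytic_bilinear : analytic_at (fun z => B (F z) (G z)) y.
Proof.
under eq_fun do rewrite bilinearE.
by apply: analytic_sum => k; exact: analytic_sum.
Qed.

Lemma partial_bilinear i :
  partial i (fun z => B (F z) (G z)) y = B (partial i F y) (G y) + B (F y) (partial i G y).
Proof.
under eq_fun do rewrite bilinearE.
rewrite (bilinearE (partial i F y)) (bilinearE (F y)) -big_split /= partial_sum; last first.
  by move=> k; apply: analytic_differentiable; exact: analytic_sum.
apply: eq_bigr => k _; rewrite -big_split /= partial_sum; last first.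
  by move=> l; exact: analytic_differentiable.
have dF := analytic_differentiable (Fy k); apply: eq_bigr => l _.
have dG := analytic_differentiable (Gy l).
rewrite partialM ?partial_cst ?mulr0 ?addr0 //; last exact: differentiableM.
by rewrite partialM // -!partial_coord ?mulrDl //; exact: vanalytic_differentiable.
Qed.

End BilinearCalculus.

(** * The Beltrami equation *)

Section ComplexModulus.
Context {R : rcfType}.
Implicit Types (x y : R) (z : R[i]).

Lemma normc_seminorm : ring_seminorm (@Normc.normc R).
Proof.
split; [exact: Normc.normc0| |exact: le_normcD|exact: normcN| |by rewrite Normc.normc1].
  by move=> [x y]; exact: sqrtr_ge0.
by move=> x y; rewrite Normc.normcM.
Qed.

Lemma normc_real x : Normc.normc x%:C%C = `|x|.
Proof. by rewrite /= expr0n addr0 sqrtr_sqr. Qed.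

Lemma normc_le_ReIm x y : Normc.normc (Complex x y) <= `|x| + `|y|.
Proof.
have -> : Complex x y = Complex x 0 + Complex 0 y by simpc.
apply: le_trans (le_normcD _ _) _.
by rewrite /= !expr0n /= addr0 add0r !sqrtr_sqr.
Qed.

Lemma Re_le_normc z : `|complex.Re z| <= Normc.normc z.
Proof. by case: z => x y; rewrite -sqrtr_sqr ler_wsqrtr // lerDl sqr_ge0. Qed.

Lemma Im_le_normc z : `|complex.Im z| <= Normc.normc z.
Proof. by case: z => x y; rewrite -sqrtr_sqr ler_wsqrtr // lerDr sqr_ge0. Qed.

End ComplexModulus.

Section CauchyProduct.
Context {R : realType}.

Lemma cauchy_product_le (K : comNzRingType) (nu : K -> R) (a b : nat -> nat -> K) rho M T i j :
  ring_seminorm nu -> 0 <= rho -> 0 <= T ->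
  (forall n, \sum_(k < n) \sum_(l < n) nu (a k l) * rho ^+ (k + l) <= M) ->
  (forall k l, (k <= i)%N -> (l <= j)%N -> nu (b (i - k)%N (j - l)%N) <= T * rho ^+ (k + l)) ->
  nu (cauchy_product a b i j) <= T * M.
Proof.
move=> nuP r0 T0 aM bT; pose F k l := T * (nu (a k l) * rho ^+ (k + l)).
have F0 k l : 0 <= F k l by rewrite !mulr_ge0 ?exprn_ge0 ?(snorm_ge0 nuP).
apply: (@le_trans _ _ (\sum_(k < i.+1) \sum_(l < j.+1) F k l)).
  apply: le_trans (snorm_sum nuP _ _ _) _; apply: ler_sum => k _.
  apply: le_trans (snorm_sum nuP _ _ _) _; apply: ler_sum => l _.
  apply: le_trans (snormM nuP _ _) _; rewrite /F mulrCA ler_wpM2l ?(snorm_ge0 nuP) //.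
  by apply: bT; rewrite -ltnS.
apply: le_trans (rectangle_sum_le_square (n := (i + j).+1) F0 _ _) _.
- by rewrite ltnS leq_addr.
- by rewrite ltnS leq_addl.
under eq_bigr do rewrite -mulr_sumr.
by rewrite -mulr_sumr ler_wpM2l.
Qed.

Lemma cauchy_product_Re (a b : nat -> nat -> R[i]) i j :
  complex.Re (cauchy_product a b i j) =
    cauchy_product (fun k l => complex.Re (a k l)) (fun k l => complex.Re (b k l)) i j
    - cauchy_product (fun k l => complex.Im (a k l)) (fun k l => complex.Im (b k l)) i j.
Proof.
rewrite /cauchy_product raddf_sum -sumrB; apply: eq_bigr => k _.
rewrite raddf_sum -sumrB; apply: eq_bigr => l _.
by case: (a k l) => ? ?; case: (b _ _) => ? ?.
Qed.

Lemma cauchy_product_Im (a b : nat -> nat -> R[i]) i j :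
  complex.Im (cauchy_product a b i j) =
    cauchy_product (fun k l => complex.Im (a k l)) (fun k l => complex.Re (b k l)) i j
    + cauchy_product (fun k l => complex.Re (a k l)) (fun k l => complex.Im (b k l)) i j.
Proof.
rewrite /cauchy_product raddf_sum -big_split; apply: eq_bigr => k _.
rewrite raddf_sum -big_split; apply: eq_bigr => l _.
by case: (a k l) => ? ?; case: (b _ _) => ? ? /=; rewrite addrC.
Qed.

End CauchyProduct.

Lemma bin_add_mono a b a' b' : (a <= a')%N -> (b <= b')%N ->
  ('C(a + b, a) <= 'C(a' + b', a'))%N.
Proof.
move=> aa bb; apply: (@leq_trans 'C(a' + b, a')).
  rewrite -[leqLHS]bin_sub ?leq_addr // -[leqRHS]bin_sub ?leq_addr //.
  by rewrite !addKn leq_bin2l // leq_add2r.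
by rewrite leq_bin2l // leq_add2l.
Qed.

Lemma mul_bin_add_le i j k l : (k <= i)%N -> (l <= j)%N ->
  ((i - k).+1 * 'C((i - k).+1 + (j - l), (i - k).+1) <= j.+1 * 'C(i + j.+1, i))%N.
Proof.
move=> ki lj; have -> : (j.+1 * 'C(i + j.+1, i) = (i + j).+1 * 'C(i + j, i))%N.
  rewrite -(bin_sub (leq_addr _ _)) addKn -(bin_sub (leq_addr _ _)) addKn addnS.
  by rewrite mul_bin_diag.
rewrite addSn -mul_bin_diag /=; apply: leq_mul.
  by rewrite ltnS leq_add // leq_subr.
by apply: bin_add_mono; rewrite leq_subr.
Qed.

Lemma sum_geometric_half_le2 (R : realFieldType) (q : R) n :
  0 <= q <= 2^-1 -> \sum_(i < n) q ^+ i <= 2.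
Proof.
move=> /andP[q0 q1]; apply: (@le_trans _ _ (2 - 2 * 2^-1 ^+ n)); last first.
  by rewrite gerBl mulr_ge0 // exprn_ge0 // invr_ge0.
elim: n => [|n IH]; first by rewrite big_ord0 expr0; lra.
rewrite big_ord_recr /=; have : q ^+ n <= 2^-1 ^+ n by rewrite lerXn2r // nnegrE invr_ge0.
rewrite exprS; lra.
Qed.

(* Cauchy-Kovalevskaya coefficients: [beltrami_coef i j] is the coefficient of
   [s ^+ i * t ^+ j] in the formal solution of [w_t = Z w_s], [w(s, 0) = s]. *)
Section BeltramiCoefficients.
Context {R : realType}.
Variable Z : nat -> nat -> R[i].

Fixpoint beltrami_table (n i j : nat) : R[i] :=
  if n is m.+1 then
    if (j <= m)%N then beltrami_table m i j
    else m.+1%:R^-1 * cauchy_product Z (partial_coefs 0 (beltrami_table m)) i m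
  else (i == 1%N)%:R.

Definition beltrami_coef i j : R[i] := beltrami_table j i j.

Lemma beltrami_tableE n i j : (j <= n)%N -> beltrami_table n i j = beltrami_coef i j.
Proof.
elim: n => [|n IH]; first by rewrite leqn0 => /eqP->.
by rewrite leq_eqVlt => /predU1P[->|] //=; rewrite ltnS => jn; rewrite jn IH.
Qed.

Lemma beltrami_coef0 i : beltrami_coef i 0 = (i == 1%N)%:R.
Proof. by []. Qed.

Lemma beltrami_coefS i j :
  partial_coefs 1 beltrami_coef i j = cauchy_product Z (partial_coefs 0 beltrami_coef) i j.
Proof.
have -> : partial_coefs 1 beltrami_coef i j = beltrami_coef i j.+1 *+ j.+1 by [].
have -> : beltrami_coef i j.+1
    = j.+1%:R^-1 * cauchy_product Z (partial_coefs 0 (beltrami_table j)) i j.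
  by rewrite /beltrami_coef /= ltnn.
rewrite -[LHS]mulr_natl mulrA mulfV ?pnatr_eq0 // mul1r.
apply: eq_bigr => k _; apply: eq_bigr => l _.
by rewrite /partial_coefs /= beltrami_tableE // leq_subr.
Qed.

Variables rho M : R.
Hypotheses (rho_gt0 : 0 < rho) (rho_le1 : rho <= 1) (M_ge1 : 1 <= M)
  (Z_le : forall n, \sum_(i < n) \sum_(j < n) Normc.normc (Z i j) * rho ^+ (i + j) <= M).

Definition beltrami_majorant i j : R :=
  'C(i + j, i)%:R * rho^-1 ^+ i * (M / rho) ^+ j.

Let M_gt0 : 0 < M. Proof. exact: lt_le_trans M_ge1. Qed.

Let ratio_gt0 : 0 < M / rho. Proof. by rewrite divr_gt0. Qed.

Lemma beltrami_majorant_ge0 i j : 0 <= beltrami_majorant i j.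
Proof. by rewrite !mulr_ge0 ?exprn_ge0 ?invr_ge0 // ltW. Qed.

Lemma beltrami_majorant_step i j k l : (k <= i)%N -> (l <= j)%N ->
  beltrami_majorant (i - k).+1 (j - l) *+ (i - k).+1
    <= j.+1%:R * beltrami_majorant i j.+1 / M * rho ^+ (k + l).
Proof.
move=> ki lj; set B := M / rho; have B0 : 0 < B := ratio_gt0.
rewrite /beltrami_majorant -/B -[leLHS]mulr_natl.
rewrite [leLHS](_ : _ = ((i - k).+1 * 'C((i - k).+1 + (j - l), (i - k).+1))%:R
  * (rho^-1 ^+ (i - k).+1 * B ^+ (j - l))); last by rewrite natrM !mulrA.
rewrite [leRHS](_ : _ = (j.+1 * 'C(i + j.+1, i))%:R
  * (rho^-1 ^+ i * B ^+ j.+1 / M * rho ^+ (k + l))); last by rewrite natrM !mulrA.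
apply: ler_pM => //.
- by rewrite mulr_ge0 ?exprn_ge0 ?invr_ge0 // ltW.
- by rewrite ler_nat mul_bin_add_le.
have -> : rho^-1 ^+ (i - k).+1 = rho^-1 ^+ i * rho^-1 * rho ^+ k.
  rewrite -[in RHS](subnK ki) exprD exprS -!mulrA [X in _ = _ * X]mulrCA -exprMn.
  by rewrite mulVf ?gt_eqF // expr1n mulr1 mulrC.
have -> : B ^+ j.+1 = B ^+ (j - l) * B ^+ l * B by rewrite -exprD subnK // exprSr.
have pow_ge1 : 1 <= B ^+ l * rho ^+ l by rewrite -exprMn /B divfK ?gt_eqF // exprn_ege1.
rewrite exprD {3}/B.
have -> : rho^-1 ^+ i * (B ^+ (j - l) * B ^+ l * (M / rho)) / M * (rho ^+ k * rho ^+ l)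
  = (rho^-1 ^+ i / rho * rho ^+ k * B ^+ (j - l)) * (B ^+ l * rho ^+ l).
  by field; rewrite !gt_eqF.
apply: ler_peMr => //.
by rewrite !mulr_ge0 ?exprn_ge0 ?invr_ge0 // ltW.
Qed.

Lemma normc_beltrami_coef_le i j : Normc.normc (beltrami_coef i j) <= beltrami_majorant i j.
Proof.
elim/ltn_ind: j i => -[_|j IH] i.
  rewrite beltrami_coef0 /beltrami_majorant addn0 binn expr0 mulr1 mul1r.
  rewrite -(rmorph_nat (real_complex R)).
  rewrite normc_real; case: eqP => [->|_]; first by rewrite normr1 expr1 invf_ge1.
  by rewrite normr0 exprn_ge0 // invr_ge0 ltW.
have j0 : 0 < j.+1%:R :> R by rewrite ltr0n.
rewrite -(ler_pM2l j0) mulr_natl -normcMn.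
have -> : beltrami_coef i j.+1 *+ j.+1 = partial_coefs 1 beltrami_coef i j by [].
rewrite beltrami_coefS -[leRHS](divfK (lt0r_neq0 M_gt0)).
apply: (cauchy_product_le normc_seminorm (ltW rho_gt0) _ Z_le) => [|k l ki lj].
  by rewrite divr_ge0 ?(ltW M_gt0) // mulr_ge0 // beltrami_majorant_ge0.
rewrite normcMn; apply: le_trans (beltrami_majorant_step ki lj); rewrite lerMn2r IH ?orbT //.
by rewrite ltnS leq_subr.
Qed.

Lemma beltrami_majorant_le i j : beltrami_majorant i j <= (2 * (M / rho)) ^+ (i + j).
Proof.
rewrite /beltrami_majorant [leRHS]exprMn -mulrA; apply: ler_pM => //.
- by rewrite mulr_ge0 ?exprn_ge0 ?invr_ge0 // ltW.
- rewrite -natrX ler_nat; apply: leq_trans (_ : \sum_(k < (i + j).+1) 'C(i + j, k) <= _)%N.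
    have ij : (i < (i + j).+1)%N by rewrite ltnS leq_addr.
    by rewrite (bigD1 (Ordinal ij)) //= leq_addr.
  rewrite (_ : 2 = 1 + 1)%N // expnDn leq_sum // => k _.
  by rewrite !exp1n !muln1.
- rewrite exprD ler_wpM2r ?exprn_ge0 ?(ltW ratio_gt0) //.
  have rho_inv_le : rho^-1 <= M / rho by rewrite ler_peMl // invr_ge0 ltW.
  by rewrite lerXn2r // nnegrE ?(ltW ratio_gt0) // invr_ge0 ltW.
Qed.

Lemma pseries_of_beltrami_majorant (w : nat -> nat -> R) x :
  (forall i j, `|w i j| <= beltrami_majorant i j) ->
  exists f, pseries f x ((4 * (M / rho))^-1 / 2) w.
Proof.
move=> w_le; set s := (4 * (M / rho))^-1; have s0 : 0 < s by rewrite invr_gt0 mulr_gt0.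
apply: (@pseries_exists _ x s w (2 * 2)) => // n; rewrite pnorm2_ptrunc ?(ltW s0) //.
pose q : R := 2^-1; have sum_le : \sum_(i < n) q ^+ i <= 2.
  by apply: sum_geometric_half_le2; rewrite lexx invr_ge0 ler0n.
have sum_ge0 : 0 <= \sum_(i < n) q ^+ i by apply: sumr_ge0 => i _; rewrite exprn_ge0 ?invr_ge0.
apply: le_trans (ler_pM sum_ge0 sum_ge0 sum_le sum_le).
rewrite mulr_suml; apply: ler_sum => i _; rewrite mulr_sumr; apply: ler_sum => j _.
rewrite -exprD; apply: (@le_trans _ _ ((2 * (M / rho)) ^+ (i + j) * s ^+ (i + j))).
  rewrite ler_wpM2r ?exprn_ge0 ?(ltW s0) //.
  exact: le_trans (w_le i j) (beltrami_majorant_le i j).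
rewrite -exprMn (_ : 2 * (M / rho) * s = q) // /s /q.
by field; rewrite !gt_eqF.
Qed.

End BeltramiCoefficients.

Lemma beltrami_pseries_exists (R : realType) (X Y : 'rV[R]_2 -> R) x rho a b :
  rho <= 1 -> pseries X x rho a -> pseries Y x rho b ->
  let w := beltrami_coef (fun i j => Complex (a i j) (b i j)) in
  exists s u v, pseries u x s (fun i j => complex.Re (w i j))
             /\ pseries v x s (fun i j => complex.Im (w i j)).
Proof.
move=> rho1 [rho0 [M1 hM1] _] [_ [M2 hM2] _]; set Z := (Z in beltrami_coef Z) => w.
pose M := Num.max 1 (M1 + M2); have M_ge1 : 1 <= M by rewrite le_max lexx.
have Z_le n : \sum_(i < n) \sum_(j < n) Normc.normc (Z i j) * rho ^+ (i + j) <= M.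
  apply: (@le_trans _ _ (M1 + M2)); last by rewrite le_max lexx orbT.
  apply: le_trans (lerD (hM1 n) (hM2 n)); rewrite !(pnorm2_ptrunc _ _ (ltW rho0)) -big_split /=.
  apply: ler_sum => i _; rewrite -big_split /=; apply: ler_sum => j _.
  by rewrite -mulrDl ler_wpM2r ?exprn_ge0 ?(ltW rho0) // normc_le_ReIm.
have w_le := normc_beltrami_coef_le rho0 rho1 M_ge1 Z_le.
have majorized := pseries_of_beltrami_majorant rho0 M_ge1.
have [u hu] := majorized _ x (fun i j => le_trans (Re_le_normc _) (w_le i j)).
have [v hv] := majorized _ x (fun i j => le_trans (Im_le_normc _) (w_le i j)).
by exists ((4 * (M / rho))^-1 / 2), u, v.
Qed.

Lemma beltrami_solution (R : realType) (X Y : 'rV[R]_2 -> R) (x : 'rV[R]_2) :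
  analytic_at X x -> analytic_at Y x ->
  exists u v : 'rV[R]_2 -> R,
    [/\ analytic_at u x, analytic_at v x, partial 0 u x = 1, partial 0 v x = 0 &
     (\forall y \near x, partial 1 u y = X y * partial 0 u y - Y y * partial 0 v y) /\
     (\forall y \near x, partial 1 v y = Y y * partial 0 u y + X y * partial 0 v y)].
Proof.
move=> Xx Yx; have [rho [a [b [rho1 Xa Yb]]]] := analytic_pseries_pair Xx Yx.
have [s [u [v]]] := beltrami_pseries_exists rho1 Xa Yb; set w := beltrami_coef _ => -[hu hv].
have [du dv] := (pseries_partial 0 hu, pseries_partial 0 hv).
have Re_partial i : (fun k l => complex.Re (partial_coefs i w k l))
    = partial_coefs i (fun k l => complex.Re (w k l)) by exact: raddf_partial_coefs.
have Im_partial i : (fun k l => complex.Im (partial_coefs i w k l))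
    = partial_coefs i (fun k l => complex.Im (w k l)) by exact: raddf_partial_coefs.
have coef_eq i j : partial_coefs 1 w i j
    = cauchy_product (fun k l => Complex (a k l) (b k l)) (partial_coefs 0 w) i j.
  exact: beltrami_coefS.
exists u, v; split; [exact: pseries_analytic hu|exact: pseries_analytic hv| | |].
- by rewrite -(pseries_value du).
- by rewrite -(pseries_value dv).
have [[rho0 _ _] [s0 _ _]] := (Xa, du).
pose t := Num.min rho (s / 16); have t0 : 0 < t by rewrite lt_min rho0.
have tr : 0 < t <= rho by rewrite t0 ge_min lexx.
have ts : 0 < t <= s / 16 by rewrite t0 ge_min lexx orbT.
have [{}Xa {}Yb] := (pseries_le_radius Xa tr, pseries_le_radius Yb tr).
have [{}du {}dv] := (pseries_le_radius du ts, pseries_le_radius dv ts).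
split.
  have rhs := pseriesD (pseriesM Xa du) (pseriesN (pseriesM Yb dv)).
  apply: pseries_unique (pseries_partial 1 hu) _; move: rhs; congr (pseries _ _ _ _).
  apply/funext => i; apply/funext => j.
  by rewrite -!Re_partial -Im_partial coef_eq cauchy_product_Re.
have rhs := pseriesD (pseriesM Yb du) (pseriesM Xa dv).
apply: pseries_unique (pseries_partial 1 hv) _; move: rhs; congr (pseries _ _ _ _).
apply/funext => i; apply/funext => j.
by rewrite -Re_partial -!Im_partial coef_eq cauchy_product_Im.
Qed.

(** * The analytic inverse function theorem *)

(* The inverse of [k |-> k - E (x + k)], for a perturbation [E] with small
   polynomial approximations [N], is the limit of the fixed point iteration
   [k |-> h + E (x + k)], run on the approximations. *)
Section FixedPointIteration.
Context {R : realType}.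
Variables (N : 'I_2 -> nat -> poly2 R) (rho : R).
Hypotheses (rho0 : 0 < rho)
  (N_le : forall i n, pnorm2 (2 * rho) (N i n) <= rho / 8)
  (N_rate : forall i, geometric_rate (2 * rho) (N i)).

Fixpoint fixpoint_iter n : 'I_2 -> poly2 R :=
  if n is m.+1 then fun i => pvar i + psubst (fixpoint_iter m) (N i m) else fun=> 0.

Let sigma := rho / 2.
Let sigma0 : 0 < sigma. Proof. by rewrite divr_gt0. Qed.

Let rho2_ge0 : 0 <= 2 * rho. Proof. by rewrite mulr_ge0 // ltW. Qed.

Let sigma_seminorm := pnorm2_seminorm (ltW sigma0).

Lemma fixpoint_iter_le n i : pnorm2 sigma (fixpoint_iter n i) <= rho.
Proof.
elim: n i => [|n IH] i /=; first by rewrite (snorm0 sigma_seminorm) ltW.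
apply: le_trans (snormD sigma_seminorm _ _) _.
have subst_le : pnorm2 sigma (psubst (fixpoint_iter n) (N i n)) <= rho / 8.
  apply: le_trans (psubst_le _ (ltW sigma0) IH) _; apply: le_trans (N_le i n).
  by apply: pnorm2_le_radius; rewrite (ltW rho0) ler_double // ltW.
have var_le : pnorm2 sigma (pvar i) <= rho / 2 := pnorm2_var i (ltW sigma0).
by have := rho0; lra.
Qed.

Lemma fixpoint_iter_step C n i : pnorm2 (2 * rho) (N i n.+1 - N i n) <= C / 2 ^+ n ->
  pnorm2 sigma (fixpoint_iter n.+2 i - fixpoint_iter n.+1 i)
    <= C / 2 ^+ n + (\sum_j pnorm2 sigma (fixpoint_iter n.+1 j - fixpoint_iter n j)) / 8.
Proof.
move=> rateC; set S := \sum_j _.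
have -> : fixpoint_iter n.+2 i - fixpoint_iter n.+1 i
    = psubst (fixpoint_iter n.+1) (N i n.+1 - N i n)
      + (psubst (fixpoint_iter n.+1) (N i n) - psubst (fixpoint_iter n) (N i n)).
  by rewrite psubstB subrKA /= opprD addrACA subrr add0r.
apply: le_trans (snormD sigma_seminorm _ _) _; apply: lerD.
  apply: le_trans (psubst_le _ (ltW sigma0) (fixpoint_iter_le n.+1)) _.
  apply: le_trans rateC; apply: pnorm2_le_radius.
  by rewrite (ltW rho0) ler_double // ltW.
rewrite -(ler_pM2r rho0).
apply: le_trans (psubst_lipschitz _ (ltW sigma0) (fixpoint_iter_le _) (fixpoint_iter_le _)) _.
have S0 : 0 <= S by apply: sumr_ge0 => j _; exact: pnorm2_ge0 (ltW sigma0).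
by rewrite -/S (_ : S / 8 * rho = rho / 8 * S) ?ler_wpM2r //; ring.
Qed.

Lemma fixpoint_iter_rate i : geometric_rate sigma (fun n => fixpoint_iter n i).
Proof.
have [[C0 hC0] [C1 hC1]] := (N_rate 0, N_rate 1); pose C := C0 + C1.
have C0_ge0 := geometric_rate_const_ge0 rho2_ge0 hC0.
have C1_ge0 := geometric_rate_const_ge0 rho2_ge0 hC1.
pose S n := \sum_j pnorm2 sigma (fixpoint_iter n.+1 j - fixpoint_iter n j).
suff S_le n : S n <= (8 * C + 2 * rho) / 2 ^+ n.
  exists (8 * C + 2 * rho) => n; apply: le_trans (S_le n).
  by rewrite /S (bigD1 i) //= lerDl sumr_ge0 // => j _; exact: pnorm2_ge0 (ltW sigma0).
elim: n => [|n IH].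
  rewrite expr0 divr1 /S sum_I2 [fixpoint_iter 0]/= !subr0.
  by have := fixpoint_iter_le 1 0; have := fixpoint_iter_le 1 1; rewrite /C; lra.
have step0 := fixpoint_iter_step (hC0 n); have step1 := fixpoint_iter_step (hC1 n).
rewrite -/(S n) in step0 step1; rewrite [S n.+1]sum_I2.
apply: le_trans (lerD step0 step1) _; rewrite exprS invfM; move: IH.
have t0 : 0 <= (2 ^+ n)^-1 :> R by rewrite invr_ge0 exprn_ge0.
have := mulr_ge0 (ltW rho0) t0; have := mulr_ge0 C0_ge0 t0; have := mulr_ge0 C1_ge0 t0.
by move: (S n) (2 ^+ n)^-1 => Sn t; rewrite /C; lra.
Qed.

End FixedPointIteration.

Section PerturbedIdentity.
Context {R : realType}.
Variables (E : 'rV[R]_2 -> 'rV[R]_2) (x : 'rV[R]_2) (rho : R) (N : 'I_2 -> nat -> poly2 R).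
Hypotheses (EN : forall i, papprox (fun z => E z 0 i) x (2 * rho) (N i))
  (N_le : forall i n, pnorm2 (2 * rho) (N i n) <= rho / 8).
Implicit Types h k : 'rV[R]_2.

Let rho0 : 0 < rho.
Proof. by have [+ _ _] := EN 0; rewrite pmulr_rgt0. Qed.

Lemma perturbation_lipschitz k k' i : `|k| <= rho -> `|k'| <= rho ->
  `|E (x + k) 0 i - E (x + k') 0 i| <= (\sum_j `|k 0 j - k' 0 j|) / 8.
Proof.
move=> kr kr'; have [_ _ hE] := EN i.
have rho_le2 : rho <= 2 * rho by exact: ler_double (ltW rho0).
apply: (@cvgn_le _ (fun n => `|peval k (N i n) - peval k' (N i n)|)).
  by apply: cvg_norm; apply: cvgB; apply: hE; exact: le_trans rho_le2.
move=> n; rewrite -(ler_pM2r rho0); apply: le_trans (peval_lipschitz _ kr kr') _.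
by rewrite mulrAC -mulrA [leRHS]mulrC ler_wpM2r ?sumr_ge0.
Qed.

Lemma perturbed_identity_inj k k' : `|k| <= rho -> `|k'| <= rho ->
  k - E (x + k) = k' - E (x + k') -> k = k'.
Proof.
move=> kr kr' kk'; pose S := \sum_j `|k 0 j - k' 0 j|.
have diff_le j : `|k 0 j - k' 0 j| <= S / 8.
  apply: le_trans (perturbation_lipschitz j kr kr').
  have /rowP/(_ j) := kk'; rewrite !mxE => kkj.
  by rewrite (_ : k 0 j - k' 0 j = E (x + k) 0 j - E (x + k') 0 j) //; lra.
have S0 : 0 <= S by exact: sumr_ge0.
have S_eq0 : S = 0.
  have : S <= S / 8 + S / 8 by rewrite {1}/S sum_I2; exact: lerD.
  by move=> Sle; apply/le_anti/andP; split; lra.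
apply/rowP => j; apply/eqP; rewrite -subr_eq0 -normr_le0.
by have := diff_le j; rewrite S_eq0 mul0r.
Qed.

Lemma perturbed_identity_inverse y : exists K : 'rV[R]_2 -> 'rV[R]_2,
  [/\ vanalytic_at K y, forall h, `|h| <= rho / 2 -> `|K (y + h)| <= rho &
    forall h, `|h| <= rho / 2 -> K (y + h) - E (x + K (y + h)) = h].
Proof.
have s0 : 0 < rho / 2 by rewrite divr_gt0.
have N_rate i : geometric_rate (2 * rho) (N i) by have [] := EN i.
pose K z : 'rV[R]_2 := \row_i limn (fun n => peval (z - y) (fixpoint_iter N n i)).
have KP i : papprox (fun z => K z 0 i) y (rho / 2) (fun n => fixpoint_iter N n i).
  under eq_fun do rewrite mxE.
  exact: papprox_limit s0 (fixpoint_iter_rate rho0 N_le N_rate i).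
have iter_le i n := fixpoint_iter_le rho0 N_le n i.
have EK i := papprox_comp (EN i) KP iter_le.
exists K; split=> [i|h|h hs].
- exact: papprox_analytic (KP i).
- exact: papprox_inner_norm_le (EN 0) KP iter_le h.
apply/rowP => i; have [_ _ hK] := KP i; have [_ _ hEK] := EK i.
suff fixed : K (y + h) 0 i = h 0 i + E (x + K (y + h)) 0 i.
  by rewrite mxE [X in _ + X]mxE fixed addrK.
have lim_iter : peval h (fixpoint_iter N n.+1 i) @[n --> \oo] --> K (y + h) 0 i.
  by rewrite (cvg_shiftS (fun n => peval h (fixpoint_iter N n i))); exact: hK.
suff lim_fixed : peval h (fixpoint_iter N n.+1 i) @[n --> \oo] --> h 0 i + E (x + K (y + h)) 0 i.
  exact: cvg_unique lim_iter lim_fixed.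
under eq_cvg do rewrite /= raddfD /= peval_var.
by apply: cvgD; [exact: cvg_cst|exact: hEK].
Qed.

End PerturbedIdentity.

Section InverseFunction.
Context {R : realType}.
Implicit Types (x y h k : 'rV[R]_2).

Lemma pnorm2_nonaffine_part_small rho M : 0 < rho -> 0 < M ->
  exists2 sigma : R, 0 < sigma & 2 * sigma <= rho /\
    forall p, pnorm2 rho p <= M -> pnorm2 (2 * sigma) (nonaffine_part p) <= sigma / 8.
Proof.
move=> r0 M0; pose sigma := Num.min (rho / 2) (rho ^+ 2 / (32 * M)).
have s0 : 0 < sigma by rewrite lt_min !divr_gt0 ?exprn_gt0 ?mulr_gt0.
have s_le : sigma <= rho / 2 by rewrite ge_min lexx.
have sM_le : sigma * (32 * M) <= rho ^+ 2.
  by rewrite -ler_pdivlMr ?mulr_gt0 // ge_min lexx orbT.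
exists sigma => //; split=> [|p pM]; first by lra.
rewrite -(ler_pM2r (exprn_gt0 2 r0)).
apply: le_trans (pnorm2_nonaffine_part_scale _ (_ : 0 <= 2 * sigma <= rho)) _; first by lra.
apply: (@le_trans _ _ ((2 * sigma) ^+ 2 * M)); first by rewrite ler_wpM2l ?exprn_ge0 //; lra.
have -> : (2 * sigma) ^+ 2 * M = sigma / 8 * (sigma * (32 * M)) by rewrite expr2; field.
by rewrite ler_wpM2l //; lra.
Qed.

(* [F (x + k) = F x + k - E (x + k)], where [E] has vanishing differential at [x]. *)
Lemma perturbation_of_identity (F : 'rV[R]_2 -> 'rV[R]_2) x : vanalytic_at F x ->
  (forall i, partial i F x = delta_mx 0 i) ->
  exists rho N, (forall i, papprox (fun z => (z - x - (F z - F x)) 0 i) x (2 * rho) (N i))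
             /\ forall i n, pnorm2 (2 * rho) (N i n) <= rho / 8.
Proof.
move=> Fx dF; have [s0 [P0 FP0]] := analytic_papprox (Fx 0).
have [s1 [P1 FP1]] := analytic_papprox (Fx 1).
have [r r0 [_ _ {}FP0 {}FP1]] := papprox_common_radius FP0 FP1.
pose P (i : 'I_2) := if i == 0 then P0 else P1.
have FP i : papprox (fun z => F z 0 i) x r (P i) by rewrite /P; case: (I2_cases i) => ->.
have [M M0 hM] : exists2 M, 0 < M & forall i n, pnorm2 r (P i n) <= M.
  have [[_ hP0 _] [_ hP1 _]] := (FP 0, FP 1).
  have [M0 M00 hM0] := geometric_rate_bounded (ltW r0) hP0.
  have [M1 M10 hM1] := geometric_rate_bounded (ltW r0) hP1.
  exists (M0 + M1) => [|i n]; first by rewrite addr_gt0.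
  by have := hM0 n; have := hM1 n; case: (I2_cases i) => ->; lra.
have [rho rho0 [rho_le small]] := pnorm2_nonaffine_part_small r0 M0.
exists rho, (fun i n => - nonaffine_part (P i n)); split=> i => [|n]; last first.
  by rewrite (snormN (pnorm2_seminorm _)) ?small //; lra.
have dFi j : partial j (fun z => F z 0 i) x = (i == j)%:R.
  by rewrite -partial_coord ?dF ?mxE //; exact: vanalytic_differentiable.
have := papproxN (papprox_nonaffine_part (FP i)).
have -> : (fun z => - (F z 0 i - (F x 0 i + \sum_j partial j (fun z => F z 0 i) x * (z - x) 0 j)))
    = (fun z => (z - x - (F z - F x)) 0 i).
  apply/funext => z; under eq_bigr do rewrite dFi.
  rewrite (bigD1 i) //= big1 => [|j /negPf ji]; last by rewrite eq_sym ji mul0r.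
  by rewrite !mxE eqxx mul1r; ring.
by move=> /papprox_le_radius; apply; lra.
Qed.

Lemma inverse_function_normalized (F : 'rV[R]_2 -> 'rV[R]_2) x : vanalytic_at F x ->
  (forall i, partial i F x = delta_mx 0 i) ->
  exists G : 'rV[R]_2 -> 'rV[R]_2, [/\ vanalytic_at G (F x),
    \forall z \near x, G (F z) = z & \forall y \near F x, F (G y) = y].
Proof.
move=> Fx dF; have [rho [N [EN N_le]]] := perturbation_of_identity Fx dF.
have rho0 : 0 < rho by have [+ _ _] := EN 0; rewrite pmulr_rgt0.
set E := (fun z => z - x - (F z - F x)) in EN.
have FE k : F (x + k) = F x + (k - E (x + k)).
  by rewrite /E [x + k]addrC addrK subKr [RHS]addrC subrK.
have [K [Ka K_le KE]] := perturbed_identity_inverse (E := E) EN N_le (F x).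
have FK h : `|h| <= rho / 2 -> F (x + K (F x + h)) = F x + h by move=> hs; rewrite FE KE.
have s0 : 0 < rho / 2 by rewrite divr_gt0.
exists (fun y => x + K y); split.
- by apply: vanalyticD => //; exact: vanalytic_cst.
- have Fnear : \forall z \near x, `|F z - F x| <= rho / 2.
    have /cvgrPdist_le/(_ _ s0) := vanalytic_continuous Fx.
    by apply: filterS => z; rewrite distrC.
  have xnear : \forall z \near x, `|z - x| <= rho.
    by apply/nbhs_shiftP; exists rho => // h; rewrite addrC addKr.
  apply: filterS2 Fnear xnear => z Fz zr.
  have FzE : F x + (F z - F x) = F z by rewrite addrC subrK.
  have KFz := K_le _ Fz; have FKz := FK _ Fz; rewrite FzE in KFz FKz.
  suff <- : z - x = K (F z) by rewrite addrC subrK.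
  apply: (perturbed_identity_inj (E := E) EN N_le zr KFz); apply: (@addrI _ (F x)).
  by rewrite -!FE FKz addrC subrK.
- by apply/nbhs_shiftP; exists (rho / 2).
Qed.

Theorem inverse_function (F : 'rV[R]_2 -> 'rV[R]_2) x : vanalytic_at F x ->
  \matrix_i partial i F x \in unitmx ->
  exists G : 'rV[R]_2 -> 'rV[R]_2, [/\ vanalytic_at G (F x),
    \forall z \near x, G (F z) = z & \forall y \near F x, F (G y) = y].
Proof.
move=> Fx; set A := (\matrix_i _) => Au; pose L y := y *m invmx A.
have LF : vanalytic_at (L \o F) x by exact: vanalytic_mulmxr.
have dLF i : partial i (L \o F) x = delta_mx 0 i.
  rewrite partial_mulmxr // -[partial i F x](rowK (fun i => partial i F x)) -/A rowE -mulmxA.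
  by rewrite mulmxV // mulmx1.
have [G [Ga GLF LFG]] := inverse_function_normalized LF dLF.
have La y : vanalytic_at L y by apply: vanalytic_mulmxr => i; exact: analytic_coord.
exists (G \o L); split=> //; first exact: vanalytic_comp.
have : \forall y \near F x, L (F (G (L y))) = L y := vanalytic_continuous (La (F x)) LFG.
apply: filterS => y /= LFGy.
by rewrite -[LHS](mulmxKV Au) -[RHS](mulmxKV Au) -!/(L _) LFGy.
Qed.

End InverseFunction.

(** * The Hermitian geometry of C^4 and the triple cross product *)

Local Notation o0 := (@Ordinal 4 0 isT).
Local Notation o1 := (@Ordinal 4 1 isT).
Local Notation o2 := (@Ordinal 4 2 isT).
Local Notation o3 := (@Ordinal 4 3 isT).

Lemma ord4_ind (P : 'I_4 -> Prop) : P o0 -> P o1 -> P o2 -> P o3 -> forall i, P i.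
Proof.
by move=> p0 p1 p2 p3 [[|[|[|[|]]]] hi] //;
  [move: p0|move: p1|move: p2|move: p3]; congr P; apply/val_inj.
Qed.

Lemma sum4 (V : zmodType) (F : 'I_4 -> V) : \sum_j F j = F o0 + F o1 + F o2 + F o3.
Proof.
rewrite !(big_ord_recl, big_ord0) addr0 !addrA.
by do !congr (_ + _); congr (F _); apply/val_inj.
Qed.

Lemma det4 (K : comNzRingType) (F : 'I_4 -> 'I_4 -> K) :
  \det (\matrix_(i, j) F i j) =
    F o3 o0 * - (F o0 o1 * (F o1 o2 * F o2 o3 - F o1 o3 * F o2 o2)
       - F o0 o2 * (F o1 o1 * F o2 o3 - F o1 o3 * F o2 o1)
       + F o0 o3 * (F o1 o1 * F o2 o2 - F o1 o2 * F o2 o1))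
  + F o3 o1 * (F o0 o0 * (F o1 o2 * F o2 o3 - F o1 o3 * F o2 o2)
       - F o0 o2 * (F o1 o0 * F o2 o3 - F o1 o3 * F o2 o0)
       + F o0 o3 * (F o1 o0 * F o2 o2 - F o1 o2 * F o2 o0))
  + F o3 o2 * - (F o0 o0 * (F o1 o1 * F o2 o3 - F o1 o3 * F o2 o1)
       - F o0 o1 * (F o1 o0 * F o2 o3 - F o1 o3 * F o2 o0)
       + F o0 o3 * (F o1 o0 * F o2 o1 - F o1 o1 * F o2 o0))
  + F o3 o3 * (F o0 o0 * (F o1 o1 * F o2 o2 - F o1 o2 * F o2 o1)
       - F o0 o1 * (F o1 o0 * F o2 o2 - F o1 o2 * F o2 o0)
       + F o0 o2 * (F o1 o0 * F o2 o1 - F o1 o1 * F o2 o0)).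
Proof.
pose G (i j : nat) := F (inord i) (inord j).
have GE i j : F i j = G i j by rewrite /G !inord_val.
rewrite (_ : \matrix_(i, j) F i j = \matrix_(i, j) G i j); last first.
  by apply/matrixP => i j; rewrite !mxE GE.
rewrite !GE /=.
rewrite (expand_det_row _ o3) sum4 /cofactor !mxE /=.
rewrite !(expand_det_row _ ord0) !(big_ord_recl, big_ord0) /cofactor !mxE /=.
rewrite !(expand_det_row _ ord0) !(big_ord_recl, big_ord0) /cofactor !mxE /=.
rewrite !det_mx11 !mxE /= /bump /=.
by ring.
Qed.

Section InnerProduct.
Context {R : realType}.
Implicit Types (x y z w : 'rV[R]_8) (a : R).

Lemma innerC x y : inner x y = inner y x.
Proof. by apply: eq_bigr => k _; rewrite mulrC. Qed.

Lemma innerDl x y z : inner (x + y) z = inner x z + inner y z.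
Proof. by rewrite -big_split; apply: eq_bigr => k _; rewrite mxE mulrDl. Qed.

Lemma innerZl a x z : inner (a *: x) z = a * inner x z.
Proof. by rewrite mulr_sumr; apply: eq_bigr => k _; rewrite mxE mulrA. Qed.

Lemma innerNl x z : inner (- x) z = - inner x z.
Proof. by rewrite -scaleN1r innerZl mulN1r. Qed.

Lemma innerDr x y z : inner x (y + z) = inner x y + inner x z.
Proof. by rewrite !(innerC x) innerDl. Qed.

Lemma innerZr a x z : inner x (a *: z) = a * inner x z.
Proof. by rewrite !(innerC x) innerZl. Qed.

Lemma innerNr x z : inner x (- z) = - inner x z.
Proof. by rewrite !(innerC x) innerNl. Qed.

Lemma inner0l x : inner 0 x = 0.
Proof. by rewrite -(scale0r 0) innerZl mul0r. Qed.

Lemma inner0r x : inner x 0 = 0.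
Proof. by rewrite innerC inner0l. Qed.

Definition innerE := (innerDl, innerZl, innerNl, innerDr, innerZr, innerNr, inner0l, inner0r).

Lemma inner_ge0 x : 0 <= inner x x.
Proof. by apply: sumr_ge0 => k _; rewrite -expr2 sqr_ge0. Qed.

Lemma inner_eq0 x : inner x x = 0 -> x = 0.
Proof.
move=> /eqP; rewrite psumr_eq0 => [|k _]; last by rewrite -expr2 sqr_ge0.
move=> /allP h; apply/rowP => k; rewrite mxE; apply/eqP.
by have := h k (mem_index_enum k); rewrite /= -expr2 sqrf_eq0.
Qed.

Lemma inner_gt0 x : x != 0 -> 0 < inner x x.
Proof. by move=> x0; rewrite lt_def inner_ge0 andbT; apply: contra x0 => /eqP/inner_eq0 ->. Qed.

Lemma unit_neq0 x : inner x x = 1 -> x != 0.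
Proof. by move=> xx; apply: contra_eq_neq xx => ->; rewrite inner0l eq_sym oner_neq0. Qed.

Lemma inner_ext x y : (forall w, inner x w = inner y w) -> x = y.
Proof.
move=> h; apply/eqP; rewrite -subr_eq0; apply/eqP; apply: inner_eq0.
by rewrite innerDl innerNl h subrr.
Qed.

Lemma inner_delta x k : inner x (delta_mx 0 k) = x 0 k.
Proof.
rewrite /inner (bigD1 k) //= big1 ?addr0; first by rewrite mxE !eqxx mulr1.
by move=> l lk; rewrite mxE (negPf lk) andbF mulr0.
Qed.

Lemma mulmx_trE m n (A : 'M[R]_(m, 8)) (B : 'M[R]_(n, 8)) i j :
  (A *m B^T) i j = inner (row i A) (row j B).
Proof. by rewrite mxE; apply: eq_bigr => k _; rewrite !mxE. Qed.

End InnerProduct.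

Section ComplexStructure.
Context {R : realType}.
Implicit Types (x y z w : 'rV[R]_8) (a b : R).

Let double_lt8 (j : 'I_4) : (j.*2 < 8)%N.
Proof. by have := ltn_ord j; rewrite -[(j < 4)%N]ltn_double. Qed.

Let doubleS_lt8 (j : 'I_4) : (j.*2.+1 < 8)%N.
Proof. by have := ltn_ord j; rewrite -[(j < 4)%N]ltn_Sdouble. Qed.

Definition muli x : 'rV[R]_8 :=
  \row_k (if odd k then x 0 (inord k.-1) else - x 0 (inord k.+1)).

Lemma inner_pairs x y : inner x y = \sum_(j < 4) (x 0 (inord j.*2) * y 0 (inord j.*2)
  + x 0 (inord j.*2.+1) * y 0 (inord j.*2.+1)).
Proof.
rewrite /inner !(big_ord_recl, big_ord0) /= !addr0 !addrA.
by do !congr (_ + _); congr (x 0 _ * y 0 _); apply/val_inj; rewrite /= ?inordK.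
Qed.

Lemma omega_muli x y : omega x y = inner (muli x) y.
Proof.
rewrite omegaE inner_pairs; apply: eq_bigr => j _.
by rewrite !mxE !inordK //= odd_double /= mulNr addrC.
Qed.

Lemma zcoordD j x y : zcoord j (x + y) = zcoord j x + zcoord j y.
Proof. by rewrite /zcoord !mxE; simpc. Qed.

Lemma zcoordZ j a x : zcoord j (a *: x) = a%:C%C * zcoord j x.
Proof. by rewrite /zcoord !mxE; simpc. Qed.

Lemma zcoord_muli j x : zcoord j (muli x) = Complex 0 1 * zcoord j x.
Proof. by rewrite /zcoord !mxE !inordK //= odd_double /=; simpc. Qed.

Definition of_zcoord (c : 'I_4 -> R[i]) : 'rV[R]_8 :=
  \row_k (if odd k then complex.Im (c (inord k./2)) else complex.Re (c (inord k./2))).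

Lemma of_zcoordK c j : zcoord j (of_zcoord c) = c j.
Proof.
rewrite /zcoord !mxE !inordK //= odd_double uphalf_double doubleK /= inord_val.
by case: (c _).
Qed.

Definition herm x y : R[i] := \sum_(j < 4) conjc (zcoord j x) * zcoord j y.

Lemma hermE x y : herm x y = Complex (inner x y) (omega x y).
Proof.
rewrite inner_pairs omegaE /herm.
elim/big_rec3: _ => [//|j p q r _ ->].
by rewrite /zcoord; simpc; congr Complex; ring.
Qed.

Lemma inner_herm x y : inner x y = complex.Re (herm x y).
Proof. by rewrite hermE. Qed.

Lemma omega_antisym x y : omega y x = - omega x y.
Proof. by rewrite !omegaE -sumrN; apply: eq_bigr => k _; ring. Qed.

Lemma omega_self x : omega x x = 0.
Proof. by apply/eqP; rewrite -eqNr -omega_antisym. Qed.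

Lemma omegaDr x y z : omega x (y + z) = omega x y + omega x z.
Proof. by rewrite !omega_muli innerDr. Qed.

Lemma omegaZr a x z : omega x (a *: z) = a * omega x z.
Proof. by rewrite !omega_muli innerZr. Qed.

Lemma omegaNr x z : omega x (- z) = - omega x z.
Proof. by rewrite !omega_muli innerNr. Qed.

Lemma omegaDl x y z : omega (y + z) x = omega y x + omega z x.
Proof. by rewrite !(omega_antisym x) omegaDr opprD. Qed.

Lemma omegaZl a x z : omega (a *: z) x = a * omega z x.
Proof. by rewrite !(omega_antisym x) omegaZr mulrN. Qed.

End ComplexStructure.

Section HolomorphicVolumeForm.
Context {R : realType}.
Implicit Types (x y z w : 'rV[R]_8) (a : R) (c d : R[i]).

Lemma Omega_alternate (v : 'I_4 -> 'rV[R]_8) i j : i != j -> v i = v j -> Omega v = 0.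
Proof. by move=> ij vij; apply: (determinant_alternate ij) => k; rewrite !mxE vij. Qed.

(* signed 3x3 minors: the coefficients of [Omega x y z] as a complex linear form *)
Definition minor3 (p q r : 'I_4) x y z : R[i] :=
  zcoord p x * (zcoord q y * zcoord r z - zcoord r y * zcoord q z)
  - zcoord q x * (zcoord p y * zcoord r z - zcoord r y * zcoord p z)
  + zcoord r x * (zcoord p y * zcoord q z - zcoord q y * zcoord p z).

Definition minor (j : 'I_4) x y z : R[i] :=
  match val j with
  | 0 => - minor3 o1 o2 o3 x y z
  | 1 => minor3 o0 o2 o3 x y z
  | 2 => - minor3 o0 o1 o3 x y z
  | _ => minor3 o0 o1 o2 x y z
  end.

Lemma Omega_minor x y z w :
  Omega (quad x y z w) = \sum_(j < 4) minor j x y z * zcoord j w.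
Proof.
rewrite /Omega (det4 (fun i j => zcoord j (quad x y z w i))) sum4 /minor /minor3 /=.
rewrite /quad !(tnth_nth 0) /=; ring.
Qed.

Lemma Omega_linear1 a x x' y z w : Omega (quad (a *: x + x') y z w)
  = a%:C%C * Omega (quad x y z w) + Omega (quad x' y z w).
Proof. by rewrite !Omega_minor !sum4 /minor /= /minor3 !zcoordD !zcoordZ; ring. Qed.

Lemma Omega_linear2 a x y y' z w : Omega (quad x (a *: y + y') z w)
  = a%:C%C * Omega (quad x y z w) + Omega (quad x y' z w).
Proof. by rewrite !Omega_minor !sum4 /minor /= /minor3 !zcoordD !zcoordZ; ring. Qed.

Lemma Omega_linear3 a x y z z' w : Omega (quad x y (a *: z + z') w)
  = a%:C%C * Omega (quad x y z w) + Omega (quad x y z' w).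
Proof. by rewrite !Omega_minor !sum4 /minor /= /minor3 !zcoordD !zcoordZ; ring. Qed.

Lemma Omega_muli4 x y z w : Omega (quad x y z (muli w)) = Complex 0 1 * Omega (quad x y z w).
Proof.
rewrite !Omega_minor mulr_sumr; apply: eq_bigr => j _; rewrite zcoord_muli; ring.
Qed.

Lemma Re_realM a c : complex.Re (a%:C%C * c) = a * complex.Re c.
Proof. by case: c => ? ?; simpc. Qed.

Lemma ReOmega_linear1 a x x' y z w :
  ReOmega (a *: x + x') y z w = a * ReOmega x y z w + ReOmega x' y z w.
Proof. by rewrite /ReOmega Omega_linear1 raddfD /= Re_realM. Qed.

Lemma ReOmega_linear2 a x y y' z w :
  ReOmega x (a *: y + y') z w = a * ReOmega x y z w + ReOmega x y' z w.
Proof. by rewrite /ReOmega Omega_linear2 raddfD /= Re_realM. Qed.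

Lemma ReOmega_linear3 a x y z z' w :
  ReOmega x y (a *: z + z') w = a * ReOmega x y z w + ReOmega x y z' w.
Proof. by rewrite /ReOmega Omega_linear3 raddfD /= Re_realM. Qed.

Lemma ReOmega_swap12 x y z w : ReOmega y x z w = - ReOmega x y z w.
Proof.
rewrite /ReOmega -raddfN /=; congr complex.Re.
by rewrite !Omega_minor !sum4 /minor /= /minor3; ring.
Qed.

Lemma ReOmega_swap14 x y z w : ReOmega w y z x = - ReOmega x y z w.
Proof.
rewrite /ReOmega -raddfN /=; congr complex.Re.
by rewrite !Omega_minor !sum4 /minor /= /minor3; ring.
Qed.

Lemma ReOmega_swap34 x y z w : ReOmega x y w z = - ReOmega x y z w.
Proof.
rewrite /ReOmega -raddfN /=; congr complex.Re.
by rewrite !Omega_minor !sum4 /minor /= /minor3; ring.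
Qed.

Lemma cross_linear1 a x x' y z : cross (a *: x + x') y z = a *: cross x y z + cross x' y z.
Proof. by apply: inner_ext => w; rewrite !innerE !crossP ReOmega_linear1. Qed.

Lemma cross_linear3 a x y z z' : cross x y (a *: z + z') = a *: cross x y z + cross x y z'.
Proof. by apply: inner_ext => w; rewrite !innerE !crossP ReOmega_linear3. Qed.

Lemma crossD3 x y z z' : cross x y (z + z') = cross x y z + cross x y z'.
Proof. by rewrite -[z in LHS]scale1r cross_linear3 scale1r. Qed.

Lemma cross03 x y : cross x y 0 = 0.
Proof. by have := cross_linear3 (-1) x y 0 0; rewrite scaler0 addr0 scaleN1r addNr. Qed.

Lemma crossZ3 a x y z : cross x y (a *: z) = a *: cross x y z.
Proof. by rewrite -[a *: z]addr0 cross_linear3 cross03 addr0. Qed.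

Lemma crossN3 x y z : cross x y (- z) = - cross x y z.
Proof. by rewrite -scaleN1r crossZ3 scaleN1r. Qed.

Lemma cross01 y z : cross 0 y z = 0.
Proof. by have := cross_linear1 (-1) 0 0 y z; rewrite scaler0 addr0 scaleN1r addNr. Qed.

Lemma cross_swap12 x y z : cross y x z = - cross x y z.
Proof. by apply: inner_ext => w; rewrite innerNl !crossP ReOmega_swap12. Qed.

Lemma cross_xxz x z : cross x x z = 0.
Proof. by apply: inner_ext => w; rewrite crossP inner0l /ReOmega (@Omega_alternate _ o0 o1). Qed.

Lemma cross_xyx x y : cross x y x = 0.
Proof. by apply: inner_ext => w; rewrite crossP inner0l /ReOmega (@Omega_alternate _ o0 o2). Qed.

Lemma cross_xyy x y : cross x y y = 0.
Proof. by apply: inner_ext => w; rewrite crossP inner0l /ReOmega (@Omega_alternate _ o1 o2). Qed.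

Lemma zcoord_cross j x y z : zcoord j (cross x y z) = conjc (minor j x y z).
Proof.
rewrite -(of_zcoordK (fun j => conjc (minor j x y z)) j); congr zcoord; symmetry.
apply: cross_unique => w; rewrite inner_herm /herm /ReOmega Omega_minor.
by congr complex.Re; apply: eq_bigr => k _; rewrite of_zcoordK conjcK.
Qed.

(* Cauchy-Binet for a 3 x 4 matrix and its conjugate *)
Lemma herm_cross x y z : herm (cross x y z) (cross x y z) =
  herm x x * (herm y y * herm z z - herm y z * herm z y)
  - herm x y * (herm y x * herm z z - herm y z * herm z x)
  + herm x z * (herm y x * herm z y - herm y y * herm z x).
Proof.
have conj_minor3 p q r : conjc (minor3 p q r x y z) =
  conjc (zcoord p x)
    * (conjc (zcoord q y) * conjc (zcoord r z) - conjc (zcoord r y) * conjc (zcoord q z))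
  - conjc (zcoord q x)
    * (conjc (zcoord p y) * conjc (zcoord r z) - conjc (zcoord r y) * conjc (zcoord p z))
  + conjc (zcoord r x)
    * (conjc (zcoord p y) * conjc (zcoord q z) - conjc (zcoord q y) * conjc (zcoord p z)).
  by rewrite /minor3 !(rmorphB, rmorphD, rmorphM).
have conjN c : conjc (- c) = - conjc c by rewrite rmorphN.
rewrite /herm !sum4 !zcoord_cross !conjcK.
have -> : minor o0 x y z = - minor3 o1 o2 o3 x y z by [].
have -> : minor o1 x y z = minor3 o0 o2 o3 x y z by [].
have -> : minor o2 x y z = - minor3 o0 o1 o3 x y z by [].
have -> : minor o3 x y z = minor3 o0 o1 o2 x y z by [].
rewrite !conjN !conj_minor3 /minor3.
move: (zcoord o0 x) (zcoord o1 x) (zcoord o2 x) (zcoord o3 x) => x0 x1 x2 x3.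
move: (zcoord o0 y) (zcoord o1 y) (zcoord o2 y) (zcoord o3 y) => y0 y1 y2 y3.
move: (zcoord o0 z) (zcoord o1 z) (zcoord o2 z) (zcoord o3 z) => z0 z1 z2 z3.
ring.
Qed.

Lemma cross_norm x y z : inner x y = 0 -> inner x z = 0 -> inner y z = 0 ->
  inner (cross x y z) (cross x y z) =
    inner x x * inner y y * inner z z - inner x x * omega y z ^+ 2
    - inner y y * omega x z ^+ 2 - inner z z * omega x y ^+ 2.
Proof.
move=> xy xz yz; rewrite [LHS]inner_herm herm_cross !hermE.
rewrite (innerC y x) (innerC z x) (innerC z y) xy xz yz.
rewrite (omega_antisym x y) (omega_antisym x z) (omega_antisym y z) !omega_self; simpc => /=; ring.
Qed.

End HolomorphicVolumeForm.

Definition orthonormal_pair (R : realType) (p q : 'rV[R]_8) : Prop :=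
  [/\ inner p p = 1, inner q q = 1 & inner p q = 0].

Definition unitary_pair (R : realType) (p q : 'rV[R]_8) : Prop :=
  orthonormal_pair p q /\ omega p q = 0.

Definition herm_perp (R : realType) (p q z : 'rV[R]_8) : Prop :=
  [/\ inner p z = 0, inner q z = 0, omega p z = 0 & omega q z = 0].

Section PerpPart.
Context {R : realType}.
Variables p q : 'rV[R]_8.
Implicit Types (z w : 'rV[R]_8) (a : R).

Definition perp_part z : 'rV[R]_8 := z - inner p z *: p - inner q z *: q.

Lemma perp_partD z w : perp_part (z + w) = perp_part z + perp_part w.
Proof. by rewrite /perp_part !innerE; apply/rowP => k; rewrite !mxE; ring. Qed.

Lemma perp_partZ a z : perp_part (a *: z) = a *: perp_part z.
Proof. by rewrite /perp_part !innerE; apply/rowP => k; rewrite !mxE; ring. Qed.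

Lemma perp_part_decomp z : z = perp_part z + inner p z *: p + inner q z *: q.
Proof. by rewrite /perp_part; apply/rowP => k; rewrite !mxE; ring. Qed.

Lemma perp_part_id z : inner p z = 0 -> inner q z = 0 -> perp_part z = z.
Proof. by move=> pz qz; rewrite /perp_part pz qz !scale0r !subr0. Qed.

Lemma perp_part_sub m (E : 'M[R]_(m, 8)) z :
  (p <= E)%MS -> (q <= E)%MS -> (z <= E)%MS -> (perp_part z <= E)%MS.
Proof. by move=> pE qE zE; rewrite /perp_part -!scaleNr !addmx_sub // scalemx_sub. Qed.

Lemma perp_part_subE m (E : 'M[R]_(m, 8)) z :
  (p <= E)%MS -> (q <= E)%MS -> (perp_part z <= E)%MS = (z <= E)%MS.
Proof.
move=> pE qE; apply/idP/idP => [zE|]; last exact: perp_part_sub.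
rewrite (perp_part_decomp z); apply: addmx_sub; last exact: scalemx_sub.
by apply: addmx_sub => //; exact: scalemx_sub.
Qed.

Hypothesis pq : orthonormal_pair p q.

Lemma inner_p_perp_part z : inner p (perp_part z) = 0.
Proof. by have [pp qq pq0] := pq; rewrite /perp_part !innerE pp pq0; ring. Qed.

Lemma inner_q_perp_part z : inner q (perp_part z) = 0.
Proof. by have [pp qq pq0] := pq; rewrite /perp_part !innerE qq (innerC q p) pq0; ring. Qed.

Lemma perp_part_p : perp_part p = 0.
Proof.
by have [pp _ pq0] := pq; rewrite /perp_part pp (innerC q p) pq0 scale1r scale0r subr0 subrr.
Qed.

Lemma perp_part_q : perp_part q = 0.
Proof. by have [_ qq pq0] := pq; rewrite /perp_part qq pq0 scale1r scale0r subr0 subrr. Qed.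

End PerpPart.

Section CrossOperator.
Context {R : realType}.
Variables p q : 'rV[R]_8.
Local Notation J := (cross p q).
Implicit Types (z w v : 'rV[R]_8) (a : R).

Lemma cross_perp_part z : J (perp_part p q z) = J z.
Proof.
by rewrite /perp_part !crossD3 !crossN3 !crossZ3 cross_xyx cross_xyy !scaler0 oppr0 !addr0.
Qed.

Lemma herm_perp_cross z : herm_perp p q (J z).
Proof.
split; rewrite ?omega_muli innerC crossP /ReOmega ?Omega_muli4.
- by rewrite (@Omega_alternate _ _ o0 o3).
- by rewrite (@Omega_alternate _ _ o1 o3).
- by rewrite (@Omega_alternate _ _ o0 o3) ?mulr0.
- by rewrite (@Omega_alternate _ _ o1 o3) ?mulr0.
Qed.

Lemma perp_part_cross z : perp_part p q (J z) = J z.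
Proof. by have [pJ qJ _ _] := herm_perp_cross z; exact: perp_part_id. Qed.

Lemma cross_skew_adjoint z w : inner (J z) w = - inner z (J w).
Proof. by rewrite crossP (innerC z) crossP ReOmega_swap34. Qed.

Lemma inner_cross_self z : inner z (J z) = 0.
Proof. by apply/eqP; rewrite -eqNr -cross_skew_adjoint innerC. Qed.

Lemma omega_cross_self z : omega z (J z) = 0.
Proof.
by rewrite omega_muli innerC crossP /ReOmega Omega_muli4 (@Omega_alternate _ _ o2 o3) ?mulr0.
Qed.

Lemma herm_perpD z w : herm_perp p q z -> herm_perp p q w -> herm_perp p q (z + w).
Proof.
move=> [pz qz wpz wqz] [pw qw wpw wqw]; split; rewrite ?innerDr ?omegaDr.
- by rewrite pz pw addr0.
- by rewrite qz qw addr0.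
- by rewrite wpz wpw addr0.
- by rewrite wqz wqw addr0.
Qed.

Lemma herm_perpZ a z : herm_perp p q z -> herm_perp p q (a *: z).
Proof.
by move=> [pz qz wpz wqz]; split; rewrite ?innerZr ?omegaZr ?pz ?qz ?wpz ?wqz mulr0.
Qed.

Lemma herm_perp_swap z : herm_perp p q z -> herm_perp q p z.
Proof. by case. Qed.

End CrossOperator.

Lemma unitary_pair_swap (R : realType) (p q : 'rV[R]_8) : unitary_pair p q -> unitary_pair q p.
Proof.
by move=> [[pp qq pq] wpq]; rewrite /unitary_pair /orthonormal_pair innerC omega_antisym wpq oppr0.
Qed.

Section UnitaryCrossOperator.
Context {R : realType}.
Variables p q : 'rV[R]_8.
Hypothesis pqU : unitary_pair p q.
Local Notation J := (cross p q).
Implicit Types (z w v : 'rV[R]_8) (a : R).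

Lemma herm_perp_perp_part z : omega p z = 0 -> omega q z = 0 -> herm_perp p q (perp_part p q z).
Proof.
have [pq wpq] := pqU; move=> wp wq; split.
- exact: inner_p_perp_part.
- exact: inner_q_perp_part.
- by rewrite /perp_part !(omegaDr, omegaNr, omegaZr) wp omega_self wpq; ring.
- by rewrite /perp_part !(omegaDr, omegaNr, omegaZr) wq omega_self (omega_antisym p q) wpq; ring.
Qed.

Lemma cross_norm_herm_perp z : herm_perp p q z -> inner (J z) (J z) = inner z z.
Proof.
have [[pp qq pq] wpq] := pqU.
by move=> [pz qz wpz wqz]; rewrite cross_norm // pp qq wpq wpz wqz; ring.
Qed.

Lemma cross_neq0 z : herm_perp p q z -> z != 0 -> J z != 0.
Proof.
move=> zH; apply: contra => /eqP Jz; apply/eqP/inner_eq0.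
by rewrite -cross_norm_herm_perp // Jz inner0l.
Qed.

Lemma cross_isometry z w : herm_perp p q z -> herm_perp p q w -> inner (J z) (J w) = inner z w.
Proof.
move=> zH wH; have := cross_norm_herm_perp (herm_perpD zH wH).
rewrite crossD3 !innerE !cross_norm_herm_perp // (innerC (J w)) (innerC w).
by move: (inner (J z) (J w)) (inner z w) (inner z z) (inner w w) => *; lra.
Qed.

Lemma cross_cross z : herm_perp p q z -> J (J z) = - z.
Proof.
move=> zH; have sumH : herm_perp p q (J (J z) + z) by exact: herm_perpD (herm_perp_cross _ _ _) zH.
apply/eqP; rewrite -subr_eq0 opprK; apply/eqP; apply: inner_eq0.
by rewrite innerDl cross_skew_adjoint -[X in _ + X](cross_isometry zH sumH) addrC subrr.
Qed.

(* Equality in Cauchy-Schwarz: both vectors have norm [|v| ^ 2]. *)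
Lemma cross_cross_l v : herm_perp p q v -> cross (J v) q v = - inner v v *: p.
Proof.
have [[pp qq pq] wpq] := pqU; move=> vH; have [pv qv wpv wqv] := vH.
have [pJv qJv wpJv wqJv] := herm_perp_cross p q v.
have norm_eq : inner (cross (J v) q v) (cross (J v) q v) = inner v v ^+ 2.
  rewrite cross_norm ?(innerC _ q) // 1?(innerC _ v) ?inner_cross_self //.
  rewrite (omega_antisym v (J v)) omega_cross_self (omega_antisym q (J v)) wqJv wqv qq.
  by rewrite cross_norm_herm_perp //; ring.
have inner_eq : inner (cross (J v) q v) p = - inner v v.
  by rewrite crossP ReOmega_swap14 -crossP cross_norm_herm_perp.
apply/eqP; rewrite -subr_eq0; apply/eqP; apply: inner_eq0.
by rewrite scaleNr opprK !innerE norm_eq (innerC p) inner_eq pp; ring.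
Qed.

End UnitaryCrossOperator.

Lemma Cayley_isotropic (R : realType) (x y z w : 'rV[R]_8) : omega x y = 0 -> omega x z = 0 ->
  omega x w = 0 -> Cayley x y z w = ReOmega x y z w.
Proof.
move=> xy xz xw.
have omega_0i i : omega (quad x y z w o0) (quad x y z w i) = 0.
  by move: i; apply: ord4_ind; rewrite //= omega_self.
have omega_i0 i : omega (quad x y z w i) (quad x y z w o0) = 0.
  by rewrite omega_antisym omega_0i oppr0.
rewrite /Cayley /wedge22 big1 ?mulr0 ?add0r // => s _.
have : s (s^-1%g o0) = o0 by rewrite permKV.
by move: (s^-1%g o0); apply: ord4_ind => ->; rewrite ?omega_0i ?omega_i0 ?mulr0 ?mul0r.
Qed.

(** * Special Lagrangian planes *)

Section FourFrames.
Context {R : realType}.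
Implicit Types (x y z w v : 'rV[R]_8) (E : 'M[R]_(4, 8)).

Definition rows4 x y z w : 'M[R]_(4, 8) := \matrix_i quad x y z w i.

Lemma quadE x y z w : [/\ quad x y z w o0 = x, quad x y z w o1 = y,
  quad x y z w o2 = z & quad x y z w o3 = w].
Proof. by []. Qed.

Lemma row_rows4 x y z w i : row i (rows4 x y z w) = quad x y z w i.
Proof. exact: rowK. Qed.

Lemma Omega_rows4 x y z w : Omega (fun i => row i (rows4 x y z w)) = Omega (quad x y z w).
Proof. by congr Omega; apply/funext => i; rewrite row_rows4. Qed.

Lemma mulmx_rows4 (c : 'rV[R]_4) x y z w : c *m rows4 x y z w
  = c 0 o0 *: x + c 0 o1 *: y + c 0 o2 *: z + c 0 o3 *: w.
Proof. by rewrite mulmx_sum_row sum4 !row_rows4. Qed.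

Lemma sub_rows4P v x y z w : reflect
  (exists a b c d : R, v = a *: x + b *: y + c *: z + d *: w) (v <= rows4 x y z w)%MS.
Proof.
apply: (iffP submxP) => [[c ->]|[a [b [c [d ->]]]]].
  by exists (c 0 o0), (c 0 o1), (c 0 o2), (c 0 o3); rewrite mulmx_rows4.
by exists (\row_i nth 0 [:: a; b; c; d] i); rewrite mulmx_rows4 !mxE.
Qed.

Lemma rows4_sub x y z w m (E : 'M[R]_(m, 8)) :
  (rows4 x y z w <= E)%MS = [&& (x <= E)%MS, (y <= E)%MS, (z <= E)%MS & (w <= E)%MS].
Proof.
apply/row_subP/and4P => [rowsE|[xE yE zE wE]].
  by split; [have := rowsE o0|have := rowsE o1|have := rowsE o2|have := rowsE o3];
    rewrite row_rows4.
by apply: ord4_ind; rewrite row_rows4.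
Qed.

Lemma mem_rows4 x y z w : [&& (x <= rows4 x y z w)%MS, (y <= rows4 x y z w)%MS,
  (z <= rows4 x y z w)%MS & (w <= rows4 x y z w)%MS].
Proof. by rewrite -rows4_sub submx_refl. Qed.

Lemma rows4_swap34 x y z w : (rows4 x y w z :=: rows4 x y z w)%MS.
Proof.
apply/eqmxP; rewrite !rows4_sub.
by have /and4P[-> -> -> ->] := mem_rows4 x y z w; have /and4P[-> -> -> ->] := mem_rows4 x y w z.
Qed.

Lemma gram_rows4 x y z w : rows4 x y z w *m (rows4 x y z w)^T
  = \matrix_(i, j) inner (quad x y z w i) (quad x y z w j).
Proof. by apply/matrixP => i j; rewrite mulmx_trE !row_rows4 mxE. Qed.

Lemma det_gram_rows4 x y z w : inner x y = 0 -> inner x z = 0 -> inner y z = 0 ->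
  inner x w = 0 -> inner y w = 0 -> inner z w = 0 ->
  \det (rows4 x y z w *m (rows4 x y z w)^T)
    = inner x x * inner y y * inner z z * inner w w.
Proof.
move=> xy xz yz xw yw zw; have [q0 q1 q2 q3] := quadE x y z w.
rewrite gram_rows4 (det4 (fun i j => inner (quad x y z w i) (quad x y z w j))) q0 q1 q2 q3.
rewrite (innerC y x) (innerC z x) (innerC w x) (innerC z y) (innerC w y) (innerC w z).
by rewrite xy xz yz xw yw zw; ring.
Qed.

Lemma row_free_gram m n (A : 'M[R]_(m, n)) : A *m A^T \in unitmx -> row_free A.
Proof.
rewrite -row_free_unit -!kermx_eq0 -!submx0 => /(submx_trans _); apply.
by rewrite sub_kermx mulmxA mulmx_ker mul0mx.
Qed.

Lemma rows4_free x y z w : inner x y = 0 -> inner x z = 0 -> inner y z = 0 ->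
  inner x w = 0 -> inner y w = 0 -> inner z w = 0 ->
  x != 0 -> y != 0 -> z != 0 -> w != 0 -> row_free (rows4 x y z w).
Proof.
move=> xy xz yz xw yw zw x0 y0 z0 w0; apply: row_free_gram.
by rewrite unitmxE unitfE det_gram_rows4 // !mulf_neq0 // gt_eqF // inner_gt0.
Qed.

Lemma rows4_free_perp_part p q a b (x y : R) : row_free (rows4 p q a b) ->
  perp_part p q (x *: a + y *: b) = 0 -> x = 0 /\ y = 0.
Proof.
move=> free; set z := x *: a + y *: b => z0.
pose c : 'rV[R]_4 := \row_i nth 0 [:: - inner p z; - inner q z; x; y] i.
have c0 : c = 0.
  apply: (row_free_inj free); rewrite mul0mx mulmx_rows4 !mxE /=.
  by rewrite !scaleNr -addrA -/z addrC -[RHS]z0 addrA.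
have := congr1 (fun v : 'rV[R]_4 => v 0 o2) c0.
by have := congr1 (fun v : 'rV[R]_4 => v 0 o3) c0; rewrite !mxE.
Qed.

Lemma rows4_free_perp_part_neq0 p q a b : row_free (rows4 p q a b) -> perp_part p q a != 0.
Proof.
move=> free; apply/eqP => a0; have := @rows4_free_perp_part p q a b 1 0 free.
rewrite scale1r scale0r addr0 => /(_ a0)[/eqP].
by rewrite oner_eq0.
Qed.

Lemma rows4_free_perp_part_neq p q a b (x : R) : row_free (rows4 p q a b) ->
  perp_part p q b <> x *: perp_part p q a.
Proof.
move=> free bE; have [_ /eqP] : - x = 0 /\ 1 = 0 :> R.
  by apply: (rows4_free_perp_part free); rewrite perp_partD !perp_partZ bE scale1r scaleNr addNr.
by rewrite oner_eq0.
Qed.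

Lemma Omega_mulmx (B : 'M[R]_4) (v : 'M[R]_(4, 8)) :
  Omega (fun i => row i (B *m v)) = (\det B)%:C%C * Omega (fun i => row i v).
Proof.
rewrite /Omega.
have -> : \matrix_(i < 4, j < 4) zcoord j (row i (B *m v))
  = map_mx (real_complex R) B *m \matrix_(i < 4, j < 4) zcoord j (row i v).
  apply/matrixP => i j; rewrite !mxE.
  transitivity (\sum_k zcoord j (B i k *: row k v)); last first.
    by apply: eq_bigr => k _; rewrite !mxE zcoordZ.
  rewrite row_mul mulmx_sum_row.
  elim/big_rec2: _ => [|k s t _ <-]; last by rewrite zcoordD mxE.
  by rewrite /zcoord !mxE.
by rewrite det_mulmx det_map_mx.
Qed.

(* A 4-form on a 4-plane is determined by its value on one orthonormal basis. *)
Lemma calibrated_orthonormal_basis E : E *m E^T = 1%:M ->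
  complex.Re (Omega (fun i => row i E)) = 1 ->
  forall v : 'M[R]_(4, 8), (v <= E)%MS ->
    complex.Re (Omega (fun i => row i v)) = \det (v *m E^T).
Proof.
move=> EE E1 v /submxP[B ->].
by rewrite Omega_mulmx Re_realM E1 mulr1 -mulmxA EE mulmx1.
Qed.

Lemma sub_orthonormal_proj k n (E : 'M[R]_(k, n)) m (v : 'M[R]_(m, n)) :
  E *m E^T = 1%:M -> (v <= E)%MS -> v *m E^T *m E = v.
Proof. by move=> EE /submxP[B ->]; rewrite -(mulmxA B) EE mulmx1. Qed.

Lemma inner_proj k (E : 'M[R]_(k, 8)) c w : E *m E^T = 1%:M -> (w <= E)%MS ->
  inner (c *m E^T *m E) w = inner c w.
Proof.
have innerM x y : inner x y = (x *m y^T) 0 0 by rewrite mulmx_trE !row_id.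
move=> EE wE; rewrite !innerM -[in RHS](sub_orthonormal_proj EE wE).
by rewrite !trmx_mul trmxK !mulmxA.
Qed.

End FourFrames.

Section ComplexLine.
Context {R : realType}.
Variables p q : 'rV[R]_8.
Local Notation J := (cross p q).
Implicit Types (a d v w : 'rV[R]_8) (x y s t : R).

Definition complex_line v : 'M[R]_(1 + 1, 8) := col_mx v (J v).

Lemma sub_complex_lineP v w :
  reflect (exists x y, w = x *: v + y *: J v) (w <= complex_line v)%MS.
Proof.
rewrite -addsmxE; apply: (iffP sub_addsmxP) => [[[A B] ->] /=|[x [y ->]]].
  exists (A 0 0), (B 0 0).
  by rewrite (mx11_scalar A) (mx11_scalar B) !mul_scalar_mx !mxE.
by exists (x%:M, y%:M); rewrite /= !mul_scalar_mx.
Qed.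

Lemma complex_line_id v : (v <= complex_line v)%MS.
Proof. by have := submx_refl (complex_line v); rewrite col_mx_sub => /andP[]. Qed.

(* [inner a a] times the component of [d] orthogonal to [complex_line a] *)
Definition line_residual a d : 'rV[R]_8 :=
  inner a a *: d - inner d a *: a - inner d (J a) *: J a.

Lemma line_residualZ a t d : line_residual a (t *: d) = t *: line_residual a d.
Proof. by rewrite /line_residual !innerZl; apply/rowP => k; rewrite !mxE; ring. Qed.

Lemma line_residual_solve a d : a != 0 -> line_residual a d = 0 ->
  d = ((inner a a)^-1 * inner d a) *: a + ((inner a a)^-1 * inner d (J a)) *: J a.
Proof.
move=> a0 /eqP; rewrite /line_residual -addrA -opprD subr_eq0 => /eqP dE.
have aa0 : inner a a != 0 by rewrite gt_eqF // inner_gt0.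
by rewrite -!scalerA -scalerDr -dE scalerA mulVf // scale1r.
Qed.

Lemma line_residual_eq0_sub a d : a != 0 -> line_residual a d = 0 -> (d <= complex_line a)%MS.
Proof.
by move=> a0 /(line_residual_solve a0) dE; apply/sub_complex_lineP; do 2 eexists; exact: dE.
Qed.

(* [line_residual] is quadratic in its first argument; these are the weights of
   the value at [t = 0] of a quadratic polynomial in terms of [t = 1, -1, 2]. *)
Lemma line_residual_interpolation v a d : 3 *: line_residual v d =
  3 *: line_residual (v + a) d + line_residual (v - a) d - line_residual (v + 2 *: a) d.
Proof.
rewrite /line_residual !crossD3 crossN3 crossZ3 !innerE (innerC a v).
move: (J v) (J a) (inner v v) (inner v a) (inner a a) => Jv Ja vv va aa.
move: (inner d v) (inner d a) (inner d Jv) (inner d Ja) => dv da dJv dJa.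
by apply/rowP => k; rewrite !mxE; ring.
Qed.

Hypothesis pqU : unitary_pair p q.

Lemma complex_line_cross v w : herm_perp p q v ->
  (w <= complex_line v)%MS -> (J w <= complex_line v)%MS.
Proof.
move=> vH /sub_complex_lineP[x [y ->]]; apply/sub_complex_lineP; exists (- y), x.
by rewrite crossD3 !crossZ3 (cross_cross pqU vH) scalerN scaleNr addrC.
Qed.

Lemma complex_line_sub v w : herm_perp p q v ->
  (w <= complex_line v)%MS -> (complex_line w <= complex_line v)%MS.
Proof. by move=> vH wv; rewrite col_mx_sub wv complex_line_cross. Qed.

Lemma complex_line_sym v w : herm_perp p q v -> w != 0 ->
  (w <= complex_line v)%MS -> (v <= complex_line w)%MS.
Proof.
move=> vH w0 /sub_complex_lineP[x [y wE]].
have norm0 : x ^+ 2 + y ^+ 2 != 0.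
  apply: contra w0; rewrite paddr_eq0 ?sqr_ge0 // !sqrf_eq0 wE => /andP[/eqP-> /eqP->].
  by rewrite !scale0r addr0.
apply/sub_complex_lineP; exists (x / (x ^+ 2 + y ^+ 2)), (- y / (x ^+ 2 + y ^+ 2)).
rewrite wE crossD3 !crossZ3 (cross_cross pqU vH); move: (J v) => Jv.
by apply/rowP => k; rewrite !mxE; field.
Qed.

Lemma sub_line_residual_eq0 a d : herm_perp p q a ->
  (d <= complex_line a)%MS -> line_residual a d = 0.
Proof.
move=> aH /sub_complex_lineP[x [y ->]]; rewrite /line_residual !innerE.
rewrite (innerC (J a) a) inner_cross_self cross_norm_herm_perp //; move: (J a) => Ja.
by apply/rowP => k; rewrite !mxE; ring.
Qed.

Lemma line_residual_cross a d : herm_perp p q a ->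
  line_residual a (d + J a) = line_residual a d.
Proof.
move=> aH; rewrite /line_residual !(innerDl d) (cross_norm_herm_perp pqU aH).
rewrite (innerC (J a) a) inner_cross_self addr0; move: (J a) => Ja.
by apply/rowP => k; rewrite !mxE; ring.
Qed.

Lemma complex_line_pencil v a d : herm_perp p q v -> herm_perp p q a -> v != 0 -> d != 0 ->
  (forall t, line_residual (v + t *: a) (t *: d) = 0) ->
  (d <= complex_line v)%MS /\ (a <= complex_line v)%MS.
Proof.
move=> vH aH v0 d0 residual_eq0.
have residual0 t : t != 0 -> line_residual (v + t *: a) d = 0.
  by move=> t0; apply: (scalerI t0); rewrite scaler0 -line_residualZ.
have dv : (d <= complex_line v)%MS.
  apply: line_residual_eq0_sub => //; apply: (@scalerI _ _ 3); first by rewrite pnatr_eq0.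
  rewrite (line_residual_interpolation v a) -{1}[a]scale1r -[- a]scaleN1r.
  by rewrite !residual0 ?oppr_eq0 ?pnatr_eq0 ?oner_eq0 // !scaler0 subr0 addr0.
split=> //; have vaH : herm_perp p q (v + a) by exact: herm_perpD.
have [va0|va_neq0] := eqVneq (v + a) 0.
  by rewrite -(addKr v a) va0 addr0 -scaleN1r scalemx_sub // complex_line_id.
have dva : (d <= complex_line (v + a))%MS.
  by apply: line_residual_eq0_sub => //; have := residual0 1; rewrite scale1r oner_eq0; apply.
have vav : ((v + a)%R <= complex_line v)%MS.
  exact: submx_trans (complex_line_sym vaH d0 dva) (complex_line_sub vH dv).
by rewrite -(addKr v a) addmx_sub // -scaleN1r scalemx_sub // complex_line_id.
Qed.

Lemma complex_line_pencil2 v a1 a2 d1 d2 : herm_perp p q v -> herm_perp p q a1 ->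
  herm_perp p q a2 -> v != 0 -> d1 != 0 \/ d2 != 0 ->
  (forall s t, line_residual (v + (s *: a1 + t *: a2)) (s *: d1 + t *: d2) = 0) ->
  [/\ (a1 <= complex_line v)%MS, (a2 <= complex_line v)%MS,
      (d1 <= complex_line v)%MS & (d2 <= complex_line v)%MS].
Proof.
move=> vH; wlog d10 : a1 a2 d1 d2 / d1 != 0
  => [d1_case a1H a2H v0 [d10|d20] residual_eq0|a1H a2H v0 _ residual_eq0].
- by apply: d1_case => //; left.
- have residual_swap s t : line_residual (v + (s *: a2 + t *: a1)) (s *: d2 + t *: d1) = 0.
    by rewrite (addrC (s *: a2)) (addrC (s *: d2)).
  by have [] := d1_case a2 a1 d2 d1 d20 a2H a1H v0 (or_introl d20) residual_swap.
have [d1v a1v] : (d1 <= complex_line v)%MS /\ (a1 <= complex_line v)%MS.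
  by apply: complex_line_pencil => // t; have := residual_eq0 t 0; rewrite !scale0r !addr0.
have [d2z|d20] := eqVneq d2 0; last first.
  have [d2v a2v] : (d2 <= complex_line v)%MS /\ (a2 <= complex_line v)%MS.
    by apply: complex_line_pencil => // t; have := residual_eq0 0 t; rewrite !scale0r !add0r.
  by split.
have [_ a12v] : (d1 <= complex_line v)%MS /\ ((a1 + a2)%R <= complex_line v)%MS.
  apply: complex_line_pencil => //; first exact: herm_perpD.
  by move=> t; have := residual_eq0 t t; rewrite d2z scaler0 addr0 scalerDr.
split=> //; last by rewrite d2z sub0mx.
by rewrite -(addKr a1 a2) addmx_sub // -scaleN1r scalemx_sub.
Qed.

Lemma complex_line_cross_pencil2 v a1 a2 b1 b2 : herm_perp p q v -> herm_perp p q a1 ->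
  herm_perp p q a2 -> v != 0 -> b1 <> J a1 \/ b2 <> J a2 ->
  (forall s t, line_residual (v + (s *: a1 + t *: a2)) (J v + (s *: b1 + t *: b2)) = 0) ->
  [/\ (a1 <= complex_line v)%MS, (a2 <= complex_line v)%MS,
      (b1 <= complex_line v)%MS & (b2 <= complex_line v)%MS].
Proof.
move=> vH a1H a2H v0 b_neq residual_eq0.
have d_neq0 : b1 - J a1 != 0 \/ b2 - J a2 != 0.
  by case: b_neq => /eqP n; [left|right]; rewrite subr_eq0.
have [s t|a1v a2v d1v d2v] := complex_line_pencil2 vH a1H a2H v0 d_neq0.
  have sumH : herm_perp p q (v + (s *: a1 + t *: a2)).
    by apply: herm_perpD => //; apply: herm_perpD; exact: herm_perpZ.
  rewrite -(line_residual_cross _ sumH) -(residual_eq0 s t); congr line_residual.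
  rewrite !crossD3 !crossZ3; move: (J v) (J a1) (J a2) => jv j1 j2.
  by apply/rowP => k; rewrite !mxE; ring.
split=> //; first by rewrite -(subrK (J a1) b1) addmx_sub // complex_line_cross.
by rewrite -(subrK (J a2) b2) addmx_sub // complex_line_cross.
Qed.

(* A nonconstant solution of the Beltrami equation with coefficients [x], [y]
   turns the derivatives [A], [B] into a solution of the Cauchy-Riemann equation. *)
Lemma beltrami_cauchy_riemann A B x y s t : y != 0 -> s != 0 -> s *: A + t *: B != 0 ->
  herm_perp p q A -> herm_perp p q B ->
  (x * s - y * t) *: A + (y * s + x * t) *: B
    = x *: (s *: A + t *: B) + y *: J (s *: A + t *: B) -> A != 0 /\ B = J A.
Proof.
move=> y0 s0 AB0 AH BH e; suff BE : B = J A.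
  by split=> //; apply: contra AB0 => /eqP A0; rewrite BE A0 cross03 !scaler0 addr0 eqxx.
move: e; rewrite crossD3 !crossZ3 => e; pose Z := B - J A; have JJA := cross_cross pqU AH.
have sZ : s *: Z = t *: J Z.
  rewrite /Z crossD3 crossN3 JJA; apply: (scalerI y0).
  apply/eqP; rewrite -subr_eq0; apply/eqP.
  move/eqP: e; rewrite -subr_eq0 => /eqP <-; move: (J A) (J B) => JA JB.
  by apply/rowP => k; rewrite !mxE; ring.
suff /eqP : Z = 0 by rewrite subr_eq0 => /eqP.
apply: inner_eq0; apply: (mulfI s0); rewrite mulr0 -innerZr sZ innerZr.
by rewrite inner_cross_self mulr0.
Qed.

End ComplexLine.

Section SLSpan.
Context {R : realType}.
Implicit Types (p q v x y : 'rV[R]_8) (a b c d : R).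

Definition sl_span p q v : 'M[R]_(4, 8) := rows4 p q v (cross p q v).

Lemma mem_sl_span p q v : [&& (p <= sl_span p q v)%MS, (q <= sl_span p q v)%MS,
  (v <= sl_span p q v)%MS & (cross p q v <= sl_span p q v)%MS].
Proof. exact: mem_rows4. Qed.

Lemma sl_span_swap12 p q v : (sl_span q p v :=: sl_span p q v)%MS.
Proof.
have sub p' q' : (sl_span q' p' v <= sl_span p' q' v)%MS.
  rewrite rows4_sub cross_swap12 -scaleN1r.
  by have /and4P[-> -> -> Jv] := mem_sl_span p' q' v; rewrite scalemx_sub.
by apply/eqmxP; rewrite !sub.
Qed.

Lemma sl_spanZ p q v a : a != 0 -> (sl_span p q (a *: v) :=: sl_span p q v)%MS.
Proof.
move=> a0; apply/eqmxP; rewrite /sl_span crossZ3 !rows4_sub.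
have /and4P[-> -> vS JvS] := mem_rows4 p q v (cross p q v).
have /and4P[-> -> avS aJvS] := mem_rows4 p q (a *: v) (a *: cross p q v).
rewrite !scalemx_sub //= -{1}(scalerK a0 v) -{2}(scalerK a0 (cross p q v)).
by rewrite scalemx_sub // scalemx_sub.
Qed.

Lemma complex_line_sl_span p q v : (complex_line p q v <= sl_span p q v)%MS.
Proof. by rewrite col_mx_sub; have /and4P[_ _ -> ->] := mem_sl_span p q v. Qed.

Lemma perp_part_line_sl_span p q v x :
  (perp_part p q x <= complex_line p q v)%MS -> (x <= sl_span p q v)%MS.
Proof.
have /and4P[pS qS _ _] := mem_sl_span p q v.
by move=> xL; rewrite -(perp_part_subE _ pS qS); exact: submx_trans xL (complex_line_sl_span p q v).
Qed.

Lemma rows4_sl_span p q u w a b : w = cross p q u + a *: p + b *: q ->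
  (rows4 p q u w :=: sl_span p q (perp_part p q u))%MS.
Proof.
move=> wE; rewrite /sl_span cross_perp_part; apply/eqmxP; rewrite !rows4_sub.
have /and4P[pT qT uT wT] := mem_rows4 p q u w.
have /and4P[pS qS vS JuS] := mem_rows4 p q (perp_part p q u) (cross p q u).
rewrite pT qT pS qS (perp_part_sub pT qT uT) -(perp_part_subE _ pS qS) vS /=.
have -> /= : (w <= rows4 p q (perp_part p q u) (cross p q u))%MS.
  by rewrite wE !addmx_sub ?scalemx_sub.
suff -> : cross p q u = w - a *: p - b *: q by rewrite -!scaleNr !addmx_sub ?scalemx_sub.
by rewrite wE addrAC !addrK.
Qed.

Variables p q v : 'rV[R]_8.
Hypotheses (pqU : unitary_pair p q) (vH : herm_perp p q v).
Local Notation J := (cross p q).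
Local Notation W := (sl_span p q v).
Local Notation nv := (inner v v).

Lemma sl_span_orthonormal : nv = 1 -> W *m W^T = 1%:M.
Proof.
have [[pp qq pq] wpq] := pqU; have [pv qv _ _] := vH; have [pJ qJ _ _] := herm_perp_cross p q v.
have JJ := cross_norm_herm_perp pqU vH; have vJ := inner_cross_self p q v; move=> vv.
rewrite gram_rows4; apply/matrixP; apply: ord4_ind; apply: ord4_ind;
  rewrite !mxE /= ?(innerC q p) ?(innerC v p) ?(innerC v q)
    ?(innerC (J v) p) ?(innerC (J v) q) ?(innerC (J v) v);
  by rewrite ?pp ?qq ?pq ?pv ?qv ?pJ ?qJ ?JJ ?vJ ?vv.
Qed.

Lemma sl_span_ReOmega : ReOmega p q v (J v) = nv.
Proof. by rewrite -crossP cross_norm_herm_perp. Qed.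

Lemma sl_span_cross x : (x <= W)%MS -> (J x <= W)%MS.
Proof.
move=> /sub_rows4P[a [b [c [d ->]]]].
rewrite !crossD3 !crossZ3 cross_xyx cross_xyy (cross_cross pqU vH) !scaler0 !add0r.
have /and4P[_ _ vW JvW] := mem_sl_span p q v.
by rewrite -scaleN1r !addmx_sub // !scalemx_sub.
Qed.

Lemma sl_span_cross_l x : (x <= W)%MS -> (cross x q v <= W)%MS.
Proof.
move=> /sub_rows4P[a [b [c [d ->]]]].
have -> : a *: p + b *: q + c *: v + d *: J v = a *: p + (b *: q + (c *: v + (d *: J v + 0))).
  by rewrite addr0 !addrA.
rewrite !cross_linear1 cross01 cross_xxz cross_xyx (cross_cross_l pqU vH) !scaler0 !add0r addr0.
have /and4P[pW _ _ JvW] := mem_sl_span p q v.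
by rewrite !addmx_sub // !scalemx_sub.
Qed.

Lemma omega_sl_span x y : (x <= W)%MS -> (y <= W)%MS -> omega x y = 0.
Proof.
have [_ wpq] := pqU; have [_ _ wpv wqv] := vH; have [_ _ wpJ wqJ] := herm_perp_cross p q v.
have wvJ := omega_cross_self p q v.
move=> /sub_rows4P[a [b [c [d ->]]]] /sub_rows4P[a' [b' [c' [d' ->]]]].
rewrite !(omegaDl, omegaZl) !(omegaDr, omegaZr) !omega_self.
rewrite (omega_antisym p q) (omega_antisym p v) (omega_antisym p (J v)).
rewrite (omega_antisym q v) (omega_antisym q (J v)) (omega_antisym v (J v)).
by rewrite wpq wpv wqv wpJ wqJ wvJ; ring.
Qed.

Lemma sl_span_cross_cross x : omega p x = 0 -> omega q x = 0 -> ((J (J x) + x)%R <= W)%MS.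
Proof.
move=> wp wq; have xH := herm_perp_perp_part pqU wp wq.
rewrite -(cross_perp_part p q x) (cross_cross pqU xH) {2}(perp_part_decomp p q x) -addrA addKr.
by have /and4P[pW qW _ _] := mem_sl_span p q v; rewrite addmx_sub // scalemx_sub.
Qed.

(* [a J - b] is invertible modulo [W], since [J] squares to [-1] there. *)
Lemma sl_span_complex_div x a b : omega p x = 0 -> omega q x = 0 -> (a != 0) || (b != 0) ->
  ((a *: J x - b *: x)%R <= W)%MS -> (x <= W)%MS.
Proof.
move=> wp wq ab0 xW; have JxW := sl_span_cross xW; have JJxW := sl_span_cross_cross wp wq.
have norm0 : a ^+ 2 + b ^+ 2 != 0 by rewrite paddr_eq0 ?sqr_ge0 // !sqrf_eq0 negb_and.
have -> : x = (a ^+ 2 + b ^+ 2)^-1 *: ((- b) *: (a *: J x - b *: x)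
    + (- a) *: (J (a *: J x - b *: x) - a *: (J (J x) + x))).
  rewrite crossD3 crossN3 !crossZ3; move: (J (J x)) (J x) => jj j.
  by apply/rowP => k; rewrite !mxE; field.
by rewrite scalemx_sub // addmx_sub ?scalemx_sub // addmx_sub // -scaleNr scalemx_sub.
Qed.

Lemma perp_part_sl_span x : (x <= W)%MS -> (perp_part p q x <= complex_line p q v)%MS.
Proof.
have [pqO _] := pqU; have [pv qv _ _] := vH.
move=> /sub_rows4P[a [b [c [d ->]]]]; rewrite !perp_partD !perp_partZ.
rewrite (perp_part_p pqO) (perp_part_q pqO) (perp_part_id pv qv) perp_part_cross.
by rewrite !scaler0 !add0r; apply/sub_complex_lineP; exists c, d.
Qed.

Hypothesis v0 : v != 0.

Lemma sl_span_free : row_free W.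
Proof.
have [[pp qq pq] _] := pqU; have [pv qv _ _] := vH; have [pJ qJ _ _] := herm_perp_cross p q v.
apply: rows4_free => //; [exact: inner_cross_self|exact: unit_neq0|exact: unit_neq0|].
exact: cross_neq0.
Qed.

Lemma sl_span_coefs x a b c d : x = a *: p + b *: q + c *: v + d *: J v ->
  [/\ inner p x = a, inner q x = b, nv^-1 * inner v x = c & nv^-1 * inner (J v) x = d].
Proof.
have [[pp qq pq] _] := pqU; have [pv qv _ _] := vH; have [pJ qJ _ _] := herm_perp_cross p q v.
have vv0 : nv != 0 by rewrite gt_eqF // inner_gt0.
have JJ := cross_norm_herm_perp pqU vH; have vJ := inner_cross_self p q v.
move=> ->; split; rewrite !innerE ?(innerC v p) ?(innerC v q) ?(innerC (J v) p) ?(innerC (J v) q)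
  ?(innerC (J v) v) ?(innerC q p) ?pp ?qq ?pq ?pv ?qv ?pJ ?qJ ?JJ ?vJ;
  by [ring|field].
Qed.

Definition sl_proj x := inner p x *: p + inner q x *: q
  + (nv^-1 * inner v x) *: v + (nv^-1 * inner (J v) x) *: J v.

Lemma sl_proj_sub x : (sl_proj x <= W)%MS.
Proof.
by have /and4P[pW qW vW JvW] := mem_sl_span p q v; rewrite !addmx_sub ?scalemx_sub.
Qed.

Lemma sl_proj_id x : (x <= W)%MS -> sl_proj x = x.
Proof.
by move=> /sub_rows4P[a [b [c [d xE]]]]; rewrite /sl_proj; have [-> -> -> ->] := sl_span_coefs xE.
Qed.

Lemma sl_proj_self_adjoint x y : inner (sl_proj x) y = inner x (sl_proj y).
Proof. by rewrite /sl_proj !innerE !(innerC x); ring. Qed.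

End SLSpan.

Section CalibratedPlane.
Context {R : realType}.
Variables (E : 'M[R]_(4, 8)) (p q : 'rV[R]_8).
Hypotheses (EE : E *m E^T = 1%:M)
  (E_calibrated : forall v : 'M[R]_(4, 8), (v <= E)%MS ->
     complex.Re (Omega (fun i => row i v)) = \det (v *m E^T))
  (pq : orthonormal_pair p q).
Implicit Types (a b x y z w : 'rV[R]_8).

Let E_free : row_free E. Proof. by apply/row_freeP; exists E^T. Qed.

Lemma calibrated_ReOmega_sqr x y z w : (rows4 x y z w <= E)%MS ->
  ReOmega x y z w ^+ 2 = \det (rows4 x y z w *m (rows4 x y z w)^T).
Proof.
move=> TE; rewrite /ReOmega -Omega_rows4 E_calibrated // expr2 -{2}det_tr -det_mulmx.
by rewrite trmx_mul trmxK mulmxA (sub_orthonormal_proj EE TE).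
Qed.

Lemma calibrated_ReOmega_neq0 x y z w : (rows4 x y z w :=: E)%MS -> ReOmega x y z w != 0.
Proof.
move=> TE; have TsubE : (rows4 x y z w <= E)%MS by rewrite TE.
rewrite -sqrf_eq0 calibrated_ReOmega_sqr // -unitfE -unitmxE.
have [B TB] := submxP TsubE; have Bu : B \in unitmx.
  rewrite -row_free_unit -row_leq_rank -{1}(eqP E_free) -TE TB; exact: mxrankM_maxl.
by rewrite TB trmx_mul mulmxA -(mulmxA B) EE mulmx1 unitmx_mul unitmx_tr Bu.
Qed.

Section Frame.
Variables a b : 'rV[R]_8.
Hypothesis TE : (rows4 p q a b :=: E)%MS.
Local Notation a' := (perp_part p q a).
Local Notation Ja' := (cross p q a').
Local Notation projJa' := (Ja' *m E^T *m E).

Let TsubE : [&& (p <= E)%MS, (q <= E)%MS, (a <= E)%MS & (b <= E)%MS].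
Proof. by rewrite -rows4_sub TE. Qed.

Let a'E : (a' <= E)%MS.
Proof. by have /and4P[pE qE aE _] := TsubE; exact: perp_part_sub. Qed.

Let inner_projJ w : (w <= E)%MS -> inner projJa' w = ReOmega p q a' w.
Proof. by move=> wE; rewrite inner_proj // crossP. Qed.

(* The calibration makes [|J a'|] and [|a'|] agree after projection to E, while
   [|J a'| <= |a'|] always: all the defects in [cross_norm] must vanish. *)
Lemma inner_proj_cross : inner projJa' projJa' = inner a' a'.
Proof.
have /and4P[pE qE _ bE] := TsubE; have [pp qq pq0] := pq.
have projE : (projJa' <= E)%MS by rewrite submxMl.
have neq0 : inner projJa' projJa' != 0.
  rewrite gt_eqF // inner_gt0 //.
  apply: contra (calibrated_ReOmega_neq0 TE) => /eqP proj0.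
  by rewrite -crossP -cross_perp_part crossP -inner_projJ // proj0 inner0l.
apply: (mulIf neq0); rewrite -expr2 {1}inner_projJ // calibrated_ReOmega_sqr; last first.
  by rewrite rows4_sub pE qE a'E projE.
rewrite det_gram_rows4 ?pp ?qq ?mul1r // ?inner_p_perp_part ?inner_q_perp_part //.
- by rewrite innerC inner_projJ // /ReOmega (@Omega_alternate _ _ o0 o3).
- by rewrite innerC inner_projJ // /ReOmega (@Omega_alternate _ _ o1 o3).
- by rewrite innerC inner_projJ // /ReOmega (@Omega_alternate _ _ o2 o3).
Qed.

Lemma calibrated_half_frame :
  [/\ omega p q = 0, omega p a = 0, omega q a = 0, a' != 0 & (cross p q a <= E)%MS].
Proof.
have [pp qq pq0] := pq; have normE := inner_proj_cross.
have pa' := inner_p_perp_part pq a; have qa' := inner_q_perp_part pq a.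
have a'0 : a' != 0.
  apply: contra (calibrated_ReOmega_neq0 TE) => /eqP a'z.
  by rewrite -crossP -cross_perp_part a'z cross03 inner0l.
have pythagoras : inner Ja' Ja' = inner a' a' + inner (Ja' - projJa') (Ja' - projJa').
  have := inner_proj Ja' EE (submxMl (Ja' *m E^T) E); rewrite -normE.
  move: Ja' projJa' => j k kj; rewrite !innerDl !innerDr !innerNl !innerNr (innerC k j) kj; ring.
have := cross_norm pq0 pa' qa'; rewrite pythagoras pp qq !mul1r => defect.
have a'_gt0 := inner_gt0 a'0; have proj_ge0 := inner_ge0 (Ja' - projJa').
have wqa'_ge0 := sqr_ge0 (omega q a'); have wpa'_ge0 := sqr_ge0 (omega p a').
have wpq_ge0 : 0 <= inner a' a' * omega p q ^+ 2 by rewrite mulr_ge0 ?sqr_ge0 ?inner_ge0.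
have wpa' : omega p a' = 0 by apply/eqP; rewrite -sqrf_eq0; apply/eqP; lra.
have wqa' : omega q a' = 0 by apply/eqP; rewrite -sqrf_eq0; apply/eqP; lra.
have wpq : omega p q = 0.
  have /eqP : inner a' a' * omega p q ^+ 2 = 0 by lra.
  by rewrite mulf_eq0 gt_eqF //= sqrf_eq0 => /eqP.
have JE : Ja' = projJa'.
  by apply/eqP; rewrite -subr_eq0; apply/eqP; apply: inner_eq0; lra.
split=> //; last by rewrite -cross_perp_part JE submxMl.
- rewrite (perp_part_decomp p q a) (omegaDr p (_ + _)) (omegaDr p) !omegaZr.
  by rewrite wpa' omega_self wpq !mulr0 !addr0.
- rewrite (perp_part_decomp p q a) (omegaDr q (_ + _)) (omegaDr q) !omegaZr.
  by rewrite wqa' omega_self (omega_antisym p q) wpq oppr0 !mulr0 !addr0.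
Qed.

End Frame.

Theorem calibrated_frame a b : (rows4 p q a b :=: E)%MS ->
  [/\ omega p q = 0, omega p a = 0 /\ omega q a = 0, omega p b = 0 /\ omega q b = 0 &
      line_residual p q (perp_part p q a) (perp_part p q b) = 0].
Proof.
move=> TE; have [wpq wpa wqa a0 JaE] := calibrated_half_frame TE.
have [_ wpb wqb _ _] := calibrated_half_frame (eqmx_trans (rows4_swap34 p q a b) TE).
have pqU : unitary_pair p q by split.
have : (rows4 p q a b <= E)%MS by rewrite TE.
rewrite rows4_sub => /and4P[pE qE aE bE].
have aH : herm_perp p q (perp_part p q a) by exact: herm_perp_perp_part.
have SE : (sl_span p q (perp_part p q a) <= E)%MS.
  by rewrite rows4_sub pE qE perp_part_sub //= cross_perp_part.
have ES : (E <= sl_span p q (perp_part p q a))%MS.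
  by rewrite -(mxrank_leqif_sup SE) (eqP (sl_span_free pqU aH a0)) (eqP E_free).
split=> //; apply: sub_line_residual_eq0 => //; apply: perp_part_sl_span => //.
exact: submx_trans bE ES.
Qed.

End CalibratedPlane.

Lemma sl_span_calibrated_basis (R : realType) (p q v : 'rV[R]_8) :
  unitary_pair p q -> herm_perp p q v -> v != 0 ->
  exists E : 'M[R]_(4, 8), [/\ E *m E^T = 1%:M, (E :=: sl_span p q v)%MS &
    complex.Re (Omega (fun i => row i E)) = 1].
Proof.
move=> pqU vH v0; have vv_gt0 := inner_gt0 v0.
pose k := (Num.sqrt (inner v v))^-1; have k0 : k != 0 by rewrite invr_eq0 sqrtr_eq0 -ltNge.
have kvH : herm_perp p q (k *: v) by exact: herm_perpZ.
have kv1 : inner (k *: v) (k *: v) = 1.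
  by rewrite innerZl innerZr mulrA /k -invfM -expr2 sqr_sqrtr ?ltW // mulVf // gt_eqF.
exists (sl_span p q (k *: v)); split; first exact: sl_span_orthonormal.
  exact: sl_spanZ.
by rewrite Omega_rows4 -/(ReOmega _ _ _ _) sl_span_ReOmega.
Qed.

(** * Calculus of the inner, symplectic and triple cross products *)

Section FormCalculus.
Context {R : realType}.
Implicit Types (F G H P Q : 'rV[R]_2 -> 'rV[R]_8) (y : 'rV[R]_2) (i : 'I_2).

Lemma analytic_inner F G y : vanalytic_at F y -> vanalytic_at G y ->
  analytic_at (fun z => inner (F z) (G z)) y.
Proof. by apply: analytic_bilinear => *; rewrite !innerE. Qed.

Lemma analytic_normalized_inner F G H y : F y != 0 -> vanalytic_at F y -> vanalytic_at G y ->
  vanalytic_at H y -> analytic_at (fun z => (inner (F z) (F z))^-1 * inner (G z) (H z)) y.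
Proof.
move=> F0 Fy Gy Hy; apply: analyticM (analytic_inner Gy Hy).
by apply: analyticV (analytic_inner Fy Fy); rewrite gt_eqF // inner_gt0.
Qed.

Lemma partial_inner i F G y : vanalytic_at F y -> vanalytic_at G y ->
  partial i (fun z => inner (F z) (G z)) y
    = inner (partial i F y) (G y) + inner (F y) (partial i G y).
Proof. by move=> Fy Gy; apply: partial_bilinear => // *; rewrite !innerE. Qed.

Lemma analytic_omega F G y : vanalytic_at F y -> vanalytic_at G y ->
  analytic_at (fun z => omega (F z) (G z)) y.
Proof.
by apply: analytic_bilinear => *; [rewrite omegaDl omegaZl|rewrite omegaDr omegaZr].
Qed.

Lemma partial_omega i F G y : vanalytic_at F y -> vanalytic_at G y ->
  partial i (fun z => omega (F z) (G z)) y
    = omega (partial i F y) (G y) + omega (F y) (partial i G y).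
Proof.
move=> Fy Gy; apply: partial_bilinear => // *.
  by rewrite omegaDl omegaZl.
by rewrite omegaDr omegaZr.
Qed.

Lemma cross_coord (x v w : 'rV[R]_8) l :
  cross x v w 0 l = \sum_k x 0 k * ReOmega (delta_mx 0 k) v w (delta_mx 0 l).
Proof.
have ReOmega0 (u u' u'' : 'rV[R]_8) : ReOmega 0 u u' u'' = 0.
  by have := ReOmega_linear1 (-1) 0 0 u u' u''; rewrite scaler0 addr0 mulN1r addNr.
rewrite mxE {1}(row_sum_delta x).
by elim/big_rec2: _ => [|k r s _ <-]; rewrite ?ReOmega0 ?ReOmega_linear1.
Qed.

Section Cross.
Variables (F G H : 'rV[R]_2 -> 'rV[R]_8) (y : 'rV[R]_2).
Hypotheses (Fy : vanalytic_at F y) (Gy : vanalytic_at G y) (Hy : vanalytic_at H y).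

Let minor_analytic k l :
  analytic_at (fun z => ReOmega (delta_mx 0 k) (G z) (H z) (delta_mx 0 l)) y.
Proof.
apply: (@analytic_bilinear _ _ _ (fun u v => ReOmega (delta_mx 0 k) u v (delta_mx 0 l))) => // *.
  by rewrite ReOmega_linear2.
by rewrite ReOmega_linear3.
Qed.

Let partial_minor i k l :
  partial i (fun z => ReOmega (delta_mx 0 k) (G z) (H z) (delta_mx 0 l)) y
  = ReOmega (delta_mx 0 k) (partial i G y) (H y) (delta_mx 0 l)
    + ReOmega (delta_mx 0 k) (G y) (partial i H y) (delta_mx 0 l).
Proof.
apply: (@partial_bilinear _ _ _ (fun u v => ReOmega (delta_mx 0 k) u v (delta_mx 0 l))) => // *.
  by rewrite ReOmega_linear2.
by rewrite ReOmega_linear3.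
Qed.

Lemma vanalytic_cross : vanalytic_at (fun z => cross (F z) (G z) (H z)) y.
Proof.
by move=> l; under eq_fun do rewrite cross_coord; apply: analytic_sum => k; exact: analyticM.
Qed.

Lemma partial_cross i : partial i (fun z => cross (F z) (G z) (H z)) y
  = cross (partial i F y) (G y) (H y) + cross (F y) (partial i G y) (H y)
    + cross (F y) (G y) (partial i H y).
Proof.
apply/rowP => l; rewrite partial_coord; last exact: vanalytic_differentiable vanalytic_cross.
under eq_fun do rewrite cross_coord.
rewrite partial_sum => [|k]; last by apply: analytic_differentiable; exact: analyticM.
rewrite 2![in RHS]mxE !cross_coord -!big_split; apply: eq_bigr => k _ /=.
rewrite partialM ?partial_minor -?partial_coord ?mulrDr ?addrA //.
- exact: vanalytic_differentiable.
- exact: analytic_differentiable (Fy k).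
- exact: analytic_differentiable.
Qed.

End Cross.

Lemma vanalytic_perp_part P Q F y :
  vanalytic_at P y -> vanalytic_at Q y -> vanalytic_at F y ->
  vanalytic_at (fun z => perp_part (P z) (Q z) (F z)) y.
Proof.
move=> Py Qy Fy; rewrite /perp_part.
by apply: vanalyticB; [apply: vanalyticB => //|]; apply: vanalyticZ => //; exact: analytic_inner.
Qed.

Lemma vanalytic_line_residual P Q F G y : vanalytic_at P y -> vanalytic_at Q y ->
  vanalytic_at F y -> vanalytic_at G y ->
  vanalytic_at (fun z => line_residual (P z) (Q z) (F z) (G z)) y.
Proof.
move=> Py Qy Fy Gy; have JFy := vanalytic_cross Py Qy Fy; rewrite /line_residual.
by apply: vanalyticB; [apply: vanalyticB|]; apply: vanalyticZ => //; exact: analytic_inner.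
Qed.

Lemma vanalytic_sl_proj P Q F y (n : 'rV[R]_8) : vanalytic_at P y -> vanalytic_at Q y ->
  vanalytic_at F y -> F y != 0 -> vanalytic_at (fun z => sl_proj (P z) (Q z) (F z) n) y.
Proof.
move=> Py Qy Fy F0; have JFy := vanalytic_cross Py Qy Fy; have ny := vanalytic_cst n y.
have Pn := vanalyticZ (analytic_inner Py ny) Py; have Qn := vanalyticZ (analytic_inner Qy ny) Qy.
have Fn := vanalyticZ (analytic_normalized_inner F0 Fy Fy ny) Fy.
have JFn := vanalyticZ (analytic_normalized_inner F0 Fy JFy ny) JFy.
exact: vanalyticD (vanalyticD (vanalyticD Pn Qn) Fn) JFn.
Qed.

End FormCalculus.

(** * Rigidity of degenerate rulings *)

Section Rigidity.
Context {R : realType}.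
Variables (P Q X V : 'rV[R]_2 -> 'rV[R]_8) (U : set 'rV[R]_2).
Local Notation J y := (cross (P y) (Q y)).
Local Notation W y := (sl_span (P y) (Q y) (V y)).
Hypotheses (U_open : open U)
  (P_analytic : forall y, U y -> vanalytic_at P y)
  (Q_analytic : forall y, U y -> vanalytic_at Q y)
  (X_analytic : forall y, U y -> vanalytic_at X y)
  (V_analytic : forall y, U y -> vanalytic_at V y).
Hypotheses (PQ_unitary : forall y, U y -> unitary_pair (P y) (Q y))
  (V_herm_perp : forall y, U y -> herm_perp (P y) (Q y) (V y))
  (V_neq0 : forall y, U y -> V y != 0)
  (X_s : forall y, U y -> perp_part (P y) (Q y) (partial 0 X y) = V y)
  (X_t : forall y, U y -> perp_part (P y) (Q y) (partial 1 X y) = J y (V y)).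
Hypotheses (partial_P_sub : forall i y, U y -> (partial i P y <= W y)%MS)
  (partial_Q_sub : forall i y, U y -> (partial i Q y <= W y)%MS).
Hypothesis nondegenerate : forall y, U y ->
  perp_part (P y) (Q y) (partial 1 P y) <> J y (partial 0 P y) \/
  perp_part (P y) (Q y) (partial 1 Q y) <> J y (partial 0 Q y).
Implicit Types (i : 'I_2) (y z : 'rV[R]_2) (F : 'rV[R]_2 -> 'rV[R]_8).

Let U_nbhs y : U y -> nbhs y U. Proof. by move=> Uy; apply: open_nbhs_nbhs. Qed.

Let JV_analytic y : U y -> vanalytic_at (fun z => J z (V z)) y.
Proof. by move=> Uy; apply: vanalytic_cross; auto. Qed.

Let sub_sub y (x x' : 'rV[R]_8) : (x <= W y)%MS -> (x' <= W y)%MS -> ((x - x')%R <= W y)%MS.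
Proof. by move=> xW x'W; rewrite addmx_sub // eqmx_opp. Qed.

Lemma partial_JV_sub i y : U y ->
  ((partial i (fun z => J z (V z)) y - J y (partial i V y))%R <= W y)%MS.
Proof.
move=> Uy; rewrite partial_cross; [|by auto..].
rewrite addrK addmx_sub //; first by apply: sl_span_cross_l; auto.
rewrite cross_swap12 eqmx_opp -(sl_span_swap12 (P y) (Q y)).
apply: sl_span_cross_l.
- exact: unitary_pair_swap (PQ_unitary Uy).
- exact: herm_perp_swap (V_herm_perp Uy).
- by rewrite (sl_span_swap12 (P y) (Q y)); auto.
Qed.

Lemma partial_sub_span i F y c d :
  (forall z, U z -> vanalytic_at F z) -> (forall z, U z -> (F z <= W z)%MS) -> U y ->
  perp_part (P y) (Q y) (F y) = c *: V y + d *: J y (V y) ->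
  ((partial i F y - (c *: partial i V y + d *: J y (partial i V y)))%R <= W y)%MS.
Proof.
move=> F_analytic F_sub Uy Fy_perp.
have Fy_span : F y = inner (P y) (F y) *: P y + inner (Q y) (F y) *: Q y
    + c *: V y + d *: J y (V y).
  by rewrite {1}(perp_part_decomp (P y) (Q y) (F y)) Fy_perp -addrA addrC addrA.
have [_ _ <- <-] := sl_span_coefs (PQ_unitary Uy) (V_herm_perp Uy) (V_neq0 Uy) Fy_span.
pose a z := inner (P z) (F z); pose b z := inner (Q z) (F z).
pose c' z := (inner (V z) (V z))^-1 * inner (V z) (F z).
pose d' z := (inner (V z) (V z))^-1 * inner (J z (V z)) (F z).
have Py := P_analytic Uy; have Qy := Q_analytic Uy; have Vy := V_analytic Uy.
have JVy := JV_analytic Uy; have Fy := F_analytic _ Uy.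
have ay : analytic_at a y := analytic_inner Py Fy.
have b_y : analytic_at b y := analytic_inner Qy Fy.
have cy : analytic_at c' y := analytic_normalized_inner (V_neq0 Uy) Vy Vy Fy.
have dy : analytic_at d' y := analytic_normalized_inner (V_neq0 Uy) Vy JVy Fy.
have F_near : \forall z \near y, F z = a z *: P z + b z *: Q z + c' z *: V z + d' z *: J z (V z).
  apply: filterS (U_nbhs Uy) => z Uz; symmetry.
  exact: (sl_proj_id (PQ_unitary Uz) (V_herm_perp Uz) (V_neq0 Uz) (F_sub z Uz)).
rewrite (partial_near_eq i F_near).
have dP := vanalyticZ ay Py; have dQ := vanalyticZ b_y Qy.
have dV := vanalyticZ cy Vy; have dJV := vanalyticZ dy JVy.
have dPQ := vanalyticD dP dQ; have dPQV := vanalyticD dPQ dV.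
rewrite !partialD; try exact: vanalytic_differentiable; rewrite !partialZ // -/(c' y) -/(d' y).
have /and4P[PW QW VW JVW] := mem_sl_span (P y) (Q y) (V y).
have regroup (p q v j p' q' v' j' k : 'rV[R]_8) (s t e f s' t' e' f' : R) :
    s' *: p + s *: p' + (t' *: q + t *: q') + (e' *: v + e *: v') + (f' *: j + f *: j')
    - (e *: v' + f *: k)
    = s' *: p + s *: p' + (t' *: q + t *: q') + (e' *: v + f' *: j) + f *: (j' - k).
  by apply/rowP => l; rewrite !mxE; ring.
rewrite regroup !addmx_sub ?scalemx_sub //; auto; exact: partial_JV_sub.
Qed.

Lemma partial_X_sub i y : U y -> (partial i X y <= W y)%MS.
Proof.
move=> Uy; apply: perp_part_line_sl_span; case: (I2_cases i) => ->.
  by rewrite X_s // complex_line_id.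
by rewrite X_t // complex_line_cross ?complex_line_id; auto.
Qed.

Lemma omega_partial_V i y : U y ->
  omega (P y) (partial i V y) = 0 /\ omega (Q y) (partial i V y) = 0.
Proof.
move=> Uy; have Vy := V_analytic Uy; have /and4P[_ _ VW _] := mem_sl_span (P y) (Q y) (V y).
have omega0 F : vanalytic_at F y -> (partial i F y <= W y)%MS ->
    (forall z, U z -> omega (F z) (V z) = 0) -> omega (F y) (partial i V y) = 0.
  move=> Fy dF_sub FV; have := partial_omega i Fy Vy.
  rewrite (omega_sl_span (PQ_unitary Uy) (V_herm_perp Uy) dF_sub VW) add0r => <-.
  rewrite (@partial_near_eq _ _ _ i _ (fun=> 0)) ?partial_cst //.
  by apply: filterS (U_nbhs Uy) => z /FV.
by split; apply: omega0; auto => z /V_herm_perp[].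
Qed.

(* Both sides come from differentiating [X_s] and [X_t] and commuting the partials of [X]. *)
Lemma partial_V_cauchy_riemann y : U y ->
  ((partial 1 V y - J y (partial 0 V y))%R <= W y)%MS.
Proof.
move=> Uy; have dX_analytic i z : U z -> vanalytic_at (partial i X) z.
  by move=> Uz; apply: vanalytic_partial; exact: X_analytic.
have dsX := @partial_sub_span 1 (partial 0 X) y 1 0 (dX_analytic 0) (@partial_X_sub 0) Uy.
have dtX := @partial_sub_span 0 (partial 1 X) y 0 1 (dX_analytic 1) (@partial_X_sub 1) Uy.
rewrite !scale1r !scale0r !addr0 in dsX; rewrite !scale1r !scale0r !add0r in dtX.
move: {dsX dtX} (dsX (X_s Uy)) (dtX (X_t Uy)) => dsX dtX.
rewrite vpartial_comm in dtX; last exact: X_analytic.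
by have := sub_sub dtX dsX; rewrite opprB addrC addrA subrK.
Qed.

(* Commuting the partials of [F] gives [a *: J V_s - b *: V_s] in [W], where [a] and [b]
   both vanish exactly when [F] satisfies the Cauchy-Riemann equation modulo [P], [Q]. *)
Lemma partial0_V_sub F y : (forall z, U z -> vanalytic_at F z) ->
  (forall i z, U z -> (partial i F z <= W z)%MS) -> U y ->
  perp_part (P y) (Q y) (partial 1 F y) <> J y (partial 0 F y) -> (partial 0 V y <= W y)%MS.
Proof.
move=> F_analytic dF_sub Uy notCR; have pqU := PQ_unitary Uy; have vH := V_herm_perp Uy.
have dF_analytic i z : U z -> vanalytic_at (partial i F) z.
  by move=> Uz; apply: vanalytic_partial; exact: F_analytic.
have [x [x' F0E]] := sub_complex_lineP _ _ _ _ (perp_part_sl_span pqU vH (dF_sub 0 y Uy)).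
have [z [z' F1E]] := sub_complex_lineP _ _ _ _ (perp_part_sl_span pqU vH (dF_sub 1 y Uy)).
have d1F0 := partial_sub_span 1 (dF_analytic 0) (dF_sub 0) Uy F0E.
have d0F1 := partial_sub_span 0 (dF_analytic 1) (dF_sub 1) Uy F1E.
rewrite (vpartial_comm (F_analytic _ Uy)) in d0F1.
have [wP wQ] := omega_partial_V 0 Uy.
have CR := partial_V_cauchy_riemann Uy; have JCR := sl_span_cross pqU vH CR.
rewrite crossD3 crossN3 in JCR; have JJV := sl_span_cross_cross (V y) pqU wP wQ.
apply: (@sl_span_complex_div _ _ _ _ pqU vH (partial 0 V y) (x - z') (x' + z)) => //.
  apply: contra_notT notCR; rewrite negb_or !negbK subr_eq0 addrC addr_eq0.
  move=> /andP[/eqP xE /eqP zE]; rewrite F1E zE -xE.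
  rewrite -(cross_perp_part _ _ (partial 0 F y)) F0E crossD3 !crossZ3.
  by rewrite (cross_cross pqU vH) scalerN scaleNr addrC.
have := sub_sub (sub_sub d0F1 d1F0) (addmx_sub (scalemx_sub x CR)
  (addmx_sub (scalemx_sub x' JCR) (scalemx_sub x' JJV))).
congr (_ <= _)%MS; move: (partial 1 (partial 0 F) y) (partial 0 V y) (partial 1 V y) => g v0 v1.
move: (J y (J y v0)) (J y v0) (J y v1) => jj j j1.
by apply/rowP => k; rewrite !mxE; ring.
Qed.

Lemma partial_V_sub i y : U y -> (partial i V y <= W y)%MS.
Proof.
move=> Uy; have V0W : (partial 0 V y <= W y)%MS.
  by have [] := nondegenerate Uy; [apply: (@partial0_V_sub P)|apply: (@partial0_V_sub Q)].
have /= JV0W := sl_span_cross (PQ_unitary Uy) (V_herm_perp Uy) V0W.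
case: (I2_cases i) => ->; first exact: V0W.
rewrite -[partial 1 V y](subrK (J y (partial 0 V y))).
exact: addmx_sub (partial_V_cauchy_riemann Uy) JV0W.
Qed.

Let projW n y := sl_proj (P y) (Q y) (V y) n.

Let projW_sub n y : (projW n y <= W y)%MS.
Proof. exact: sl_proj_sub. Qed.

Let projW_id n y : U y -> (n <= W y)%MS -> projW n y = n.
Proof. by move=> Uy; apply: sl_proj_id; auto. Qed.

Let projW_analytic n y : U y -> vanalytic_at (projW n) y.
Proof. by move=> Uy; apply: vanalytic_sl_proj; auto. Qed.

Lemma inner_partial_sl_proj i n F y : (forall z, U z -> vanalytic_at F z) ->
  (forall z, U z -> (F z <= W z)%MS) -> U y -> (partial i F y <= W y)%MS ->
  inner (F y) (partial i (projW n) y) = 0.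
Proof.
move=> F_analytic F_sub Uy dF_sub; have Fy := F_analytic _ Uy.
have F_proj : \forall z \near y, inner (F z) (projW n z) = inner (F z) n.
  apply: filterS (U_nbhs Uy) => z Uz.
  by rewrite -sl_proj_self_adjoint -/(projW _ _) projW_id // F_sub.
have := partial_near_eq i F_proj; rewrite (partial_inner i Fy (projW_analytic n Uy)).
rewrite (partial_inner i Fy (vanalytic_cst n y)) partial_cst inner0r addr0.
rewrite -[X in inner X n](projW_id Uy dF_sub) sl_proj_self_adjoint.
by rewrite -[X in _ = X]addr0 => /addrI.
Qed.

Lemma partial_sl_proj i n y : U y -> partial i (projW n) y = 0.
Proof.
move=> Uy; have pqU := PQ_unitary Uy; have vH := V_herm_perp Uy; have v0 := V_neq0 Uy.
have [PW QW VW JVW] : [/\ forall z, U z -> (P z <= W z)%MS, forall z, U z -> (Q z <= W z)%MS,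
    forall z, U z -> (V z <= W z)%MS & forall z, U z -> (J z (V z) <= W z)%MS].
  by split=> z _; have /and4P[] := mem_sl_span (P z) (Q z) (V z).
have dVW := partial_V_sub i Uy; have JdVW := sl_span_cross pqU vH dVW.
have dJVW : (partial i (fun z => J z (V z)) y <= W y)%MS.
  rewrite -[partial i _ y](subrK (J y (partial i V y))).
  exact: addmx_sub (partial_JV_sub i Uy) JdVW.
have [c [d projE]] := sub_complex_lineP _ _ _ _ (perp_part_sl_span pqU vH (projW_sub n y)).
have dproj_sub : (partial i (projW n) y <= W y)%MS.
  have := partial_sub_span i (@projW_analytic n) (fun z _ => projW_sub n z) Uy projE.
  by rewrite -{2}[partial i _ y](subrK (c *: partial i V y + d *: J y (partial i V y)))
    => /addmx_sub; apply; rewrite addmx_sub ?scalemx_sub.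
rewrite -(sl_proj_id pqU vH v0 dproj_sub) /sl_proj.
rewrite (inner_partial_sl_proj n P_analytic PW Uy (partial_P_sub i Uy)).
rewrite (inner_partial_sl_proj n Q_analytic QW Uy (partial_Q_sub i Uy)).
rewrite (inner_partial_sl_proj n V_analytic VW Uy dVW).
rewrite (inner_partial_sl_proj n JV_analytic JVW Uy dJVW).
by rewrite mulr0 !scale0r !addr0.
Qed.

Lemma sl_span_locally_cst y : U y -> \forall z \near y, (W z <= W y)%MS.
Proof.
move=> Uy; have proj_cst : \forall z \near y, forall k,
    projW (delta_mx 0 k) z = projW (delta_mx 0 k) y.
  apply: (@filter_forall _ _ _ (nbhs y) _) => k; apply: vanalytic_partial0_cst.
    by apply: filterS (U_nbhs Uy) => z Uz; exact: projW_analytic.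
  by apply: filterS (U_nbhs Uy) => z Uz i; exact: partial_sl_proj.
apply: filterS2 (U_nbhs Uy) proj_cst => z Uz zy; apply/rV_subP => x xW.
suff -> : x = projW x y by exact: projW_sub.
apply/rowP => k; rewrite -[LHS]inner_delta -[RHS]inner_delta -[x in LHS](projW_id Uz xW).
by rewrite !sl_proj_self_adjoint -/(projW _ z) -/(projW _ y) zy.
Qed.

Theorem degenerate_ruling_rigidity y : U y -> \forall z \near y,
  [/\ (P z <= W y)%MS, (Q z <= W y)%MS & ((X z - X y)%R <= W y)%MS].
Proof.
move=> Uy; have W_near := sl_span_locally_cst Uy.
have X_cst : \forall z \near y, X z *m cokermx (W y) = X y *m cokermx (W y).
  apply: (@vanalytic_partial0_cst _ _ (fun z => X z *m cokermx (W y))).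
    by apply: filterS (U_nbhs Uy) => z Uz; apply: vanalytic_mulmxr; exact: X_analytic.
  apply: filterS2 (U_nbhs Uy) W_near => z Uz zy i; rewrite partial_mulmxr; last exact: X_analytic.
  by apply/eqP; rewrite -submxE; exact: submx_trans (partial_X_sub i Uz) zy.
apply: filterS2 W_near X_cst => z zy Xzy; have /and4P[PW QW _ _] := mem_sl_span (P z) (Q z) (V z).
by split; [exact: submx_trans PW zy|exact: submx_trans QW zy|rewrite submxE mulmxBl Xzy subrr].
Qed.

End Rigidity.

(** * Analytic surfaces *)

Section Charts.
Context {R : realType} {S : analyticSurface R}.
Implicit Types (c : chart R S) (u : S).

Lemma cmap_image_nbhs c u : cdom c u -> nbhs (cmap c u) (cmap c @` cdom c).
Proof. by move=> cu; apply: open_nbhs_nbhs; split; [exact: cimg_open|exists u]. Qed.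

Lemma cinv_image c y : (cmap c @` cdom c) y -> cdom c (cinv c y) /\ cmap c (cinv c y) = y.
Proof. by move=> [u cu <-]; rewrite cmapK. Qed.

Lemma near_cinvK c u : cdom c u -> \forall y \near cmap c u, cmap c (cinv c y) = y.
Proof. by move=> /cmap_image_nbhs; apply: filterS => y /cinv_image[]. Qed.

Lemma near_cinv c u (A : set S) : cdom c u -> nbhs u A -> \forall y \near cmap c u, A (cinv c y).
Proof.
move=> cu uA; have cinv_A : nbhs (cinv c (cmap c u)) A by rewrite cmapK.
exact: (cinv_continuous cu) _ cinv_A.
Qed.

Lemma near_chart c u (A : set 'rV[R]_2) : cdom c u -> nbhs (cmap c u) A ->
  \forall v \near u, A (cmap c v).
Proof. by move=> cu; exact: (cmap_continuous cu). Qed.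

Lemma cdom_nbhs c u : cdom c u -> nbhs u (cdom c).
Proof. by move=> cu; apply: open_nbhs_nbhs; split=> //; exact: cdom_open. Qed.

Lemma atlas_coordinates c : atlas c -> coordinates c.
Proof. by move=> ac c' ac'; exact: atlas_compatible. Qed.

Lemma near_transition c c' u : cdom c u -> cdom c' u ->
  \forall y \near cmap c u, cinv c' (cmap c' (cinv c y)) = cinv c y.
Proof. by move=> cu /cdom_nbhs /(near_cinv cu); apply: filterS => y /cmapK. Qed.

Lemma analytic_in_coordinates m (f : S -> 'rV[R]_m) c u :
  analytic_map f -> coordinates c -> cdom c u -> vanalytic_at (f \o cinv c) (cmap c u).
Proof.
move=> fa cc cu; have [c' ac' cu'] := atlas_cover u; have [cc' _] := cc c' ac'.
apply: (@vanalytic_near_eq _ _ ((f \o cinv c') \o (cmap c' \o cinv c))).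
  by apply: filterS (near_transition cu cu') => y /= ->.
by apply: vanalytic_comp; [rewrite /= cmapK //; exact: fa|exact: cc'].
Qed.

Definition chart_partial m i c (f : S -> 'rV[R]_m) u : 'rV[R]_m :=
  partial i (f \o cinv c) (cmap c u).

Lemma chart_partialE m i c (f : S -> 'rV[R]_m) u :
  chart_partial i c f u = partial i (f \o cinv c) (cmap c u).
Proof. by []. Qed.

Lemma chart_partial_change m i c c' (f : S -> 'rV[R]_m) u :
  analytic_map f -> coordinates c' -> transition_analytic c c' -> cdom c u -> cdom c' u ->
  chart_partial i c f u
    = partial i (cmap c' \o cinv c) (cmap c u) 0 0 *: chart_partial 0 c' f u
      + partial i (cmap c' \o cinv c) (cmap c u) 0 1 *: chart_partial 1 c' f u.
Proof.
set tau := cmap c' \o cinv c => fa cc' cc'_analytic cu cu'.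
have tauE : tau (cmap c u) = cmap c' u by rewrite /tau /= cmapK.
have dtau : differentiable tau (cmap c u).
  by apply: vanalytic_differentiable; exact: cc'_analytic.
have df : differentiable (f \o cinv c') (tau (cmap c u)).
  by rewrite tauE; apply: vanalytic_differentiable; exact: analytic_in_coordinates.
rewrite /chart_partial (@partial_near_eq _ _ _ i _ ((f \o cinv c') \o tau)).
  rewrite partialE; last exact: differentiable_comp.
  rewrite diff_comp //= -tauE !(partialE _ df) (partialE _ dtau).
  by rewrite {1}(row_sum_delta ('d tau _ _)) sum_I2 raddfD /= !linearZ.
by apply: filterS (near_transition cu cu') => y /= ->.
Qed.

Lemma analytic_mapD m (f g : S -> 'rV[R]_m) :
  analytic_map f -> analytic_map g -> analytic_map (fun u => f u + g u).
Proof. by move=> fa ga c u ac cu; apply: vanalyticD; [exact: fa|exact: ga]. Qed.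

Lemma analytic_mapZ m a (f : S -> 'rV[R]_m) : analytic_map f -> analytic_map (fun u => a *: f u).
Proof. by move=> fa c u ac cu; apply: vanalyticZ; [exact: analytic_cst|exact: fa]. Qed.

Lemma analytic_identity m (f : S -> 'rV[R]_m) u1 : connected [set: S] -> analytic_map f ->
  (\forall u \near u1, f u = 0) -> forall u, f u = 0.
Proof.
move=> S_connected fa f1; pose Z := [set u | f u = 0]°.
suff ZT : Z = [set: S] by move=> u; have : Z u by [rewrite ZT|]; exact: nbhs_singleton.
apply: S_connected; first by exists u1.
  by exists Z; [exact: open_interior|rewrite setTI].
exists Z; last by rewrite setTI.
move=> u Zu; have [c ac cu] := atlas_cover u.
suff f0 : \forall y \near cmap c u, forall k, (f \o cinv c) y 0 k = 0.
  apply: filterS2 (near_chart cu f0) (cdom_nbhs cu) => v /= fv cv; apply/rowP => k.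
  by have := fv k; rewrite cmapK // mxE.
apply: (@filter_forall _ _ _ (nbhs (cmap c u)) _) => k.
apply: (@analytic_vanishes_near_closure _ (fun y => (f \o cinv c) y 0 k)); first exact: fa.
move=> A uA; have [v [Zv [cv Av]]] := Zu _ (filterI (cdom_nbhs cu) (near_chart cu uA)).
exists (cmap c v); split=> //; apply: filterS (near_cinv cv Zv) => y fy.
by rewrite /= (fy : f _ = 0) mxE.
Qed.

End Charts.

Section ChangeOfCoordinates.
Context {R : realType} {S : analyticSurface R}.
Variables (c : chart R S) (F G : 'rV[R]_2 -> 'rV[R]_2) (A B : set 'rV[R]_2).
Hypotheses (A_open : open A) (B_open : open B) (cc : coordinates c).
Hypothesis AP : forall y, A y -> [/\ (cmap c @` cdom c) y, vanalytic_at F y & G (F y) = y].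
Hypothesis BP : forall z, B z -> vanalytic_at G z /\ F (G z) = z.

Let dom := [set u | [/\ cdom c u, A (cmap c u) & B (F (cmap c u))]].

Let dom_open : open dom.
Proof.
rewrite openE => u [cu Au Bu]; have [_ Fu _] := AP Au.
have A_near : \forall v \near u, A (cmap c v) by apply: near_chart => //; exact: open_nbhs_nbhs.
have B_near : \forall v \near u, B (F (cmap c v)).
  apply: (@near_chart _ _ c u [set y | B (F y)] cu); apply: (vanalytic_continuous Fu).
  exact: open_nbhs_nbhs.
by apply: filterS3 (cdom_nbhs cu) A_near B_near => v.
Qed.

Let img : (F \o cmap c) @` dom = [set z | B z /\ A (G z)].
Proof.
apply/seteqP; split=> [z [u [cu Au Bu] <-]|z [Bz Az]].
  by split=> //=; have [_ _ ->] := AP Au.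
have [/cinv_image[cu GzE] _ _] := AP Az; have [_ FGz] := BP Bz.
by exists (cinv c (G z)); rewrite /dom /= ?GzE ?FGz.
Qed.

Let img_open : open ((F \o cmap c) @` dom).
Proof.
rewrite img openE => z [Bz Az]; have [Gz _] := BP Bz.
have A_near : \forall w \near z, A (G w).
  by apply: (vanalytic_continuous Gz); exact: open_nbhs_nbhs.
by apply: filterS2 (open_nbhs_nbhs (conj B_open Bz)) A_near => w.
Qed.

Let mapK u : dom u -> (cinv c \o G) ((F \o cmap c) u) = u.
Proof. by move=> [cu Au _]; have [_ _ GF] := AP Au; rewrite /= GF cmapK. Qed.

Let map_continuous u : dom u -> {for u, continuous (F \o cmap c)}.
Proof.
move=> [cu Au _]; have [_ Fu _] := AP Au.
by apply: continuous_comp; [exact: cmap_continuous|exact: vanalytic_continuous].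
Qed.

Let inv_continuous u : dom u -> {for (F \o cmap c) u, continuous (cinv c \o G)}.
Proof.
move=> [cu Au Bu]; have [Gu _] := BP Bu; have [_ _ GF] := AP Au.
apply: continuous_comp; first exact: vanalytic_continuous.
by rewrite /= GF; exact: cinv_continuous.
Qed.

Definition changed_chart : chart R S := Chart dom_open img_open mapK map_continuous inv_continuous.

Lemma changed_chart_coordinates : coordinates changed_chart.
Proof.
move=> c' ac'; have [cc' c'c] := cc ac'; split=> u /=.
  move=> [cu Au Bu] cu'; have [Gu _] := BP Bu; have [_ _ GF] := AP Au.
  apply: (@vanalytic_comp _ _ (cmap c' \o cinv c) G) => //.
  by rewrite GF; exact: cc'.
move=> cu' [cu Au Bu]; have [_ Fu _] := AP Au.
by apply: (@vanalytic_comp _ _ F (cmap c \o cinv c')); [rewrite /= cmapK|exact: c'c].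
Qed.

End ChangeOfCoordinates.

Lemma coordinates_of_local_diffeomorphism (R : realType) (S : analyticSurface R)
    (c : chart R S) (F : 'rV[R]_2 -> 'rV[R]_2) u (N : set 'rV[R]_2) :
  coordinates c -> cdom c u -> nbhs (cmap c u) N -> vanalytic_at F (cmap c u) ->
  \matrix_i partial i F (cmap c u) \in unitmx ->
  exists c' : chart R S, [/\ coordinates c', cdom c' u,
    forall v, cdom c' v -> [/\ cdom c v, N (cmap c v) & vanalytic_at F (cmap c v)] &
    cmap c' = F \o cmap c].
Proof.
move=> cc cu Nu Fu dF; have [G [Gu GF FG]] := inverse_function Fu dF.
pose good y := [/\ (cmap c @` cdom c) y, vanalytic_at F y & G (F y) = y].
pose A := [set y | good y /\ N y]°; pose B := [set z | vanalytic_at G z /\ F (G z) = z]°.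
have AP y : A y -> good y by move=> /nbhs_singleton[].
have BP z : B z -> vanalytic_at G z /\ F (G z) = z by exact: nbhs_singleton.
have Au : A (cmap c u).
  apply: filterS2 Nu (filterI (cmap_image_nbhs cu) (filterI (vanalytic_near Fu) GF)).
  by move=> y Ny [cy [Fy GFy]].
have Bu : B (F (cmap c u)) by exact: filterI (vanalytic_near Gu) FG.
exists (changed_chart (@open_interior _ _) (@open_interior _ _) AP BP).
split=> //=; first exact: changed_chart_coordinates.
by move=> v [cv Av Bv]; have [_ Fv _] := AP _ Av; have [_ Nv] := nbhs_singleton Av.
Qed.

(** * Tangent spaces of a 2-ruled 4-fold *)

Section DirectionalDerivatives.
Context {R : realType}.

Lemma derive_eq_path (V V' W : normedModType R) (f : V -> W) (g : V' -> W) a b v w :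
  (forall h : R, f (h *: v + a) = g (h *: w + b)) -> 'D_v f a = 'D_w g b.
Proof.
move=> fg; have fa : f a = g b by have := fg 0; rewrite !scale0r !add0r.
rewrite /derive; congr (lim (_ @ 0^')); apply/funext => h /=.
by rewrite fg fa.
Qed.

Lemma derive_affine (V W : normedModType R) (f : V -> W) a v d :
  (forall h : R, f (h *: v + a) = h *: d + f a) -> 'D_v f a = d.
Proof.
move=> f_affine; apply/lim_near_cst => //=; near=> h.
rewrite f_affine addrK scalerA mulVf ?scale1r //.
by near: h; exact: nbhs_dnbhs_neq.
Unshelve. all: by end_near. Qed.

End DirectionalDerivatives.

Section Convergence.
Context {R : realType} {T : Type} {F : set_system T} {FF : Filter F}.

Lemma cvg_det n (A : T -> 'M[R]_n) (B : 'M[R]_n) :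
  (forall i j, A t i j @[t --> F] --> B i j) -> \det (A t) @[t --> F] --> \det B.
Proof.
move=> A_cvg; rewrite /determinant; apply: cvg_big => [|s _]; first exact: add_continuous.
by apply: cvgMl_tmp; apply: cvg_big => [|i _]; [exact: mul_continuous|exact: A_cvg].
Qed.

Lemma cvg_inner (X : T -> 'rV[R]_8) (x w : 'rV[R]_8) :
  X t @[t --> F] --> x -> inner (X t) w @[t --> F] --> inner x w.
Proof.
move=> X_cvg; apply: cvg_big => [|k _]; first exact: add_continuous.
by apply: cvgMr_tmp; exact: cvg_comp X_cvg (@coord_continuous _ _ _ 0 k x).
Qed.

End Convergence.

Section RuledFourfold.
Context {R : realType} {S : analyticSurface R}.
Variables phi1 phi2 psi : S -> 'rV[R]_8.
Hypotheses (phi1_analytic : analytic_map phi1) (phi2_analytic : analytic_map phi2)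
  (psi_analytic : analytic_map psi).
Implicit Types (c : chart R S) (u : S) (r : 'rV[R]_2).
Local Notation iota := (iota_M phi1 phi2 psi).
Local Notation tangent := (tangent_mx phi1 phi2 psi).
Local Notation immersion := (immersion_at phi1 phi2 psi).
Local Notation J u := (cross (phi1 u) (phi2 u)).

Lemma iota_analytic r : analytic_map (iota r).
Proof. by apply: analytic_mapD => //; apply: analytic_mapD; exact: analytic_mapZ. Qed.

Lemma chart_partial_iota i c r u : coordinates c -> cdom c u ->
  chart_partial i c (iota r) u = r 0 0 *: chart_partial i c phi1 u
    + r 0 1 *: chart_partial i c phi2 u + chart_partial i c psi u.
Proof.
move=> cc cu; have p1 := analytic_in_coordinates phi1_analytic cc cu.
have p2 := analytic_in_coordinates phi2_analytic cc cu.
have p3 := analytic_in_coordinates psi_analytic cc cu.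
have r1 := vanalyticZ (analytic_cst (r 0 0) _) p1.
have r2 := vanalyticZ (analytic_cst (r 0 1) _) p2.
rewrite /chart_partial -(partialcZ _ _ p1) -(partialcZ _ _ p2).
have r12 := vanalyticD r1 r2.
rewrite -(partialD _ (vanalytic_differentiable r1) (vanalytic_differentiable r2)).
by rewrite -(partialD _ (vanalytic_differentiable r12) (vanalytic_differentiable p3)).
Qed.

Definition frame c r u : 'M[R]_(4, 8) :=
  rows4 (phi1 u) (phi2 u) (chart_partial 0 c (iota r) u) (chart_partial 1 c (iota r) u).

Lemma local_iota_differentiable c r u : coordinates c -> cdom c u ->
  differentiable (local_iota phi1 phi2 psi c) (row_mx r (cmap c u)).
Proof.
move=> cc cu; apply: differentiable_rV => k.
have df (f : S -> 'rV[R]_8) : analytic_map f -> differentiable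
    (fun y : 'rV[R]_(2 + 2) => f (cinv c (rsubmx y)) 0 k) (row_mx r (cmap c u)).
  move=> fa; apply: (@differentiable_comp _ _ _ _ (fun y : 'rV[R]_(2 + 2) => rsubmx y)
    (fun z => (f \o cinv c) z 0 k)); first exact: differentiable_rsubmx.
  by rewrite row_mxKr; apply: analytic_differentiable; exact: analytic_in_coordinates.
have dl j : differentiable (fun y : 'rV[R]_(2 + 2) => lsubmx y 0 j) (row_mx r (cmap c u)).
  apply: (@differentiable_comp _ _ _ _ (fun y : 'rV[R]_(2 + 2) => lsubmx y)
    (fun z : 'rV[R]_2 => z 0 j)); first exact: differentiable_lsubmx.
  exact: differentiable_coord.
have -> : (fun z => local_iota phi1 phi2 psi c z 0 k) = (fun z : 'rV[R]_(2 + 2) =>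
    lsubmx z 0 0 * phi1 (cinv c (rsubmx z)) 0 k + lsubmx z 0 1 * phi2 (cinv c (rsubmx z)) 0 k
    + psi (cinv c (rsubmx z)) 0 k).
  by apply/funext => z; rewrite !mxE.
apply: differentiableD; last exact: df.
by apply: differentiableD; apply: differentiableM => //; exact: df.
Qed.

Lemma row_tangent c r u i : coordinates c -> cdom c u -> row i (tangent c (r, u))
  = 'D_(delta_mx 0 i) (local_iota phi1 phi2 psi c) (row_mx r (cmap c u)).
Proof. by move=> cc cu; rewrite rowE (deriveEjacobian _ (local_iota_differentiable r cc cu)). Qed.

Lemma row_tangent_ruling c r u i : coordinates c -> cdom c u ->
  row (lshift 2 i) (tangent c (r, u)) = iota (delta_mx 0 i) u - psi u.
Proof.
move=> cc cu; rewrite (row_tangent r _ cc cu) delta_mx_lshift; apply: derive_affine => h.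
rewrite scale_row_mx add_row_mx /local_iota !row_mxKl !row_mxKr scaler0 add0r cmapK // /iota_M.
by apply/rowP => k; rewrite !mxE; ring.
Qed.

Lemma row_tangent_base c r u i : coordinates c -> cdom c u ->
  row (rshift 2 i) (tangent c (r, u)) = chart_partial i c (iota r) u.
Proof.
move=> cc cu; rewrite (row_tangent r _ cc cu) delta_mx_rshift; apply: derive_eq_path => h.
by rewrite scale_row_mx add_row_mx /local_iota row_mxKl row_mxKr scaler0 add0r.
Qed.

Lemma tangent_frame c r u : coordinates c -> cdom c u -> tangent c (r, u) = frame c r u.
Proof.
move=> cc cu; have ruling i := row_tangent_ruling r i cc cu.
have base i := row_tangent_base r i cc cu; move: (tangent c (r, u)) ruling base => T ruling base.
have rowT (i j : 'I_(2 + 2)) : val i = val j -> row i T = row j T by move=> /val_inj ->.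
apply/row_matrixP; apply: ord4_ind; rewrite row_rows4.
- rewrite (rowT o0 (lshift 2 0)) // ruling /iota_M !mxE /=.
  by rewrite scale1r scale0r addr0 addrK.
- rewrite (rowT o1 (lshift 2 1)) // ruling /iota_M !mxE /=.
  by rewrite scale1r scale0r add0r addrK.
- by rewrite (rowT o2 (rshift 2 0)) // base.
- by rewrite (rowT o3 (rshift 2 1)) // base.
Qed.

Lemma frame_sub c c' r u : coordinates c' -> transition_analytic c c' ->
  cdom c u -> cdom c' u -> (frame c r u <= frame c' r u)%MS.
Proof.
move=> cc' cc'_analytic cu cu'; rewrite rows4_sub.
rewrite !(chart_partial_change _ (iota_analytic r) cc' cc'_analytic cu cu').
have /and4P[pT qT sT tT] := mem_rows4 (phi1 u) (phi2 u)
  (chart_partial 0 c' (iota r) u) (chart_partial 1 c' (iota r) u).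
apply/and4P; split; [exact: pT|exact: qT|exact: addmx_sub (scalemx_sub _ sT) (scalemx_sub _ tT)|].
exact: addmx_sub (scalemx_sub _ sT) (scalemx_sub _ tT).
Qed.

Lemma frame_eqmx c c' r u : coordinates c -> coordinates c' ->
  cdom c u -> cdom c' u -> (frame c r u :=: frame c' r u)%MS.
Proof.
have atlas_eqmx c1 d : coordinates c1 -> atlas d -> cdom c1 u -> cdom d u ->
    (frame c1 r u :=: frame d r u)%MS.
  move=> cc1 ad c1u du; have [c1d dc1] := cc1 d ad; have dd := atlas_coordinates ad.
  by apply/eqmxP/andP; split; [exact: frame_sub dd c1d c1u du|exact: frame_sub cc1 dc1 du c1u].
move=> cc cc' cu cu'; have [d ad du] := atlas_cover u.
exact: eqmx_trans (atlas_eqmx c d cc ad cu du) (eqmx_sym (atlas_eqmx c' d cc' ad cu' du)).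
Qed.

Lemma immersion_frame c r u : coordinates c -> cdom c u ->
  immersion (r, u) <-> row_free (frame c r u).
Proof.
move=> cc cu; have freeE d : atlas d -> cdom d u ->
    row_free (tangent d (r, u)) = row_free (frame c r u).
  move=> ad du; have dd := atlas_coordinates ad.
  have [rankE _] := frame_eqmx r cc dd cu du.
  by rewrite (tangent_frame r dd du); exact: (congr1 (fun k => k == 4%N) (esym rankE)).
split=> [[d [ad du]]|]; first by rewrite freeE.
by have [d ad du] := atlas_cover u; rewrite -(freeE d) // => free; exists d.
Qed.

Lemma analytic_map_continuous (f : S -> 'rV[R]_8) u : analytic_map f -> {for u, continuous f}.
Proof.
move=> fa; have [c ac cu] := atlas_cover u.
have f_near : \forall v \near u, (f \o cinv c) (cmap c v) = f v.
  by apply: filterS (cdom_nbhs cu) => v cv; rewrite /= cmapK.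
rewrite /prop_for /continuous_at -(nbhs_singleton f_near); apply: cvg_trans (near_eq_cvg f_near) _.
have fc := vanalytic_continuous (fa c u ac cu).
exact: (@cvg_comp _ _ _ (cmap c) (f \o cinv c) _ _ _ (cmap_continuous cu) fc).
Qed.

Lemma chart_partial_continuous i c (f : S -> 'rV[R]_8) u : analytic_map f -> coordinates c ->
  cdom c u -> {for u, continuous (chart_partial i c f)}.
Proof.
move=> fa cc cu.
have fc := vanalytic_continuous (vanalytic_partial i (analytic_in_coordinates fa cc cu)).
exact: (@cvg_comp _ _ _ (cmap c) (partial i (f \o cinv c)) _ _ _ (cmap_continuous cu) fc).
Qed.

(* Unification would otherwise decide [0 = 1] in ['I_2] by unfolding these to matrix entries. *)
#[local] Opaque chart_partial perp_part cross.

Lemma near_snd_cdom c r u : cdom c u -> \forall p \near (r, u), cdom c p.2.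
Proof. by move=> cu; apply: (@cvg_snd _ _ (nbhs r) (nbhs u) _); exact: cdom_nbhs. Qed.

Lemma chart_partial_iota_cvg i c r u : coordinates c -> cdom c u ->
  chart_partial i c (iota p.1) p.2 @[p --> (r, u)] --> chart_partial i c (iota r) u.
Proof.
move=> cc cu; rewrite chart_partial_iota //.
have coord_cvg (k : 'I_2) : (p.1 : 'rV[R]_2) 0 k @[p --> (r, u)] --> r 0 k.
  by apply: (@cvg_comp _ _ _ fst (fun s : 'rV[R]_2 => s 0 k));
    [exact: cvg_fst|exact: coord_continuous].
have snd_cvg (f : S -> 'rV[R]_8) : analytic_map f ->
    chart_partial i c f p.2 @[p --> (r, u)] --> chart_partial i c f u.
  move=> fa; apply: (@cvg_comp _ _ _ snd (chart_partial i c f)); first exact: cvg_snd.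
  exact: chart_partial_continuous.
apply: cvg_trans (cvgD (cvgD (cvgZ (coord_cvg 0) (snd_cvg _ phi1_analytic))
  (cvgZ (coord_cvg 1) (snd_cvg _ phi2_analytic))) (snd_cvg _ psi_analytic)).
apply: near_eq_cvg; apply: filterS (near_snd_cdom r cu) => p cp.
by rewrite chart_partial_iota.
Qed.

Lemma det_frame_cvg c r u (E : 'M[R]_(4, 8)) : coordinates c -> cdom c u ->
  \det (frame c p.1 p.2 *m E^T) @[p --> (r, u)] --> \det (frame c r u *m E^T).
Proof.
move=> cc cu; apply: cvg_det => i j.
have snd_cvg (f : S -> 'rV[R]_8) : analytic_map f -> f p.2 @[p --> (r, u)] --> f u.
  move=> fa; apply: (@cvg_comp _ _ _ snd f); first exact: cvg_snd.
  exact: analytic_map_continuous.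
rewrite (_ : (fun p => _) = (fun p : 'rV[R]_2 * S => inner (quad (phi1 p.2) (phi2 p.2)
    (chart_partial 0 c (iota p.1) p.2) (chart_partial 1 c (iota p.1) p.2) i) (row j E))).
  rewrite mulmx_trE row_rows4; apply: cvg_inner; move: i; apply: ord4_ind.
  - exact: snd_cvg phi1_analytic.
  - exact: snd_cvg phi2_analytic.
  - exact: chart_partial_iota_cvg.
  - exact: chart_partial_iota_cvg.
by apply/funext => p; rewrite mulmx_trE row_rows4.
Qed.

(** * From the equations to special Lagrangian *)

Hypothesis phi_orthonormal : forall u, orthonormal_pair (phi1 u) (phi2 u).
Local Notation perp u := (perp_part (phi1 u) (phi2 u)).

Definition sl_equations c (f g1 g2 : S -> R) u : Prop :=
  [/\ [/\ omega (phi1 u) (chart_partial 0 c phi1 u) = 0,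
          omega (phi1 u) (chart_partial 0 c phi2 u) = 0,
          omega (phi2 u) (chart_partial 0 c phi1 u) = 0 &
          omega (phi2 u) (chart_partial 0 c phi2 u) = 0],
      omega (phi1 u) (chart_partial 0 c psi u) = 0
      /\ omega (phi2 u) (chart_partial 0 c psi u) = 0,
      chart_partial 1 c phi1 u = J u (chart_partial 0 c phi1 u) + f u *: phi2 u,
      chart_partial 1 c phi2 u = J u (chart_partial 0 c phi2 u) - f u *: phi1 u &
      chart_partial 1 c psi u
        = J u (chart_partial 0 c psi u) + g1 u *: phi1 u + g2 u *: phi2 u].

Lemma sl_equations_iota c f g1 g2 u r : coordinates c -> cdom c u -> sl_equations c f g1 g2 u ->
  [/\ omega (phi1 u) (chart_partial 0 c (iota r) u) = 0,
      omega (phi2 u) (chart_partial 0 c (iota r) u) = 0 &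
      chart_partial 1 c (iota r) u = J u (chart_partial 0 c (iota r) u)
        + (g1 u - r 0 1 * f u) *: phi1 u + (g2 u + r 0 0 * f u) *: phi2 u].
Proof.
move=> cc cu [[w11 w12 w21 w22] [w1 w2] phi1_t phi2_t psi_t]; rewrite !chart_partial_iota //; split.
- by rewrite !omegaDr !omegaZr w11 w12 w1 !mulr0 !addr0.
- by rewrite !omegaDr !omegaZr w21 w22 w2 !mulr0 !addr0.
rewrite phi1_t phi2_t psi_t !crossD3 !crossZ3.
move: (J u (chart_partial 0 c phi1 u)) (J u (chart_partial 0 c phi2 u)) => j1 j2.
by move: (J u (chart_partial 0 c psi u)) => j; apply/rowP => k; rewrite !mxE; ring.
Qed.

Definition calibrated_basis r u (E : 'M[R]_(4, 8)) : Prop :=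
  [/\ E *m E^T = 1%:M,
      forall c, coordinates c -> cdom c u -> (E :=: frame c r u)%MS &
      complex.Re (Omega (fun i => row i E)) = 1].

Section FromEquations.
Hypothesis phi_isotropic : forall u, omega (phi1 u) (phi2 u) = 0.

Let phi_unitary u : unitary_pair (phi1 u) (phi2 u). Proof. by split. Qed.

Section AtPoint.
Variables (c : chart R S) (f g1 g2 : S -> R) (r : 'rV[R]_2) (u : S).
Hypotheses (cc : coordinates c) (cu : cdom c u) (equations : sl_equations c f g1 g2 u).
Local Notation nu := (perp u (chart_partial 0 c (iota r) u)).

Let nu_herm_perp : herm_perp (phi1 u) (phi2 u) nu.
Proof. by have [w1 w2 _] := sl_equations_iota r cc cu equations; exact: herm_perp_perp_part. Qed.

Lemma sl_equations_frame : (frame c r u :=: sl_span (phi1 u) (phi2 u) nu)%MS.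
Proof.
by have [_ _ iota_t] := sl_equations_iota r cc cu equations; exact: rows4_sl_span iota_t.
Qed.

Hypothesis ru_immersion : immersion (r, u).

Let nu_neq0 : nu != 0.
Proof. by apply: rows4_free_perp_part_neq0; exact: (immersion_frame r cc cu).1 ru_immersion. Qed.

Lemma sl_equations_ReOmega_gt0 :
  0 < ReOmega (phi1 u) (phi2 u) (chart_partial 0 c (iota r) u) (chart_partial 1 c (iota r) u).
Proof.
have [_ _ ->] := sl_equations_iota r cc cu equations.
rewrite -crossP -(cross_perp_part _ _ (chart_partial 0 c (iota r) u)) !innerDr !innerZr.
have [pJ qJ _ _] := herm_perp_cross (phi1 u) (phi2 u) nu.
rewrite (innerC _ (phi1 u)) (innerC _ (phi2 u)) pJ qJ !mulr0 !addr0.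
by rewrite cross_norm_herm_perp // inner_gt0.
Qed.

Lemma sl_equations_calibrated_basis : exists E, calibrated_basis r u E.
Proof.
have [E [EE ES E1]] := sl_span_calibrated_basis (phi_unitary u) nu_herm_perp nu_neq0.
exists E; split=> // c' cc' cu'; apply: eqmx_trans ES _.
exact: eqmx_trans (eqmx_sym sl_equations_frame) (frame_eqmx r cc cc' cu cu').
Qed.

Lemma det_frame_calibrated_basis_gt0 E : calibrated_basis r u E -> 0 < \det (frame c r u *m E^T).
Proof.
move=> [EE EF E1]; rewrite -(calibrated_orthonormal_basis EE E1) ?Omega_rows4.
  exact: sl_equations_ReOmega_gt0.
by rewrite (EF c cc cu) submx_refl.
Qed.

End AtPoint.

Lemma calibrated_basis_orientation r u (E : 'rV[R]_2 * S -> 'M[R]_(4, 8)) c f g1 g2 :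
  (forall p, immersion p -> calibrated_basis p.1 p.2 (E p)) -> immersion (r, u) ->
  coordinates c -> cdom c u -> (forall v, cdom c v -> sl_equations c f g1 g2 v) ->
  \forall p \near (r, u), immersion p -> 0 < \det (E p *m (E (r, u))^T).
Proof.
move=> E_basis im cc cu equations.
have det_gt0 s v : cdom c v -> immersion (s, v) -> 0 < \det (frame c s v *m (E (s, v))^T).
  move=> cv imv.
  exact: (det_frame_calibrated_basis_gt0 cc cv (equations v cv) imv (E_basis _ imv)).
have near_det_gt0 : \forall p \near (r, u), 0 < \det (frame c p.1 p.2 *m (E (r, u))^T).
  have frame_cvg := @det_frame_cvg c r u (E (r, u)) cc cu.
  exact: frame_cvg _ (open_nbhs_nbhs (conj (@open_gt _ 0) (det_gt0 r u cu im))).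
apply: filterS2 (near_snd_cdom r cu) near_det_gt0 => -[s v] /= cv sv_gt0 imv.
have [EE EF _] := E_basis _ imv.
have frame_sub : (frame c s v <= E (s, v))%MS by rewrite (EF c cc cv) submx_refl.
move: sv_gt0; rewrite -(sub_orthonormal_proj EE frame_sub) -mulmxA det_mulmx.
by rewrite pmulr_rgt0 // det_gt0.
Qed.

Theorem sl_equations_special_lagrangian :
  (forall u0, exists c f g1 g2,
    [/\ cdom c u0, coordinates c & forall u, cdom c u -> sl_equations c f g1 g2 u]) ->
  special_lagrangian phi1 phi2 psi.
Proof.
move=> equations.
have E_exists p : exists E, immersion p -> calibrated_basis p.1 p.2 E.
  case: p => r u; have [im|] := pselect (immersion (r, u)); last by exists 0.
  have [c [f [g1 [g2 [cu cc eqs]]]]] := equations u.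
  by have [E ?] := sl_equations_calibrated_basis cc cu (eqs u cu) im; exists E.
have [E E_basis] := choice E_exists; exists E; last first.
  by move=> p im v; have [EE _ E1] := E_basis p im; exact: calibrated_orthonormal_basis EE E1 v.
split=> [p im|[r u] c im ac cu|[r u] im].
- by have [] := E_basis p im.
- have [_ EF _] := E_basis _ im; have cc := atlas_coordinates ac.
  by rewrite (tangent_frame r cc cu); exact: EF.
- have [c [f [g1 [g2 [cu cc eqs]]]]] := equations u.
  exact: calibrated_basis_orientation E_basis im cc cu eqs.
Qed.

End FromEquations.

(** * From special Lagrangian to the equations *)

Section FromSpecialLagrangian.
Hypothesis M_singularities : singularities_nowhere_dense phi1 phi2 psi.

Lemma analytic_immersions_eq0 u (h : 'rV[R]_2 -> R) : (forall r, analytic_at h r) ->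
  (forall r, immersion (r, u) -> h r = 0) -> forall r, h r = 0.
Proof.
move=> h_analytic h_im r; apply: contrapT => /eqP hr.
have h_neq0 := near_neq0 (h_analytic r) hr.
have : (closure [set s | ~ immersion (s, u)])° r.
  apply: filterS h_neq0 => s /eqP hs; apply: subset_closure => im.
  by apply: hs; exact: h_im.
by rewrite (M_singularities u).
Qed.

Lemma immersion_exists u : exists r, immersion (r, u).
Proof.
apply: contrapT => no_im; have one_analytic (r : 'rV[R]_2) := analytic_cst (1 : R) r.
have /(_ _ 0) one0 := @analytic_immersions_eq0 u (fun=> 1) one_analytic.
suff /eqP : (1 : R) = 0 by rewrite oner_eq0.
by apply: one0 => r im; exfalso; apply: no_im; exists r.
Qed.

Lemma chart_partial_iota_analytic i c u r : coordinates c -> cdom c u ->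
  vanalytic_at (fun s => chart_partial i c (iota s) u) r.
Proof.
move=> cc cu; have -> : (fun s => chart_partial i c (iota s) u) = (fun s : 'rV[R]_2 =>
    s 0 0 *: chart_partial i c phi1 u + s 0 1 *: chart_partial i c phi2 u
    + chart_partial i c psi u).
  by apply/funext => s; exact: chart_partial_iota.
apply: vanalyticD; last exact: vanalytic_cst.
by apply: vanalyticD; exact: vanalyticZ (analytic_coord _ _) (vanalytic_cst _ _).
Qed.

Hypothesis M_special_lagrangian : special_lagrangian phi1 phi2 psi.

Lemma special_lagrangian_immersion c u r : coordinates c -> cdom c u -> immersion (r, u) ->
  [/\ omega (phi1 u) (phi2 u) = 0,
      forall i, omega (phi1 u) (chart_partial i c (iota r) u) = 0
             /\ omega (phi2 u) (chart_partial i c (iota r) u) = 0 &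
      line_residual (phi1 u) (phi2 u) (perp u (chart_partial 0 c (iota r) u))
        (perp u (chart_partial 1 c (iota r) u)) = 0].
Proof.
move=> cc cu im; have [E [EE E_tangent _] E_calibrated] := M_special_lagrangian.
have [d ad du] := atlas_cover u; have dd := atlas_coordinates ad.
have := E_tangent _ _ im ad du; rewrite (tangent_frame r dd du) => EF.
have FE := eqmx_trans (frame_eqmx r cc dd cu du) (eqmx_sym EF).
have [wpq w0 w1 residual] := calibrated_frame (EE _ im) (E_calibrated _ im) (phi_orthonormal u) FE.
split; [exact: wpq| |exact: residual].
by move=> i; case: (I2_cases i) => ->; [exact: w0|exact: w1].
Qed.

Lemma special_lagrangian_isotropic u : omega (phi1 u) (phi2 u) = 0.
Proof.
have [r im] := immersion_exists u; have [c ac cu] := atlas_cover u.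
by have [] := special_lagrangian_immersion (atlas_coordinates ac) cu im.
Qed.

Let phi_unitary u : unitary_pair (phi1 u) (phi2 u).
Proof. by split=> //; exact: special_lagrangian_isotropic. Qed.

Lemma omega_chart_partial_iota c u i r : coordinates c -> cdom c u ->
  omega (phi1 u) (chart_partial i c (iota r) u) = 0
  /\ omega (phi2 u) (chart_partial i c (iota r) u) = 0.
Proof.
move=> cc cu.
have omega0 (p : 'rV[R]_8) :
    (forall s, immersion (s, u) -> omega p (chart_partial i c (iota s) u) = 0) ->
    omega p (chart_partial i c (iota r) u) = 0.
  move=> p_im.
  apply: (@analytic_immersions_eq0 u (fun s => omega p (chart_partial i c (iota s) u))) => // s.
  by apply: analytic_omega; [exact: vanalytic_cst|exact: chart_partial_iota_analytic].
by split; apply: omega0 => s /(special_lagrangian_immersion cc cu)[_ /(_ i)[]].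
Qed.

Lemma herm_perp_chart_partial_iota c u i r : coordinates c -> cdom c u ->
  herm_perp (phi1 u) (phi2 u) (perp u (chart_partial i c (iota r) u)).
Proof.
by move=> cc cu; have [w1 w2] := omega_chart_partial_iota i r cc cu; exact: herm_perp_perp_part.
Qed.

Lemma line_residual_chart_partial_iota c u r : coordinates c -> cdom c u ->
  line_residual (phi1 u) (phi2 u) (perp u (chart_partial 0 c (iota r) u))
    (perp u (chart_partial 1 c (iota r) u)) = 0.
Proof.
move=> cc cu.
have nu_analytic i s : vanalytic_at (fun s => perp u (chart_partial i c (iota s) u)) s.
  apply: vanalytic_perp_part; [exact: vanalytic_cst|exact: vanalytic_cst|].
  exact: chart_partial_iota_analytic.
have residual_analytic s := vanalytic_line_residual (vanalytic_cst (phi1 u) s)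
  (vanalytic_cst (phi2 u) s) (nu_analytic 0 s) (nu_analytic 1 s).
apply/rowP => k; rewrite [RHS]mxE.
apply: (@analytic_immersions_eq0 u (fun s => line_residual (phi1 u) (phi2 u)
  (perp u (chart_partial 0 c (iota s) u)) (perp u (chart_partial 1 c (iota s) u)) 0 k)) => s.
  exact: residual_analytic.
by move=> /(special_lagrangian_immersion cc cu)[_ _ ->]; rewrite mxE.
Qed.

Lemma omega_chart_partial c u i : coordinates c -> cdom c u ->
  [/\ [/\ omega (phi1 u) (chart_partial i c phi1 u) = 0,
          omega (phi1 u) (chart_partial i c phi2 u) = 0,
          omega (phi2 u) (chart_partial i c phi1 u) = 0 &
          omega (phi2 u) (chart_partial i c phi2 u) = 0],
      omega (phi1 u) (chart_partial i c psi u) = 0 &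
      omega (phi2 u) (chart_partial i c psi u) = 0].
Proof.
move=> cc cu; have coefs0 (p : 'rV[R]_8) :
    (forall r, omega p (chart_partial i c (iota r) u) = 0) ->
    [/\ omega p (chart_partial i c phi1 u) = 0, omega p (chart_partial i c phi2 u) = 0 &
        omega p (chart_partial i c psi u) = 0].
  move=> p0; have affine0 s t : s * omega p (chart_partial i c phi1 u)
      + t * omega p (chart_partial i c phi2 u) + omega p (chart_partial i c psi u) = 0.
    have := p0 (rV2 s t); rewrite (chart_partial_iota _ _ cc cu) !mxE /=.
    by rewrite (omegaDr p (_ + _)) (omegaDr p) !omegaZr.
  move: (omega p (chart_partial i c phi1 u)) (omega p (chart_partial i c phi2 u)) affine0 => x y.
  move: (omega p (chart_partial i c psi u)) => z affine0.
  by have := affine0 0 0; have := affine0 1 0; have := affine0 0 1; split; lra.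
have [w11 w12 w1] := coefs0 (phi1 u) (fun r => (omega_chart_partial_iota i r cc cu).1).
by have [w21 w22 w2] := coefs0 (phi2 u) (fun r => (omega_chart_partial_iota i r cc cu).2).
Qed.

Definition isothermal_at c r u : Prop :=
  perp u (chart_partial 0 c (iota r) u) != 0 /\
  perp u (chart_partial 1 c (iota r) u) = J u (perp u (chart_partial 0 c (iota r) u)).

Definition normal_field c r i y : 'rV[R]_8 :=
  perp (cinv c y) (partial i (iota r \o cinv c) y).

Lemma normal_fieldE c r i u : cdom c u ->
  normal_field c r i (cmap c u) = perp u (chart_partial i c (iota r) u).
Proof. by move=> cu; rewrite /normal_field cmapK // chart_partialE. Qed.

Lemma normal_field_analytic c r i u : coordinates c -> cdom c u ->
  vanalytic_at (normal_field c r i) (cmap c u).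
Proof.
move=> cc cu; have p := analytic_in_coordinates phi1_analytic cc cu.
have q := analytic_in_coordinates phi2_analytic cc cu.
apply: (vanalytic_perp_part p q); apply: vanalytic_partial.
exact: analytic_in_coordinates (iota_analytic r) cc cu.
Qed.

Section BeltramiEquation.
Variables (c : chart R S) (r : 'rV[R]_2).
Hypothesis cc : coordinates c.
Local Notation nu := (normal_field c r).

Definition beltrami_re y := (inner (nu 0 y) (nu 0 y))^-1 * inner (nu 1 y) (nu 0 y).
Definition beltrami_im y :=
  (inner (nu 0 y) (nu 0 y))^-1 * inner (nu 1 y) (J (cinv c y) (nu 0 y)).

Lemma normal_field_beltrami u : cdom c u -> nu 0 (cmap c u) != 0 ->
  nu 1 (cmap c u)
    = beltrami_re (cmap c u) *: nu 0 (cmap c u) + beltrami_im (cmap c u) *: J u (nu 0 (cmap c u)).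
Proof.
move=> cu; rewrite /beltrami_re /beltrami_im !normal_fieldE // cmapK // => nu0.
exact: line_residual_solve nu0 (line_residual_chart_partial_iota r cc cu).
Qed.

Section AtImmersion.
Variable u : S.
Hypotheses (cu : cdom c u) (im : immersion (r, u)).

Lemma normal_field_neq0 : nu 0 (cmap c u) != 0.
Proof.
rewrite normal_fieldE //; apply: rows4_free_perp_part_neq0.
exact: (immersion_frame r cc cu).1 im.
Qed.

Lemma beltrami_im_neq0 : beltrami_im (cmap c u) != 0.
Proof.
apply/eqP => im0; have := normal_field_beltrami cu normal_field_neq0.
rewrite im0 scale0r addr0 !normal_fieldE //; set x := beltrami_re _ => nuE.
exact: (rows4_free_perp_part_neq ((immersion_frame r cc cu).1 im) nuE).
Qed.

Lemma beltrami_re_analytic : analytic_at beltrami_re (cmap c u).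
Proof.
have nu_analytic i := normal_field_analytic r i cc cu.
exact: analytic_normalized_inner normal_field_neq0 (nu_analytic 0) (nu_analytic 1) (nu_analytic 0).
Qed.

Lemma beltrami_im_analytic : analytic_at beltrami_im (cmap c u).
Proof.
have nu_analytic i := normal_field_analytic r i cc cu.
apply: analytic_normalized_inner normal_field_neq0 (nu_analytic 0) (nu_analytic 1) _.
have p := analytic_in_coordinates phi1_analytic cc cu.
have q := analytic_in_coordinates phi2_analytic cc cu.
exact: vanalytic_cross p q (nu_analytic 0).
Qed.

End AtImmersion.

Lemma beltrami_isothermal c' (u1 v1 : 'rV[R]_2 -> R) u : coordinates c' ->
  transition_analytic c c' -> cdom c u -> cdom c' u ->
  (forall i, partial i (cmap c' \o cinv c) (cmap c u)
    = rV2 (partial i u1 (cmap c u)) (partial i v1 (cmap c u))) ->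
  nu 0 (cmap c u) != 0 -> beltrami_im (cmap c u) != 0 -> partial 0 u1 (cmap c u) != 0 ->
  partial 1 u1 (cmap c u) = beltrami_re (cmap c u) * partial 0 u1 (cmap c u)
    - beltrami_im (cmap c u) * partial 0 v1 (cmap c u) ->
  partial 1 v1 (cmap c u) = beltrami_im (cmap c u) * partial 0 u1 (cmap c u)
    + beltrami_re (cmap c u) * partial 0 v1 (cmap c u) ->
  isothermal_at c' r u.
Proof.
move=> cc' tr cu cu' dF nu0 im0 u1s u1t v1t.
have nuE i : nu i (cmap c u) = partial i u1 (cmap c u) *: perp u (chart_partial 0 c' (iota r) u)
    + partial i v1 (cmap c u) *: perp u (chart_partial 1 c' (iota r) u).
  rewrite normal_fieldE // (chart_partial_change i (iota_analytic r) cc' tr cu cu') dF !mxE /=.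
  by rewrite perp_partD; congr (_ + _); exact: perp_partZ.
have nu_beltrami := normal_field_beltrami cu nu0; rewrite !nuE u1t v1t in nu_beltrami.
rewrite (nuE 0) in nu0.
exact: (beltrami_cauchy_riemann (phi_unitary u) im0 u1s nu0
  (herm_perp_chart_partial_iota 0 r cc' cu') (herm_perp_chart_partial_iota 1 r cc' cu')
  nu_beltrami).
Qed.

End BeltramiEquation.

Lemma isothermal_coordinates u0 : exists c r, [/\ coordinates c, cdom c u0 &
  forall u, cdom c u -> isothermal_at c r u].
Proof.
have [r im] := immersion_exists u0; have [c0 ac0 cu0] := atlas_cover u0.
have cc0 := atlas_coordinates ac0; pose y0 := cmap c0 u0.
pose X := beltrami_re c0 r; pose Y := beltrami_im c0 r.
have Xy0 : analytic_at X y0 := beltrami_re_analytic cc0 cu0 im.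
have Yy0 : analytic_at Y y0 := beltrami_im_analytic cc0 cu0 im.
have [u1 [v1 [u1y v1y u1s v1s [u1t v1t]]]] := beltrami_solution Xy0 Yy0.
pose F y : 'rV[R]_2 := rV2 (u1 y) (v1 y).
have Fy0 : vanalytic_at F y0.
  by move=> k; case: (I2_cases k) => ->; under eq_fun do rewrite mxE.
have dF i y : vanalytic_at F y -> partial i F y = rV2 (partial i u1 y) (partial i v1 y).
  move=> Fy; have Fd := vanalytic_differentiable Fy.
  by apply: rV2P; rewrite partial_coord // !mxE; under eq_fun do rewrite mxE.
have Y0 : Y y0 != 0 := beltrami_im_neq0 cc0 cu0 im.
have nu_analytic := normal_field_analytic r 0 cc0 cu0.
have near_nu_neq0 := vanalytic_near_neq0 nu_analytic (normal_field_neq0 cc0 cu0 im).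
have near_u1s : \forall y \near y0, partial 0 u1 y != 0.
  by apply: near_neq0; [exact: analytic_partial|rewrite u1s oner_eq0].
have dF_unit : \matrix_i partial i F y0 \in unitmx.
  rewrite unitmxE det_trig; last first.
    apply/is_trig_mxP => i j; rewrite mxE dF //.
    by case: (I2_cases i) => ->; case: (I2_cases j) => -> //; rewrite mxE.
  rewrite big_ord_recl big_ord1 !mxE !dF // !mxE /= (_ : lift _ _ = 1); last exact/val_inj.
  rewrite u1s mul1r (nbhs_singleton v1t) u1s v1s.
  by rewrite mulr1 mulr0 addr0 unitfE.
have [c [cc cu0' c_sub cE]] := coordinates_of_local_diffeomorphism cc0 cu0
  (filterI (filterI near_nu_neq0 (near_neq0 Yy0 Y0)) (filterI near_u1s (filterI u1t v1t)))
  Fy0 dF_unit.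
exists c, r; split=> // u cu.
have [c0u [[nu0 Yu] [u1su [u1tu v1tu]]] Fu] := c_sub u cu.
have tr : transition_analytic c0 c by have [] := cc c0 ac0.
apply: (@beltrami_isothermal c0 r cc0 c u1 v1 u) => // i; rewrite -dF //.
apply: partial_near_eq; apply: filterS (near_cinvK c0u) => y yE.
by rewrite /= cE /= yE.
Qed.

Definition degenerate_at c u : Prop :=
  perp u (chart_partial 1 c phi1 u) <> J u (chart_partial 0 c phi1 u) \/
  perp u (chart_partial 1 c phi2 u) <> J u (chart_partial 0 c phi2 u).

Section IsothermalCoordinates.
Variables (c : chart R S) (r : 'rV[R]_2).
Hypotheses (cc : coordinates c) (c_isothermal : forall u, cdom c u -> isothermal_at c r u).
Local Notation nu u := (perp u (chart_partial 0 c (iota r) u)).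
Local Notation W u := (sl_span (phi1 u) (phi2 u) (nu u)).

Lemma degenerate_chart_partial_sub i u : cdom c u -> degenerate_at c u ->
  (chart_partial i c phi1 u <= W u)%MS /\ (chart_partial i c phi2 u <= W u)%MS.
Proof.
rewrite /degenerate_at -(cross_perp_part _ _ (chart_partial 0 c phi1 u)).
rewrite -(cross_perp_part _ _ (chart_partial 0 c phi2 u)) => cu degenerate.
have [nu0 nu_t] := c_isothermal cu; have nuH := herm_perp_chart_partial_iota 0 r cc cu.
have [[w11 w12 w21 w22] _ _] := omega_chart_partial 0 cc cu.
have phi1H := herm_perp_perp_part (phi_unitary u) w11 w21.
have phi2H := herm_perp_perp_part (phi_unitary u) w12 w22.
have residual0 s t : line_residual (phi1 u) (phi2 u)
    (nu u + (s *: perp u (chart_partial 0 c phi1 u) + t *: perp u (chart_partial 0 c phi2 u)))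
    (J u (nu u) + (s *: perp u (chart_partial 1 c phi1 u) + t *: perp u (chart_partial 1 c phi2 u)))
    = 0.
  have iotaE k : perp u (chart_partial k c (iota (rV2 s t + r)) u)
      = perp u (chart_partial k c (iota r) u)
      + (s *: perp u (chart_partial k c phi1 u) + t *: perp u (chart_partial k c phi2 u)).
    rewrite (chart_partial_iota k (rV2 s t + r) cc cu) (chart_partial_iota k r cc cu).
    move: (chart_partial k c phi1 u) (chart_partial k c phi2 u) (chart_partial k c psi u) => x y z.
    rewrite -!perp_partZ -!perp_partD; congr perp_part.
    by rewrite !mxE /=; apply/rowP => l; rewrite !mxE; ring.
  have nu_tE := etrans (iotaE 1) (congr1 (+%R^~ _) nu_t).
  exact: (etrans (congr2 _ (esym (iotaE 0)) (esym nu_tE))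
    (line_residual_chart_partial_iota _ cc cu)).
have [p0 q0 p1 q1] :=
  complex_line_cross_pencil2 (phi_unitary u) nuH phi1H phi2H nu0 degenerate residual0.
by case: (I2_cases i) => ->; split; apply: perp_part_line_sl_span.
Qed.

Lemma near_degenerate u : cdom c u -> degenerate_at c u ->
  \forall y \near cmap c u, degenerate_at c (cinv c y).
Proof.
move=> cu; pose P := phi1 \o cinv c; pose Q := phi2 \o cinv c.
have Pu := analytic_in_coordinates phi1_analytic cc cu.
have Qu := analytic_in_coordinates phi2_analytic cc cu.
pose defect F y := perp_part (P y) (Q y) (partial 1 F y) - cross (P y) (Q y) (partial 0 F y).
have defect_analytic F : vanalytic_at F (cmap c u) -> vanalytic_at (defect F) (cmap c u).
  move=> Fu; apply: vanalyticB.
    exact: vanalytic_perp_part Pu Qu (vanalytic_partial 1 Fu).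
  exact: vanalytic_cross Pu Qu (vanalytic_partial 0 Fu).
have near_neq (f : S -> 'rV[R]_8) : analytic_map f ->
    perp u (chart_partial 1 c f u) <> J u (chart_partial 0 c f u) ->
    \forall y \near cmap c u, perp (cinv c y) (chart_partial 1 c f (cinv c y))
      <> J (cinv c y) (chart_partial 0 c f (cinv c y)).
  move=> fa /eqP; rewrite -subr_eq0 => fu.
  have fu_analytic := defect_analytic _ (analytic_in_coordinates fa cc cu).
  have near_defect : \forall y \near cmap c u, defect (f \o cinv c) y != 0.
    by apply: (vanalytic_near_neq0 fu_analytic); rewrite /defect -!chart_partialE /P /Q /= cmapK.
  apply: filterS2 (near_cinvK cu) near_defect => y yE.
  by rewrite !chart_partialE yE /defect subr_eq0 => /eqP.
case=> [phi1u|phi2u].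
  by apply: filterS (near_neq _ phi1_analytic phi1u) => y; left.
by apply: filterS (near_neq _ phi2_analytic phi2u) => y; right.
Qed.

Lemma degenerate_locally_planar u : cdom c u -> degenerate_at c u ->
  \forall v \near u, [/\ (phi1 v <= W u)%MS, (phi2 v <= W u)%MS &
    ((iota r v - iota r u)%R <= W u)%MS].
Proof.
move=> cu degenerate.
have [U [U_open Uu UP]] : exists U : set 'rV[R]_2, [/\ open U, U (cmap c u) &
    forall y, U y -> (cmap c @` cdom c) y /\ degenerate_at c (cinv c y)].
  exists [set y | (cmap c @` cdom c) y /\ degenerate_at c (cinv c y)]°; split.
  - exact: open_interior.
  - exact: filterI (cmap_image_nbhs cu) (near_degenerate cu degenerate).
  - by move=> y /nbhs_singleton.
have on_U (A : 'rV[R]_2 -> Prop) :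
    (forall v, cdom c v -> degenerate_at c v -> A (cmap c v)) -> forall y, U y -> A y.
  by move=> A_cmap y /UP[[v cv <-]]; rewrite cmapK //; exact: A_cmap.
have analytic_on_U (f : S -> 'rV[R]_8) :
    analytic_map f -> forall y, U y -> vanalytic_at (f \o cinv c) y.
  by move=> fa; apply: on_U => v cv _; exact: analytic_in_coordinates.
have near_planar : \forall y \near cmap c u,
    let W0 := sl_span ((phi1 \o cinv c) (cmap c u)) ((phi2 \o cinv c) (cmap c u))
      (normal_field c r 0 (cmap c u)) in
    [/\ ((phi1 \o cinv c) y <= W0)%MS, ((phi2 \o cinv c) y <= W0)%MS &
        (((iota r \o cinv c) y - (iota r \o cinv c) (cmap c u))%R <= W0)%MS].
  apply: degenerate_ruling_rigidity Uu.
  - exact: U_open.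
  - exact: analytic_on_U.
  - exact: analytic_on_U.
  - by apply: analytic_on_U; exact: iota_analytic.
  - by apply: on_U => v cv _; exact: normal_field_analytic.
  - by apply: on_U => v cv _; rewrite /= cmapK.
  - apply: on_U => v cv _; rewrite normal_fieldE //= cmapK //; exact: herm_perp_chart_partial_iota.
  - by apply: on_U => v cv _; rewrite normal_fieldE //; have [] := c_isothermal cv.
  - by [].
  - apply: on_U => v cv _; rewrite normal_fieldE //= cmapK //; exact: (c_isothermal cv).2.
  - move=> i; apply: on_U => v cv dv; rewrite normal_fieldE //= cmapK //.
    by have [] := degenerate_chart_partial_sub i cv dv.
  - move=> i; apply: on_U => v cv dv; rewrite normal_fieldE //= cmapK //.
    by have [] := degenerate_chart_partial_sub i cv dv.
  - by apply: on_U => v cv dv; rewrite /= cmapK.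
apply: filterS2 (cdom_nbhs cu) (near_chart cu near_planar) => v cv.
by rewrite normal_fieldE //= !cmapK.
Qed.

Hypothesis S_connected : connected [set: S].

Lemma analytic_map_sub (f : S -> 'rV[R]_8) (A : 'M[R]_(4, 8)) u : analytic_map f ->
  (\forall v \near u, (f v <= A)%MS) -> forall v, (f v <= A)%MS.
Proof.
move=> fa near_sub v; rewrite submxE; apply/eqP.
apply: (@analytic_identity _ _ _ (fun w => f w *m cokermx A) u S_connected).
  by move=> d w ad dw; apply: vanalytic_mulmxr; exact: fa.
by apply: filterS near_sub => w; rewrite submxE => /eqP.
Qed.

Lemma degenerate_planar u : cdom c u -> degenerate_at c u -> planar phi1 phi2 psi.
Proof.
move=> cu degenerate; have near_planar := degenerate_locally_planar cu degenerate.
have phi1_sub : forall v, (phi1 v <= W u)%MS.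
  by apply: (analytic_map_sub phi1_analytic (u := u)); apply: filterS near_planar => v [].
have phi2_sub : forall v, (phi2 v <= W u)%MS.
  by apply: (analytic_map_sub phi2_analytic (u := u)); apply: filterS near_planar => v [].
have iota_sub : forall v, ((iota r v - iota r u)%R <= W u)%MS.
  apply: (@analytic_map_sub (fun v => iota r v - iota r u) _ u).
    by move=> d v ad dv; apply: vanalyticB; [exact: iota_analytic|exact: vanalytic_cst].
  by apply: filterS near_planar => v [].
exists (iota r u), (W u); split.
  have [nu0 _] := c_isothermal cu.
  exact: sl_span_free (phi_unitary u) (herm_perp_chart_partial_iota 0 r cc cu) nu0.
move=> s v; have -> : iota s v - iota r u = (s 0 0 - r 0 0) *: phi1 v + (s 0 1 - r 0 1) *: phi2 v
    + (iota r v - iota r u).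
  by rewrite /iota_M; apply/rowP => k; rewrite !mxE; ring.
by rewrite addmx_sub ?iota_sub // addmx_sub ?scalemx_sub.
Qed.

Lemma partial_inner_cst (f g : S -> 'rV[R]_8) k i u : analytic_map f -> analytic_map g ->
  (forall v, inner (f v) (g v) = k) -> cdom c u ->
  inner (chart_partial i c f u) (g u) + inner (f u) (chart_partial i c g u) = 0.
Proof.
move=> fa ga fg cu; rewrite !chart_partialE.
have := partial_inner i (analytic_in_coordinates fa cc cu) (analytic_in_coordinates ga cc cu).
rewrite /= (cmapK cu) => <-; rewrite (_ : (fun z => _) = (fun=> k)) ?partial_cst //.
by apply/funext => z; exact: fg.
Qed.

Lemma inner_chart_partial_analytic (f g : S -> 'rV[R]_8) i : analytic_map f -> analytic_map g ->
  analytic_on_chart c (fun u => inner (f u) (chart_partial i c g u)).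
Proof.
move=> fa ga u cu; have gu := analytic_in_coordinates ga cc cu.
apply: analytic_near_eq
  (analytic_inner (analytic_in_coordinates fa cc cu) (vanalytic_partial i gu)).
by apply: filterS (near_cinvK cu) => y yE; rewrite /= chart_partialE yE.
Qed.

Hypothesis M_nonplanar : ~ planar phi1 phi2 psi.

Lemma perp_cauchy_riemann u : cdom c u ->
  [/\ perp u (chart_partial 1 c phi1 u) = J u (chart_partial 0 c phi1 u),
      perp u (chart_partial 1 c phi2 u) = J u (chart_partial 0 c phi2 u) &
      perp u (chart_partial 1 c psi u) = J u (chart_partial 0 c psi u)].
Proof.
move=> cu; have : ~ degenerate_at c u by move=> /(degenerate_planar cu).
move=> /not_orP[/contrapT phi1_t /contrapT phi2_t]; split; [exact: phi1_t|exact: phi2_t|].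
have [_] := c_isothermal cu; rewrite cross_perp_part.
rewrite (chart_partial_iota 0 r cc cu) (chart_partial_iota 1 r cc cu).
move: phi1_t phi2_t; move: (chart_partial 1 c phi1 u) (chart_partial 1 c phi2 u) => b1 b2.
move: (chart_partial 0 c phi1 u) (chart_partial 0 c phi2 u) => a1 a2 phi1_t phi2_t.
by rewrite !perp_partD !perp_partZ !crossD3 !crossZ3 phi1_t phi2_t => /addrI.
Qed.

Lemma isothermal_sl_equations u : cdom c u ->
  sl_equations c (fun v => inner (phi2 v) (chart_partial 1 c phi1 v))
    (fun v => inner (phi1 v) (chart_partial 1 c psi v))
    (fun v => inner (phi2 v) (chart_partial 1 c psi v)) u.
Proof.
move=> cu; have [w_phi w1 w2] := omega_chart_partial 0 cc cu.
have [phi1_t phi2_t psi_t] := perp_cauchy_riemann cu.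
have phi1_unit v : inner (phi1 v) (phi1 v) = 1 by have [] := phi_orthonormal v.
have phi2_unit v : inner (phi2 v) (phi2 v) = 1 by have [] := phi_orthonormal v.
have phi_orthogonal v : inner (phi1 v) (phi2 v) = 0 by have [] := phi_orthonormal v.
have phi11 : inner (phi1 u) (chart_partial 1 c phi1 u) = 0.
  by have := partial_inner_cst 1 phi1_analytic phi1_analytic phi1_unit cu; rewrite innerC; lra.
have phi22 : inner (phi2 u) (chart_partial 1 c phi2 u) = 0.
  by have := partial_inner_cst 1 phi2_analytic phi2_analytic phi2_unit cu; rewrite innerC; lra.
have phi12 : inner (phi1 u) (chart_partial 1 c phi2 u)
    = - inner (phi2 u) (chart_partial 1 c phi1 u).
  have := partial_inner_cst 1 phi1_analytic phi2_analytic phi_orthogonal cu.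
  by move=> /eqP; rewrite addrC addr_eq0 => /eqP ->; congr (- _); exact: innerC.
split; [exact: w_phi|by split| | |].
- rewrite [LHS](perp_part_decomp (phi1 u) (phi2 u)) phi1_t phi11.
  by rewrite scale0r addr0.
- rewrite [LHS](perp_part_decomp (phi1 u) (phi2 u)) phi2_t phi22 phi12.
  by rewrite scale0r addr0 scaleNr.
- by rewrite [LHS](perp_part_decomp (phi1 u) (phi2 u)) psi_t.
Qed.

End IsothermalCoordinates.

Theorem special_lagrangian_sl_equations : connected [set: S] -> ~ planar phi1 phi2 psi ->
  forall u0, exists c f g1 g2,
    [/\ cdom c u0, oriented_coordinates phi1 phi2 psi c,
        [/\ analytic_on_chart c f, analytic_on_chart c g1 & analytic_on_chart c g2] &
        forall u, cdom c u -> sl_equations c f g1 g2 u].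
Proof.
move=> S_connected M_nonplanar u0; have [c [r0 [cc cu0 c_isothermal]]] := isothermal_coordinates u0.
have equations := isothermal_sl_equations cc c_isothermal S_connected M_nonplanar.
exists c, (fun v => inner (phi2 v) (chart_partial 1 c phi1 v)),
  (fun v => inner (phi1 v) (chart_partial 1 c psi v)),
  (fun v => inner (phi2 v) (chart_partial 1 c psi v)).
split; [exact: cu0| |by split; exact: inner_chart_partial_analytic|exact: equations].
split=> // u r cu im; rewrite Cayley_isotropic.
- exact: (sl_equations_ReOmega_gt0 special_lagrangian_isotropic cc cu (equations u cu) im).
- exact: special_lagrangian_isotropic.
- exact: (omega_chart_partial_iota 0 r cc cu).1.
- exact: (omega_chart_partial_iota 1 r cc cu).1.
Qed.

End FromSpecialLagrangian.

End RuledFourfold.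

Theorem theorem4p8 (R : realType) (S : analyticSurface R)
    (phi1 phi2 psi : S -> 'rV[R]_8)
    (S_connected : connected [set: S])
    (phi1_analytic : analytic_map phi1)
    (phi2_analytic : analytic_map phi2)
    (psi_analytic : analytic_map psi)
    (phi1_unit : forall u, inner (phi1 u) (phi1 u) = 1)
    (phi2_unit : forall u, inner (phi2 u) (phi2 u) = 1)
    (phi_orthogonal : forall u, inner (phi1 u) (phi2 u) = 0)
    (M_singularities : singularities_nowhere_dense phi1 phi2 psi)
    (M_nonplanar : ~ planar phi1 phi2 psi) :
  special_lagrangian phi1 phi2 psi
  <->
  (forall u, omega (phi1 u) (phi2 u) = 0) /\
  (forall u0 : S, exists (c : chart R S) (f g1 g2 : S -> R),
     [/\ cdom c u0,
         oriented_coordinates phi1 phi2 psi c,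
         [/\ analytic_on_chart c f, analytic_on_chart c g1
           & analytic_on_chart c g2] &
         forall u, cdom c u ->
           [/\ [/\ omega (phi1 u) (partial_s c phi1 u) = 0,
                   omega (phi1 u) (partial_s c phi2 u) = 0,
                   omega (phi2 u) (partial_s c phi1 u) = 0
                 & omega (phi2 u) (partial_s c phi2 u) = 0],
               omega (phi1 u) (partial_s c psi u) = 0
               /\ omega (phi2 u) (partial_s c psi u) = 0,
               partial_t c phi1 u
                 = cross (phi1 u) (phi2 u) (partial_s c phi1 u) + f u *: phi2 u,
               partial_t c phi2 u
                 = cross (phi1 u) (phi2 u) (partial_s c phi2 u) - f u *: phi1 u
             & partial_t c psi u
                 = cross (phi1 u) (phi2 u) (partial_s c psi u)
                   + g1 u *: phi1 u + g2 u *: phi2 u]]).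
Proof.
have phi_orthonormal u : orthonormal_pair (phi1 u) (phi2 u) by split.
split=> [M_special_lagrangian|[phi_isotropic equations]].
  split; last exact: special_lagrangian_sl_equations.
  exact: special_lagrangian_isotropic M_singularities M_special_lagrangian.
apply: sl_equations_special_lagrangian => // u0.
have [c [f [g1 [g2 [cu [cc _] _ eqs]]]]] := equations u0.
by exists c, f, g1, g2.
Qed.
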